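(* For $n\ge1$ let $$\tilde\omega_n:=\underbrace{\chi_{[0,1]}dx*\cdots*\chi_{[0,1]}dx}_{n-1}*d\mu_n,$$ where $\chi_{[0,1]}$ is the characteristic function of $[0,1]$ and $d\mu_n$ is the discrete measure associated to the external activity polynomial $R_{K_n}(q)$ of the complete graph $K_n$ (so $\tilde\omega_n$ has total mass $R_{K_n}(1)=n^{n-2}$). Then, appropriately scaled, the distributions $\tilde\omega_n$ converge to the Airy distribution as $n\to\infty$; precisely, the probability measures obtained from $n^{-(n-2)}\tilde\omega_n$ by rescaling the real line by $x\mapsto x/n^{3/2}$ converge in distribution to the Airy distribution.
   Context: External activity polynomial: for a connected graph $Q$, $R_Q(q):=\sum_{Q'\subseteq Q}(q-1)^{b_1(Q')}$, the sum over all connected subgraphs $Q'$ with the same vertex set as $Q$, where $b_1$ is the first Betti number; $R_Q$ has non-negative integer coefficients. To a polynomial $E(q)=\sum_ie_iq^i$ with non-negative real coefficients associate the discrete measure $d\mu_E$ with $\int\phi\,d\mu_E=\sum_i\phi(i)e_i$. Here $*$ is additive convolution of measures on $\mathbb{R}$ (an empty convolution being the unit mass at $0$). Convergence in distribution means convergence of cumulative distribution functions at all points of continuity of the limit. Airy distribution: define $c_k$ by $\sum_{k\ge1}c_kT^k=\log\sum_{n\ge0}\frac{(1/6)_n(5/6)_n}{n!}\left(\frac32T\right)^n$, where $(a)_n=a(a+1)\cdots(a+n-1)$, and set $\rho_{-1}:=1$, $\rho_0:=\frac{\sqrt{2\pi}}4$, $\rho_k:=\frac{\sqrt\pi}{2^{(3k-1)/2}\,\Gamma(3k/2)}c_k$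 for $k\ge1$. The Airy distribution is the probability measure on $\mathbb{R}$ uniquely determined by having $k$-th moment $k!\,\rho_{k-1}$ for all $k\ge0$. *)

(* Defs.v *)
From HB Require Import structures.
From mathcomp Require Import all_boot all_order all_algebra.
From mathcomp Require Import all_classical all_reals all_analysis.
From mathcomp Require Import measurable_realfun lra.

Set Implicit Arguments.
Unset Strict Implicit.
Unset Printing Implicit Defensive.

Import Order.TTheory GRing.Theory Num.Theory.
Import numFieldNormedType.Exports.

Local Open Scope ring_scope.

(* A simple graph on the vertex type [T] is given by its set of edges, each
   edge being a two-element set of vertices; a subgraph with the same vertex
   set is then a subset of the set of edges. *)

Section Graphs.
Variable T : finType.
Implicit Types Q : {set {set T}}.

Definition adjacent Q : rel T := [rel x y | (x != y) && ([set x; y] \in Q)].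

Definition connected_graph Q : bool :=
  [forall x, forall y, connect (adjacent Q) x y].

(* The cellular boundary map C_1 -> C_0, acting on row vectors of coefficients.
   An edge {u, v} with enum_rank u < enum_rank v is oriented from u to v and
   is mapped to v - u. *)
Definition boundary_mx Q : 'M[rat]_(#|Q|, #|T|) :=
  \matrix_(i < #|Q|, j < #|T|)
    let e : {set T} := enum_val i in
    let v : T := enum_val j in
    if v \notin e then 0
    else if [exists u in e, (enum_rank u < enum_rank v)%N] then 1 else -1.

(* A graph has no cells of dimension 2, so H_1 is the kernel of the boundary
   map. *)
Definition betti1 Q : nat := \rank (kermx (boundary_mx Q)).

Definition ext_activity_poly Q : {poly int} :=
  \sum_(Q' : {set {set T}} | (Q' \subset Q) && connected_graph Q')
    ('X - 1) ^+ betti1 Q'.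

End Graphs.

Definition complete_graph (n : nat) : {set {set 'I_n}} :=
  [set e : {set 'I_n} | #|e| == 2].

Local Notation finite_measureR R :=
  {finite_measure set (measurableTypeR R) -> \bar R}.

Section DiscreteMeasure.
Variable R : realType.
Implicit Types E : {poly R}.

(* The absolute value makes the definition total: the coefficients are meant to
   be non-negative, and then it changes nothing (integral_discrete_measure). *)
Definition discrete_measure E : set (measurableTypeR R) -> \bar R :=
  msum (fun i : nat => mscale `|E`_i|%:nng (dirac (i%:R : measurableTypeR R)))
       (size E).

HB.instance Definition _ E := Measure.on (discrete_measure E).

Let discrete_measure_fin E : fin_num_fun (discrete_measure E).
Proof.
move=> A mA; rewrite /discrete_measure /msum; apply/sum_fin_numP => /= i _ _.
by rewrite /mscale fin_numM// diracE.
Qed.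

HB.instance Definition _ E :=
  Measure_isFinite.Build _ _ _ (discrete_measure E) (@discrete_measure_fin E).

Let ge0_integral_discrete_measure E (f : measurableTypeR R -> \bar R) :
    (forall i, 0 <= E`_i) -> measurable_fun [set: measurableTypeR R] f -> (forall x, 0 <= f x)%E ->
  (\int[discrete_measure E]_x f x = \sum_(i < size E) (E`_i)%:E * f i%:R)%E.
Proof.
move=> E0 mf f0; rewrite /discrete_measure ge0_integral_measure_sum//.
apply: eq_bigr => i _.
by rewrite ge0_integral_mscale//= integral_dirac// diracT mul1e ger0_norm.
Qed.

Lemma integral_discrete_measure E (phi : measurableTypeR R -> R) :
    (forall i, 0 <= E`_i) -> measurable_fun [set: measurableTypeR R] phi ->
  (\int[discrete_measure E]_x (phi x)%:E =
    (\sum_(i < size E) phi i%:R * E`_i)%:E)%E.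
Proof.
move=> E0 mphi.
have mphiE : measurable_fun [set: measurableTypeR R] (EFin \o phi) by exact: measurableT_comp.
rewrite integralE !ge0_integral_discrete_measure//; last 2 first.
- exact: measurable_funeneg.
- exact: measurable_funepos.
rewrite (eq_bigr (fun i : 'I_(size E) => (E`_i * Num.max (phi i%:R) 0)%:E)).
  rewrite [X in (_ - X)%E](eq_bigr
    (fun i : 'I_(size E) => (E`_i * Num.max (- phi i%:R) 0)%:E)).
    rewrite !sumEFin -EFinB -sumrB; congr (_%:E); apply: eq_bigr => i _.
    rewrite -mulrBr mulrC; congr (_ * _).
    by do 2 case: ltP => ?; lra.
  by move=> i _; rewrite EFinM EFin_max EFinN funenegE.
by move=> i _; rewrite EFinM EFin_max funeposE.
Qed.

End DiscreteMeasure.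

Section Convolution.
Variable R : realType.
Local Notation mR := (measurableTypeR R).
Implicit Types mu nu : finite_measureR R.

Definition addR_pair (p : mR * mR) : mR := (p.1 + p.2)%R.

Let measurable_addR_pair : measurable_fun [set: mR * mR] (addR_pair : _ -> mR).
Proof. exact: (measurable_funD measurable_fst measurable_snd). Qed.

HB.instance Definition _ :=
  @isMeasurableFun.Build _ _ (mR * mR)%type mR addR_pair measurable_addR_pair.

Definition convolution mu nu : set mR -> \bar R :=
  pushforward (mu \x nu)%E addR_pair.

Let convolution0 mu nu : convolution mu nu set0 = 0%E.
Proof. exact: measure0. Qed.

Let convolution_ge0 mu nu A : (0 <= convolution mu nu A)%E.
Proof. exact: measure_ge0. Qed.

Let convolution_sigma_additive mu nu :
  semi_sigma_additive (convolution mu nu).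
Proof. exact: measure_semi_sigma_additive. Qed.

HB.instance Definition _ mu nu := isMeasure.Build _ _ _ (convolution mu nu)
  (@convolution0 mu nu) (@convolution_ge0 mu nu)
  (@convolution_sigma_additive mu nu).

Let convolution_fin mu nu : fin_num_fun (convolution mu nu).
Proof.
apply: lty_fin_num_fun; rewrite /= /convolution /pushforward preimage_setT.
rewrite (_ : setT = [set: mR] `*` [set: mR])%classic; last by rewrite setXTT.
rewrite product_measure1E//.
by rewrite ltey_eq fin_numM// fin_num_measure.
Qed.

HB.instance Definition _ mu nu :=
  Measure_isFinite.Build _ _ _ (convolution mu nu) (@convolution_fin mu nu).

Definition convolution_power mu (n : nat) : finite_measureR R :=
  iter n (fun nu => convolution mu nu : finite_measureR R) (dirac (0 : mR)).

Let unit_interval : set mR := `[0%R, 1%R]%classic.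

Let measurable_unit_interval : measurable unit_interval.
Proof. exact: measurable_itv. Qed.

Let lebesgue_unit_interval_lty : (lebesgue_measure unit_interval < +oo)%E.
Proof. by rewrite lebesgue_measure_itv/= lte_fin ltr01 -EFinD ltry. Qed.

(* chi_[0,1] dx *)
Definition unit_interval_measure : finite_measureR R :=
  mfrestr measurable_unit_interval lebesgue_unit_interval_lty.

End Convolution.

Section Omega.
Variable R : realType.

Definition tilde_omega (n : nat) : finite_measureR R :=
  convolution (convolution_power (unit_interval_measure R) n.-1)
    (discrete_measure (map_poly intr (ext_activity_poly (complete_graph n)))).

Definition rescaled_omega (n : nat) (A : set (measurableTypeR R)) : \bar R :=
  ((n%:R ^ (- (n%:Z - 2)))%:E *
   pushforward (tilde_omega n)
     (fun x : measurableTypeR R => (x / n%:R `^ (3 / 2))%R : measurableTypeR R) A)%E.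

Definition cvg_in_distribution
    (mu_ : nat -> set (measurableTypeR R) -> \bar R)
    (mu : set (measurableTypeR R) -> \bar R) : Prop :=
  forall x : R, {for x, continuous (fun t : R => mu `]-oo, t]%classic)} ->
    (mu_ n `]-oo, x]%classic @[n --> \oo] --> mu `]-oo, x]%classic)%classic.

End Omega.
Arguments tilde_omega : clear implicits.
Arguments rescaled_omega : clear implicits.

Section Airy.
Variable R : realType.

Definition pochhammer (a : R) (n : nat) : R := \prod_(i < n) (a + i%:R).

(* Coefficient of T^k in log A(T) = \sum_(j >= 1) (-1)^(j-1) (A(T) - 1)^j / j for
   a formal power series A(T) = \sum_n a_n T^n with a_0 = 1; only the terms
   j <= k, and the a_n with n <= k, contribute to it. *)
Definition fps_log (a : nat -> R) (k : nat) : R :=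
  \sum_(1 <= j < k.+1)
    (-1) ^+ j.-1 / j%:R * ((\poly_(n < k.+1) a n - 1) ^+ j)`_k.

Definition airy_c (k : nat) : R :=
  fps_log (fun n => pochhammer (1 / 6) n * pochhammer (5 / 6) n / n`!%:R
                    * (3 / 2) ^+ n) k.

Definition Gamma (s : R) : R :=
  \int[lebesgue_measure]_(t in `]0%R, +oo[%classic)
    (t `^ (s - 1) * expR (- t)).

Definition airy_rho (k : int) : R :=
  match k with
  | Negz _ => 1 (* only k = -1 matters *)
  | Posz 0 => Num.sqrt (2 * pi) / 4
  | Posz k => Num.sqrt pi / (2 `^ ((3 * k%:R - 1) / 2) * Gamma (3 * k%:R / 2))
              * airy_c k
  end.

Definition has_airy_moments (P : probability (measurableTypeR R) R) : Prop :=
  forall k : nat,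
    (\int[P]_x (x ^+ k)%:E = (k`!%:R * airy_rho (k%:Z - 1))%:E)%E.

(* Exactly one probability measure has these moments, so [get] chooses it; the
   default value of [get] plays no role. *)
Definition airy_distribution : probability (measurableTypeR R) R :=
  get (has_airy_moments : set (probability (measurableTypeR R) R)).

End Airy.

(* Main.v *)
From HB Require Import structures.
From mathcomp Require Import all_boot all_order all_algebra.
From mathcomp Require Import all_classical all_reals all_analysis.
From mathcomp Require Import measurable_realfun ring lra zify.
Require Import Defs.

Set Implicit Arguments.
Unset Strict Implicit.
Unset Printing Implicit Defensive.

Import Order.TTheory GRing.Theory Num.Theory.
Import numFieldNormedType.Exports.

Local Open Scope ring_scope.

(** The proof is by moments. If a graph is weighted by $(q-1)^{|E|}$, the series $\sum_n q^{\binom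
    n2}x^n/n!$ is the exponential of the generating series of connected graphs ([deriv_all_egf]). A
    connected graph on $n$ vertices has $b_1=|E|-n+1$, so the connected graphs contribute
    $(q-1)^{n-1}R_{K_n}(q)$. At $q=e^s$ the factor $(e^s-1)^{n-1}$ is $s^{n-1}$ times the $(n-1)$-st
    power of the moment generating function of the uniform law. The logarithm of the graph series
    therefore records exactly the moments of $\tilde\omega_n$ ([conn_poly_exps],
    [has_moments_omega]).

    After the substitution $x\mapsto e^{s/2}x$ the graph series is $\sum_n e^{sn^2/2}x^n/n!$, which
    solves a heat equation, and its logarithm solves the corresponding quadratic equation
    ([sderiv_log_egf]). Sorting by the powers $s^{n-1+k}$ gives Wright's recursion for the series
    $W_k$ of excess $k$ ([excess_rec]). Let $T$ be the tree function and $z=1/(1-T)$. For $k\ge2$,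
    $W_k$ is a polynomial in $z$ of degree $3(k-1)$. The leading coefficients obey the Riccati
    recursion of the logarithm of the Airy series, so they are the $c_{k-1}$ ([tree_span_excess]).
    The coefficients of $z^m$ have explicit asymptotics with a Gamma value at a half-integer
    ([tau_scaled_cvg]). Together these facts give convergence of all rescaled moments to
    $k!\,\rho_{k-1}$ ([scaled_moments_cvg]).

    The limit moments $m_n$ satisfy $h^nm_n/n!\to0$ for every $h$ ([airy_moments_growth]). Hence on
    $[0,\infty[$ indicators of half-lines can be squeezed between polynomials with nearly equal
    means ([poly_sandwich]), and distribution functions are controlled by moments ([cdfR_sandwich]).
    This control produces a law with the limit moments ([has_moments_limit]), so that
    [airy_distribution] really has them. Any law with these moments lives on $[0,\infty[$
    ([moments_support]), so it can be compared with the rescaled measures by the same squeeze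
    ([cdfR_scaled_cvg]). *)

(** * Hurwitz series *)

(* Sequences with the binomial convolution as product, i.e. exponential
   generating functions without any division: f stands for \sum_n f n x^n / n!. *)
Definition hurwitz (K : Type) : Type := nat -> K.

HB.instance Definition _ (K : choiceType) := gen_eqMixin (hurwitz K).
HB.instance Definition _ (K : choiceType) := gen_choiceMixin (hurwitz K).

Section HurwitzRing.
Variable K : comNzRingType.
Implicit Types f g h : hurwitz K.
Local Notation H := (hurwitz K).

Definition hz_add f g : H := fun n => f n + g n.
Definition hz_opp f : H := fun n => - f n.
Definition hz_zero : H := fun _ => 0.
Definition hz_const (c : K) : H := fun n => if n is 0%N then c else 0.
Definition hz_mul f g : H := fun n => \sum_(i < n.+1) (f i * g (n - i)%N) *+ 'C(n, i).

Fact hz_addA : associative hz_add.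
Proof. by move=> f g h; apply/funext => n; exact: addrA. Qed.
Fact hz_addC : commutative hz_add.
Proof. by move=> f g; apply/funext => n; exact: addrC. Qed.
Fact hz_add0 : left_id hz_zero hz_add.
Proof. by move=> f; apply/funext => n; exact: add0r. Qed.
Fact hz_addN : left_inverse hz_zero hz_opp hz_add.
Proof. by move=> f; apply/funext => n; exact: addNr. Qed.

HB.instance Definition _ := GRing.isZmodule.Build H hz_addA hz_addC hz_add0 hz_addN.

Definition hz_shift f : H := fun n => f n.+1.

Fact hz_mul_at0 f g : hz_mul f g 0%N = f 0%N * g 0%N.
Proof. by rewrite /hz_mul big_ord1 subn0 bin0. Qed.

(** Pascal's rule makes the shift a derivation. Commutativity and associativity then follow by
    induction on the index. *)
Fact hz_mulS f g n :
  hz_mul f g n.+1 = hz_mul (hz_shift f) g n + hz_mul f (hz_shift g) n.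
Proof.
rewrite /hz_mul big_ord_recl bin0 subn0 mulr1n.
under eq_bigr => i _ do rewrite lift0 binS mulrnDr subSS.
rewrite big_split /= addrA addrC; congr (_ + _).
rewrite [in LHS]big_ord_recr/= bin_small// mulr0n addr0.
rewrite [in RHS]big_ord_recl bin0 subn0 mulr1n; congr +%R.
apply: eq_bigr => i _; rewrite lift0 /hz_shift; congr (_ * g _ *+ _).
by have := ltn_ord i; lia.
Qed.

Fact hz_mulDl : left_distributive hz_mul hz_add.
Proof.
move=> f g h; apply/funext => n; rewrite /hz_mul /hz_add -big_split /=.
by apply: eq_bigr => i _; rewrite mulrDl mulrnDl.
Qed.

Fact hz_mulC : commutative hz_mul.
Proof.
move=> f g; apply/funext => n; elim: n f g => [|n IHn] f g.
  by rewrite !hz_mul_at0 mulrC.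
by rewrite !hz_mulS addrC IHn [X in _ + X]IHn.
Qed.

Fact hz_mulA : associative hz_mul.
Proof.
have shiftM f g : hz_shift (hz_mul f g)
    = hz_add (hz_mul (hz_shift f) g) (hz_mul f (hz_shift g)).
  by apply/funext => n; rewrite /hz_shift hz_mulS.
have hz_mulDr f g h : hz_mul f (hz_add g h) = hz_add (hz_mul f g) (hz_mul f h).
  by rewrite hz_mulC hz_mulDl hz_mulC (hz_mulC h).
move=> f g h; apply/funext => n; elim: n f g h => [|n IHn] f g h.
  by rewrite !hz_mul_at0 mulrA.
rewrite !hz_mulS !shiftM hz_mulDr hz_mulDl /hz_add.
by rewrite !IHn addrA.
Qed.

Fact hz_mul1 : left_id (hz_const 1) hz_mul.
Proof.
move=> f; apply/funext => n; rewrite /hz_mul big_ord_recl big1 ?addr0.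
  by rewrite bin0 mulr1n mul1r subn0.
by move=> i _; rewrite mul0r mul0rn.
Qed.

Fact hz_one_neq0 : hz_const 1 != 0.
Proof.
by apply/eqP => /(congr1 (fun f => f 0%N)) /=; apply/eqP; exact: oner_neq0.
Qed.

HB.instance Definition _ := GRing.Zmodule_isComNzRing.Build H
  hz_mulA hz_mulC hz_mul1 hz_mulDl hz_one_neq0.

Lemma hzD f g n : (f + g) n = f n + g n. Proof. by []. Qed.
Lemma hzN f n : (- f) n = - f n. Proof. by []. Qed.
Lemma hz0 n : (0 : H) n = 0. Proof. by []. Qed.
Lemma hz1 n : (1 : H) n = (n == 0%N)%:R. Proof. by case: n. Qed.
Lemma hzM f g n : (f * g) n = \sum_(i < n.+1) (f i * g (n - i)%N) *+ 'C(n, i).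
Proof. by []. Qed.
Lemma hzM0 f g : (f * g) 0%N = f 0%N * g 0%N.
Proof. exact: hz_mul_at0. Qed.
Lemma hz_sum I (r : seq I) (P : pred I) (F : I -> H) n :
  (\sum_(i <- r | P i) F i) n = \sum_(i <- r | P i) F i n.
Proof. by elim/big_rec2: _ => //= i x y _ <-; rewrite hzD. Qed.
Lemma hzMn f m n : (f *+ m) n = f n *+ m.
Proof. by elim: m => // m IHm; rewrite !mulrS hzD IHm. Qed.

Fact hz_const_additive : {morph hz_const : x y / x - y}.
Proof. by move=> a b; apply/funext => -[//|n]; rewrite hzD hzN /= subrr. Qed.
HB.instance Definition _ :=
  GRing.isZmodMorphism.Build K H hz_const hz_const_additive.

Lemma hz_constM c f n : (hz_const c * f) n = c * f n.
Proof.
rewrite hzM big_ord_recl big1 ?addr0 ?bin0 ?subn0//.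
by move=> i _; rewrite mul0r mul0rn.
Qed.

Fact hz_const_multiplicative : monoid_morphism hz_const.
Proof.
split=> // a b; apply/funext => n; rewrite hz_constM.
by case: n => //= n; rewrite mulr0.
Qed.
HB.instance Definition _ :=
  GRing.isMonoidMorphism.Build K H hz_const hz_const_multiplicative.

(* The derivation d/dx. *)
Definition hz_deriv f : H := hz_shift f.

Lemma hz_derivE f n : hz_deriv f n = f n.+1. Proof. by []. Qed.

Lemma hz_derivM f g : hz_deriv (f * g) = hz_deriv f * g + f * hz_deriv g.
Proof. by apply/funext => n; exact: hz_mulS. Qed.

(* The derivation x d/dx. *)
Definition hz_euler f : H := fun n => f n *+ n.

Lemma hz_eulerE f n : hz_euler f n = f n *+ n. Proof. by []. Qed.

Fact hz_euler_additive : {morph hz_euler : x y / x - y}.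
Proof. by move=> f g; apply/funext => n; rewrite /hz_euler !hzD !hzN mulrnBl. Qed.
HB.instance Definition _ :=
  GRing.isZmodMorphism.Build H H hz_euler hz_euler_additive.

Lemma hz_eulerD f g : hz_euler (f + g) = hz_euler f + hz_euler g.
Proof. exact: raddfD. Qed.
Lemma hz_eulerB f g : hz_euler (f - g) = hz_euler f - hz_euler g.
Proof. exact: raddfB. Qed.
Lemma hz_eulerMn f m : hz_euler (f *+ m) = hz_euler f *+ m.
Proof. exact: raddfMn. Qed.

Lemma hz_eulerM f g : hz_euler (f * g) = hz_euler f * g + f * hz_euler g.
Proof.
apply/funext => n; rewrite hzD !hzM hz_eulerE hzM -sumrMnl -big_split /=.
apply: eq_bigr => i _; rewrite !hz_eulerE mulrnAl mulrnAr -!mulrnA -mulrnDr.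
by congr (_ *+ _); rewrite -mulnDl mulnC subnKC// -ltnS.
Qed.

Lemma hz_euler_const c : hz_euler (hz_const c) = 0.
Proof. by apply/funext => -[|n]; rewrite hz_eulerE ?mulr0n //= mul0rn. Qed.

Lemma hz_euler1 : hz_euler 1 = 0.
Proof. exact: hz_euler_const. Qed.

Lemma hz_eulerX f m : hz_euler (f ^+ m) = hz_euler f * f ^+ m.-1 *+ m.
Proof.
case: m => [|m]; first by rewrite hz_euler1 mulr0n.
elim: m => [|m IHm]; first by rewrite expr1 expr0 mulr1.
rewrite exprS hz_eulerM IHm [in RHS]mulrS; congr (_ + _).
by rewrite mulrnAr /= mulrCA -exprS.
Qed.

(* The substitution x := q x. *)
Definition hz_dilate (q : K) f : H := fun n => q ^+ n * f n.

Lemma hz_dilateM q f g : hz_dilate q (f * g) = hz_dilate q f * hz_dilate q g.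
Proof.
apply/funext => n; rewrite /hz_dilate !hzM mulr_sumr; apply: eq_bigr => i _.
rewrite mulrnAr mulrACA -exprD subnKC//; exact: ltn_ord i.
Qed.

(** Cancellation uses only the constant term 1, so [K] may be any commutative ring, in particular
    another Hurwitz ring. *)
Lemma hz_mulIr f g : f 0%N = 1 -> g * f = 0 -> g = 0.
Proof.
move=> f0 gf; apply/funext => n; elim/ltn_ind: n => n IHn.
have := congr1 (fun h : H => h n) gf; rewrite hzM big_ord_recr /= subnn f0 mulr1.
rewrite binn mulr1n big1 ?add0r// => i _.
by rewrite IHn ?hz0 ?mul0r ?mul0rn.
Qed.

Lemma hz_mulrI f g h : f 0%N = 1 -> g * f = h * f -> g = h.
Proof.
move=> f0 /eqP; rewrite -subr_eq0 -mulrBl => /eqP /(hz_mulIr f0) /eqP.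
by rewrite subr_eq0 => /eqP.
Qed.

Definition hz_exp (a : K) : H := fun n => a ^+ n.

Lemma hz_expD a b : hz_exp (a + b) = hz_exp a * hz_exp b.
Proof.
apply/funext => n; rewrite hzM /hz_exp addrC exprDn; apply: eq_bigr => i _.
by rewrite mulrC.
Qed.

Lemma hz_exp0 : hz_exp 0 = 1.
Proof. by apply/funext => n; rewrite /hz_exp hz1; case: n => [|n]; rewrite ?expr0 ?exprS ?mul0r. Qed.

Lemma hz_expMn a n : hz_exp (a *+ n) = hz_exp a ^+ n.
Proof.
elim: n => [|n IHn]; first by rewrite hz_exp0.
by rewrite mulrS hz_expD IHn exprS.
Qed.

Lemma hz_deriv_exp a : hz_deriv (hz_exp a) = hz_const a * hz_exp a.
Proof. by apply/funext => n; rewrite hz_constM hz_derivE /hz_exp exprS. Qed.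

(* The variable x. *)
Definition hz_X : H := fun n => (n == 1%N)%:R.

Lemma hzXM f n : (hz_X * f) n = f n.-1 *+ n.
Proof.
rewrite hzM; case: n => [|n]; first by rewrite big_ord1 mul0r mulr0n mul0rn.
rewrite big_ord_recl mul0r mul0rn add0r big_ord_recl/= mul1r bin1 subSS subn0.
by rewrite big1 ?addr0// => i _; rewrite mul0r mul0rn.
Qed.

Lemma hzXnM f k n : (hz_X ^+ k * f) (k + n)%N = f n *+ ((k + n) ^_ k).
Proof.
elim: k f => [|k IHk] f; first by rewrite expr0 mul1r ffactn0 mulr1n add0n.
by rewrite exprS -mulrA hzXM addSn /= IHk -mulrnA ffactnS /= mulnC.
Qed.

Lemma hzXnM_lt f k n : (n < k)%N -> (hz_X ^+ k * f) n = 0.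
Proof.
elim: k n => // k IHk [|n] nk; rewrite exprS -mulrA hzXM ?mulr0n//=.
by rewrite IHk ?mul0rn.
Qed.

End HurwitzRing.

(** * Connected graphs *)

Section ConnectedSum.
Variables (K : comNzRingType) (q : K).

Lemma connect_ind_set (T : finType) (e : rel T) (A : {set T}) (x y : T) :
  (forall a b, e a b -> a \in A -> b \in A) -> connect e x y -> x \in A -> y \in A.
Proof.
move=> eA /connectP[p]; elim: p x => [|z p IHp] x /=; first by move=> _ ->.
by case/andP => exz pz ly xA; apply: IHp pz ly _; apply: eA exz xA.
Qed.

Lemma adjacentE (T : finType) (Q : {set {set T}}) x y :
  adjacent Q x y = (x != y) && ([set x; y] \in Q).
Proof. by []. Qed.

Lemma adjacent_sym (T : finType) (Q : {set {set T}}) : symmetric (adjacent Q).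
Proof. by move=> x y; rewrite !adjacentE eq_sym finset.setUC. Qed.

Lemma connect_adjacent_sym (T : finType) (Q : {set {set T}}) :
  connect_sym (adjacent Q).
Proof. exact/sym_connect_sym/adjacent_sym. Qed.

Lemma sum_subsets_expr (U : finType) (A : {set U}) (a : K) :
  \sum_(B : {set U} | B \subset A) a ^+ #|B| = (1 + a) ^+ #|A|.
Proof.
rewrite exprDn.
rewrite (partition_big (fun B : {set U} => inord #|B| : 'I_(#|A|).+1) predT) //=.
apply: eq_bigr => i _; rewrite expr1n mul1r -cards_draws -[X in _ *+ X]sum1_card -sumrMnr.
rewrite (eq_bigl (fun B : {set U} => B \in [set B : {set U} | B \subset A & #|B| == i])).
  by apply: eq_bigr => B; rewrite inE => /andP[_ /eqP->].
move=> B; rewrite inE; case: (boolP (B \subset A)) => //= BA.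
by rewrite -val_eqE /= inordK// ltnS subset_leq_card.
Qed.

Definition pairs (T : finType) (S : {set T}) : {set {set T}} :=
  [set e : {set T} | e \subset S & #|e| == 2%N].

Lemma card_pairs (T : finType) (S : {set T}) : #|pairs S| = 'C(#|S|, 2).
Proof. exact: cards_draws. Qed.

Lemma in_pairs2 (T : finType) (S : {set T}) (x y : T) :
  x != y -> ([set x; y] \in pairs S) = (x \in S) && (y \in S).
Proof.
by move=> xy; rewrite inE cards2 xy andbT finset.subUset !finset.sub1set.
Qed.

Definition connected_on (T : finType) (S : {set T}) (Q : {set {set T}}) :=
  [forall x in S, forall y in S, connect (adjacent Q) x y].

Lemma connected_onP (T : finType) (S : {set T}) (Q : {set {set T}}) :
  reflect {in S &, forall x y, connect (adjacent Q) x y} (connected_on S Q).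
Proof.
apply: (iffP forall_inP) => [H x y xS yS|H x xS].
  by have /forall_inP := H x xS; apply.
by apply/forall_inP => y yS; exact: H.
Qed.

(** The exponent is the number of edges because this is additive over disjoint unions. On connected
    graphs it differs from the Betti number by a constant, see [betti1_connected]. *)
Definition conn_sum (T : finType) (S : {set T}) : K :=
  \sum_(Q : {set {set T}} | (Q \subset pairs S) && connected_on S Q) (q - 1) ^+ #|Q|.

Definition graph_sum (T : finType) (S : {set T}) : K :=
  \sum_(Q : {set {set T}} | Q \subset pairs S) (q - 1) ^+ #|Q|.

Lemma graph_sumE (T : finType) (S : {set T}) : graph_sum S = q ^+ 'C(#|S|, 2).
Proof. by rewrite /graph_sum sum_subsets_expr addrC subrK card_pairs. Qed.

Lemma pairsS (T : finType) (S U : {set T}) : U \subset S -> pairs U \subset pairs S.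
Proof.
by move=> US; apply/fintype.subsetP => e; rewrite !inE => /andP[eU ->]; rewrite (fintype.subset_trans eU).
Qed.

Lemma pairs_disjoint (T : finType) (S U : {set T}) :
  pairs U :&: pairs (S :\: U) = finset.set0.
Proof.
apply/setP => e; rewrite !inE; apply/negP => /andP[/andP[eU /eqP e2] /andP[eSU _]].
have /card_gt0P[x xe] : (0 < #|e|)%N by rewrite e2.
have := fintype.subsetP eSU x xe; rewrite inE => /andP[/negP xU _]; apply: xU.
exact: (fintype.subsetP eU).
Qed.

Definition component (T : finType) (S : {set T}) (v : T) (Q : {set {set T}}) :=
  [set y in S | connect (adjacent Q) v y].

Lemma component_setU (T : finType) (S U : {set T}) (v : T) (Q1 Q2 : {set {set T}}) :
  v \in U -> U \subset S -> Q1 \subset pairs U -> connected_on U Q1 ->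
  Q2 \subset pairs (S :\: U) -> component S v (Q1 :|: Q2) = U.
Proof.
move=> vU US Q1U /connected_onP cQ1 Q2U; apply/setP => y; rewrite inE.
apply/andP/idP => [[yS vy]|yU].
  apply: connect_ind_set vy vU => a b /andP[ab]; rewrite inE => /orP[] abQ aU.
    by have := fintype.subsetP Q1U _ abQ; rewrite in_pairs2// => /andP[].
  by have := fintype.subsetP Q2U _ abQ; rewrite in_pairs2// !inE aU.
split; first exact: fintype.subsetP US _ yU.
apply: connect_sub (cQ1 _ _ vU yU) => a b /andP[ab abQ]; apply: connect1.
by rewrite adjacentE ab inE abQ.
Qed.

(** No edge leaves the component of [v]. With [component_setU] this gives a bijection between graphs
    on [S] and triples of a set [U] containing [v], a connected graph on [U] and any graph on the
    complement. *)
Lemma component_split (T : finType) (S : {set T}) (v : T) (Q : {set {set T}}) :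
  v \in S -> Q \subset pairs S ->
  let U := component S v Q in
  connected_on U (Q :&: pairs U) /\
  Q = (Q :&: pairs U) :|: (Q :&: pairs (S :\: U)).
Proof.
move=> vS QS U.
have Uadj a b : adjacent Q a b -> a \in U -> b \in U.
  move=> ab; have /andP[nab abQ] := ab; rewrite !inE => /andP[aS va].
  have := fintype.subsetP QS _ abQ; rewrite in_pairs2// => /andP[_ ->] /=.
  exact: connect_trans va (connect1 ab).
split.
  have vx x : x \in U -> connect (adjacent (Q :&: pairs U)) v x.
    move=> xU; have /andP[_] : (x \in S) && connect (adjacent Q) v x by rewrite inE in xU.
    move=> vQx.
    suff : x \in [set y in U | connect (adjacent (Q :&: pairs U)) v y] by rewrite inE => /andP[].
    apply: connect_ind_set vQx _ => [a b ab|]; last by rewrite !inE vS !connect0.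
    rewrite finset.in_set => /andP[aU va].
    have bU := Uadj _ _ ab aU; rewrite finset.in_set bU /=; apply: connect_trans va (connect1 _).
    by have /andP[nab abQ] := ab; rewrite adjacentE nab inE abQ in_pairs2// aU.
  apply/connected_onP => x y xU yU; apply: connect_trans (vx y yU).
  by rewrite connect_adjacent_sym; exact: vx.
apply/setP => e; rewrite !finset.in_setU !finset.in_setI; case: (boolP (e \in Q)) => [eQ|_] //=; apply/esym.
have := fintype.subsetP QS _ eQ; rewrite inE => /andP[eS e2].
have /cards2P[a [b [nab eE]]] := e2; rewrite eE.
have ab : adjacent Q a b by rewrite adjacentE nab -eE.
have ba : adjacent Q b a by rewrite adjacent_sym.
rewrite !in_pairs2// [a \in S :\: U]finset.in_setD [b \in S :\: U]finset.in_setD.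
have /andP[-> ->] : (a \in S) && (b \in S) by rewrite -(in_pairs2 _ nab) -eE inE eS.
rewrite !andbT; case: (boolP (a \in U)) => [aU|aU]; first by rewrite (Uadj _ _ ab aU).
by case: (boolP (b \in U)) => // bU; rewrite (Uadj _ _ ba bU) in aU.
Qed.

(* Split a graph on S into the component of v and the rest. *)
Lemma graph_sum_component (T : finType) (S : {set T}) (v : T) : v \in S ->
  graph_sum S = \sum_(U : {set T} | (U \subset S) && (v \in U))
                   conn_sum U * graph_sum (S :\: U).
Proof.
move=> vS; rewrite /graph_sum.
rewrite (partition_big (component S v) (fun U => (U \subset S) && (v \in U)))/=; last first.
  move=> Q _; apply/andP; split; last by rewrite finset.in_set vS connect0.
  by apply/fintype.subsetP => x; rewrite finset.in_set => /andP[].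
apply: eq_bigr => U /andP[US vU].
rewrite /conn_sum big_distrlr/= pair_big/=.
rewrite (reindex_onto (fun Q : {set {set T}} * {set {set T}} => Q.1 :|: Q.2)
  (fun Q => (Q :&: pairs U, Q :&: pairs (S :\: U))))/=; last first.
  move=> Q /andP[QS /eqP cQ]; have [_] := component_split vS QS.
  by rewrite cQ.
have eqP1 (Q1 Q2 : {set {set T}}) : Q1 \subset pairs U -> Q2 \subset pairs (S :\: U) ->
    ((Q1 :|: Q2) :&: pairs U == Q1) && ((Q1 :|: Q2) :&: pairs (S :\: U) == Q2).
  move=> Q1U Q2U; rewrite !finset.setIUl (finset.setIidPl Q1U) (finset.setIidPl Q2U).
  have -> : Q2 :&: pairs U = finset.set0.
    apply/eqP; rewrite -finset.subset0 -(pairs_disjoint S U) finset.setIC finset.setIS//.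
  have -> : Q1 :&: pairs (S :\: U) = finset.set0.
    by apply/eqP; rewrite -finset.subset0 -(pairs_disjoint S U) finset.setSI.
  by rewrite finset.setU0 finset.set0U !eqxx.
apply: eq_big => -[Q1 Q2] /=.
  rewrite xpair_eqE; apply/andP/andP => [[/andP[QS /eqP cQ] /andP[/eqP e1 /eqP e2]]|].
    have [cU _] := component_split vS QS; rewrite cQ e1 in cU.
    have := finset.subsetIr (Q1 :|: Q2) (pairs U); rewrite e1 => ->.
    by have := finset.subsetIr (Q1 :|: Q2) (pairs (S :\: U)); rewrite e2 => ->.
  move=> [/andP[Q1U cQ1] Q2U]; rewrite eqP1//; split=> //.
  rewrite (component_setU vU US Q1U cQ1 Q2U) eqxx andbT finset.subUset.
  by rewrite (fintype.subset_trans Q1U) ?pairsS// (fintype.subset_trans Q2U)// pairsS// finset.subsetDl.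
move=> /andP[_ /eqP[e1 e2]]; rewrite -exprD cardsU.
suff -> : Q1 :&: Q2 = finset.set0 by rewrite cards0 subn0.
apply/eqP; rewrite -finset.subset0 -(pairs_disjoint S U).
apply: finset.setISS.
  by have := finset.subsetIr (Q1 :|: Q2) (pairs U); rewrite e1.
by have := finset.subsetIr (Q1 :|: Q2) (pairs (S :\: U)); rewrite e2.
Qed.

(** Invariance under relabelling, which makes [conn_sum] depend on the number of vertices only. *)
Lemma conn_sum_imset (T1 T2 : finType) (f : T1 -> T2) : injective f ->
  conn_sum (f @: [set: T1]) = conn_sum [set: T1].
Proof.
move=> finj.
have Finj : injective (fun e : {set T1} => f @: e) by exact: imset_inj.
pose h (Q : {set {set T1}}) := [set f @: (e : {set T1}) | e in Q].
pose h' (Q : {set {set T2}}) := [set e : {set T1} | f @: e \in Q].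
have hE (Q : {set {set T1}}) (e : {set T1}) : (f @: e \in h Q) = (e \in Q) by rewrite mem_imset.
have adjE (Q : {set {set T1}}) x y : adjacent (h Q) (f x) (f y) = adjacent Q x y.
  by rewrite !adjacentE (inj_eq finj) -hE imsetU !imset_set1.
have connE (Q : {set {set T1}}) x y :
    connect (adjacent (h Q)) (f x) (f y) = connect (adjacent Q) x y.
  apply/idP/idP => cxy.
    suff : f y \in [set f z | z in [set z | connect (adjacent Q) x z]].
      by rewrite mem_imset// inE.
    apply: connect_ind_set cxy _; last by rewrite mem_imset// inE connect0.
    move=> a b /[swap] /imsetP[z]; rewrite inE => xz ->{a} zb.
    have /andP[_ /imsetP[e eQ eE]] := zb.
    have /imsetP[w we bE] : b \in f @: e by rewrite -eE !inE eqxx orbT.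
    rewrite bE mem_imset// inE; apply: connect_trans xz (connect1 _).
    by rewrite -adjE -bE.
  suff : y \in [set z | connect (adjacent (h Q)) (f x) (f z)] by rewrite inE.
  apply: connect_ind_set cxy _; last by rewrite inE connect0.
  by move=> a b; rewrite !inE -adjE => ab xa; exact: connect_trans xa (connect1 ab).
rewrite /conn_sum (reindex_onto h h')/=.
  apply: eq_big => [Q|Q _]; last by rewrite card_imset.
  have -> : h' (h Q) == Q by apply/eqP/setP => e; rewrite inE hE.
  rewrite andbT; congr (_ && _).
    apply/fintype.subsetP/fintype.subsetP => H.
      by move=> e eQ; have := H (f @: e); rewrite hE !inE card_imset// finset.subsetT => /(_ eQ)/andP[].
    move=> _ /imsetP[e eQ ->]; have := H e eQ; rewrite !inE card_imset// => /andP[_ ->].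
    by rewrite imsetS// finset.subsetT.
  apply/connected_onP/connected_onP => H.
    by move=> x y _ _; rewrite -connE; apply: H; rewrite mem_imset// inE.
  by move=> _ _ /imsetP[x _ ->] /imsetP[y _ ->]; rewrite connE; apply: H; rewrite inE.
move=> Q /andP[QS _]; apply/setP => e; apply/imsetP/idP => [[e' + ->]|eQ].
  by rewrite inE.
have := fintype.subsetP QS _ eQ; rewrite inE => /andP[eS _].
have eE : e = f @: (f @^-1: e).
  apply/setP => y; apply/idP/imsetP => [ye|[x + ->]]; last by rewrite inE.
  by have /imsetP[x _ yE] := fintype.subsetP eS _ ye; exists x => //; rewrite inE -yE.
by exists (f @^-1: e) => //; rewrite inE -eE.
Qed.

Definition conn_poly n : K := conn_sum [set: 'I_n].

Lemma conn_sumE (T : finType) (S : {set T}) : conn_sum S = conn_poly #|S|.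
Proof.
rewrite /conn_poly -(conn_sum_imset (@enum_val_inj _ (mem S))); congr conn_sum.
apply/setP => x; apply/idP/imsetP => [xS|[i _ ->]]; last exact: enum_valP.
by exists (enum_rank_in xS x); rewrite ?enum_rankK_in// inE.
Qed.

(* Taking v to be a fixed vertex out of n + 1. *)
Lemma conn_poly_rec n :
  q ^+ 'C(n.+1, 2) = \sum_(j < n.+1) (conn_poly j.+1 * q ^+ 'C(n - j, 2)) *+ 'C(n, j).
Proof.
have -> : q ^+ 'C(n.+1, 2) = graph_sum [set: 'I_n.+1].
  by rewrite graph_sumE cardsT card_ord.
rewrite (@graph_sum_component _ _ ord0) ?inE//.
pose A : {set 'I_n.+1} := [set~ ord0].
have cA : #|A| = n by rewrite cardsC1 card_ord.
(* The component of [ord0] is [ord0 |: B] with [B] among the other [n] vertices, which gives $\binom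
   nj$ choices of size [j]. *)
rewrite (reindex_onto (fun B : {set 'I_n.+1} => ord0 |: B) (fun U => U :\ ord0))/=; last first.
  by move=> U /andP[_ U0]; rewrite finset.setD1K.
rewrite (eq_bigl (fun B : {set 'I_n.+1} => B \subset A)); last first.
  move=> B; rewrite finset.subsetT finset.setU11 /= /A finset.subsetC finset.sub1set inE.
  apply/eqP/idP => [<-|B0]; first by rewrite !inE eqxx.
  by rewrite finset.setU1K.
rewrite (partition_big (fun B : {set 'I_n.+1} => inord #|B| : 'I_n.+1) predT) //=.
apply: eq_bigr => j _.
rewrite (eq_bigl (fun B : {set 'I_n.+1} => B \in [set B : {set 'I_n.+1} | B \subset A & #|B| == j])); last first.
  move=> B; rewrite inE; case: (boolP (B \subset A)) => //= BA.
  by rewrite -val_eqE /= inordK// ltnS -[X in (_ <= X)%N]cA subset_leq_card.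
under eq_bigr => B.
  rewrite inE => /andP[BA /eqP cB].
  have B0 : ord0 \notin B by move: BA; rewrite /A finset.subsetC finset.sub1set inE.
  rewrite conn_sumE graph_sumE cardsU1 B0 cB add1n cardsD finset.setTI cardsU1 B0 cB cardsT card_ord.
  rewrite add1n subSS; over.
by rewrite sumr_const cards_draws cA.
Qed.

Lemma conn_poly1 : conn_poly 1 = 1.
Proof.
by have := conn_poly_rec 0; rewrite big_ord1 bin0 /= expr0 mulr1.
Qed.

(* \sum_n q^(n choose 2) x^n / n! *)
Definition all_egf : hurwitz K := fun n => q ^+ 'C(n, 2).

Definition conn_egf : hurwitz K := conn_poly.

(** The exponential formula, in logarithmic-derivative form so that no composition of series is
    needed. *)
Lemma deriv_all_egf : hz_deriv all_egf = hz_deriv conn_egf * all_egf.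
Proof. by apply/funext => n; rewrite hz_derivE hzM /all_egf conn_poly_rec. Qed.

End ConnectedSum.


(** * The first Betti number of a connected graph *)

Section Betti.

(** The transposed boundary is the coboundary: it maps a function on the vertices to its increments
    along the edges. *)
Lemma boundary_mx_sum (n : nat) (Q : {set {set 'I_n}}) (u : 'rV[rat]_#|'I_n|)
    (i : 'I_#|Q|) (a b : 'I_n) : (a < b)%N -> enum_val i = [set a; b] ->
  (u *m (boundary_mx Q)^T) 0 i = u 0 (enum_rank b) - u 0 (enum_rank a).
Proof.
move=> ab iE; rewrite mxE (reindex enum_rank)/=; last first.
  by exists enum_val => x _; rewrite ?enum_rankK ?enum_valK.
have nab : b != a by rewrite -val_eqE/= gtn_eqF.
rewrite (bigD1 b)//= (bigD1 a) 1?eq_sym//= big1 ?addr0.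
  have gb : [exists u0 in ([set a; b] : {set 'I_n}), (enum_rank u0 < enum_rank b)%N].
    by apply/exists_inP; exists a; rewrite ?inE ?eqxx// !enum_rank_ord.
  have ga : [exists u0 in ([set a; b] : {set 'I_n}), (enum_rank u0 < enum_rank a)%N] = false.
    apply/existsP => -[c /andP[]]; rewrite !inE !enum_rank_ord/=.
    by move=> /orP[]/eqP->; rewrite ?ltnn// ltnNge ltnW.
  rewrite !mxE iE !enum_rankK; cbv zeta; by rewrite gb ga !inE !eqxx orbT/= mulr1 mulrN1.
move=> c /andP[cb ca]; rewrite !mxE iE enum_rankK; cbv zeta; rewrite !inE (negbTE cb) (negbTE ca).
by rewrite mulr0.
Qed.

(** On a connected graph the kernel of the coboundary consists of the constant functions, so the
    boundary has rank [n]. *)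
Lemma betti1_connected (n : nat) (Q : {set {set 'I_n.+1}}) :
  Q \subset pairs [set: 'I_n.+1] -> connected_on [set: 'I_n.+1] Q ->
  (betti1 Q + n)%N = #|Q|.
Proof.
move=> QS /connected_onP cQ.
suff kE : \rank (kermx (boundary_mx Q)^T) = 1%N.
  have := mxrank_ker (boundary_mx Q)^T; rewrite kE mxrank_tr /betti1 mxrank_ker.
  have := rank_leq_row (boundary_mx Q); have := rank_leq_col (boundary_mx Q).
  by move: (\rank (boundary_mx Q)) => r; rewrite card_ord; lia.
pose J : 'rV[rat]_#|'I_n.+1| := const_mx 1.
have edgeP (i : 'I_#|Q|) : exists a b : 'I_n.+1, (a < b)%N /\ enum_val i = [set a; b].
  have iQ := enum_valP i; have := fintype.subsetP QS _ iQ.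
  rewrite inE => /andP[_ /cards2P[a [b [nab ->]]]].
  have [ab|ba|/val_inj abE] := ltngtP a b.
  - by exists a, b.
  - by exists b, a; rewrite finset.setUC.
  - by rewrite abE eqxx in nab.
have kJ : (J <= kermx (boundary_mx Q)^T)%MS.
  apply/sub_kermxP/rowP => i; have [a [b [ab iE]]] := edgeP i.
  by rewrite (boundary_mx_sum _ ab iE) !mxE subrr.
have Jk : (kermx (boundary_mx Q)^T <= J)%MS.
  apply/row_subP => k; set u := row k _.
  have /sub_kermxP u0 : (u <= kermx (boundary_mx Q)^T)%MS by exact: row_sub.
  have uadj (a b : 'I_n.+1) : (a < b)%N -> [set a; b] \in Q -> u 0 (enum_rank a) = u 0 (enum_rank b).
    move=> ab abQ; have := congr1 (fun A : 'rV_#|Q| => A 0 (enum_rank_in abQ [set a; b])) u0.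
    by rewrite /= (boundary_mx_sum _ ab) ?enum_rankK_in// [in RHS]mxE => /eqP; rewrite subr_eq0 => /eqP ->.
  have uE x : u 0 (enum_rank x) = u 0 (enum_rank ord0).
    suff : x \in [set y | u 0 (enum_rank y) == u 0 (enum_rank (ord0 : 'I_n.+1))] by rewrite inE => /eqP.
    apply: connect_ind_set (cQ ord0 x (finset.in_setT _) (finset.in_setT _)) _; last by rewrite inE.
    move=> a b; rewrite adjacentE !inE => /andP[nab abQ] /eqP <-; apply/eqP.
    have [ab|ba|/val_inj abE] := ltngtP a b.
    - by rewrite (uadj _ _ ab abQ).
    - by rewrite (uadj b a)// finset.setUC.
    - by rewrite abE.
  have -> : u = u 0 (enum_rank ord0) *: J.
    by apply/rowP => j; rewrite [RHS]mxE [J _ _]mxE mulr1 -(enum_valK j) uE.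
  exact: scalemx_sub.
apply/eqP; rewrite eqn_leq (leq_trans (mxrankS Jk))/= ?rank_leq_row//.
apply: leq_trans (mxrankS kJ); rewrite lt0n mxrank_eq0.
by apply/eqP => /rowP /(_ (enum_rank ord0)) /eqP; rewrite !mxE oner_eq0.
Qed.

Lemma complete_graphE n : complete_graph n = pairs [set: 'I_n].
Proof. by apply/setP => e; rewrite !inE finset.subsetT. Qed.

Lemma connected_graphE n (Q : {set {set 'I_n}}) :
  connected_graph Q = connected_on [set: 'I_n] Q.
Proof.
apply/forallP/connected_onP => [H x y _ _|H x]; first exact: (forallP (H x)).
by apply/forallP => y; apply: H; rewrite inE.
Qed.

(** The morphism [f] allows two uses: the identity, for positivity, and the evaluation at $e^s$, for
    moments. *)
Lemma ext_activity_conn_poly (K : comNzRingType) (f : {rmorphism {poly int} -> K}) n :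
  (f 'X - 1) ^+ n * f (ext_activity_poly (complete_graph n.+1)) =
  conn_poly (f 'X) n.+1.
Proof.
rewrite /ext_activity_poly rmorph_sum mulr_sumr /conn_poly /conn_sum.
apply: eq_big => [Q|Q /andP[]]; first by rewrite complete_graphE connected_graphE.
rewrite complete_graphE connected_graphE => QS cQ.
by rewrite -(betti1_connected QS cQ) rmorphXn rmorphB rmorph1 -exprD addnC.
Qed.

End Betti.

(** * Positivity of the external activity polynomial *)

Section Positivity.
Local Notation q := ('X : {poly int}).

(** Since $\binom{n+1}2=\binom n2+n$. *)
Lemma deriv_all_egf_dilate : hz_deriv (all_egf q) = hz_dilate q (all_egf q).
Proof.
apply/funext => n; rewrite hz_derivE /hz_dilate /all_egf binS bin1.
by rewrite addnC exprD.
Qed.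

Lemma deriv_dilate (K : comNzRingType) (a : K) (f : hurwitz K) :
  hz_deriv (hz_dilate a f) = hz_const a * hz_dilate a (hz_deriv f).
Proof.
by apply/funext => n; rewrite hz_constM /hz_dilate !hz_derivE exprS mulrA.
Qed.

(* From the q-difference equation G'' = G' (q G'(qx) - G'(x)). *)
Lemma deriv2_conn_egf (A := hz_deriv (conn_egf q)) :
  hz_deriv A = (hz_const q * hz_dilate q A - A) * A.
Proof.
apply: (@hz_mulrI _ (all_egf q)); first by rewrite /all_egf bin0n.
have h1 : hz_deriv (hz_deriv (all_egf q))
    = hz_const q * hz_dilate q A * A * all_egf q.
  rewrite deriv_all_egf_dilate deriv_dilate deriv_all_egf hz_dilateM.
  by rewrite -deriv_all_egf_dilate deriv_all_egf !mulrA.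
have h2 : hz_deriv (hz_deriv (all_egf q))
    = hz_deriv A * all_egf q + A * A * all_egf q.
  by rewrite deriv_all_egf hz_derivM deriv_all_egf mulrA.
by rewrite mulrBl mulrBl -h1 h2 addrK.
Qed.

Notation R_ n := (ext_activity_poly (complete_graph n)).

Lemma conn_poly_ext_activity n : conn_poly q n.+1 = (q - 1) ^+ n * R_ n.+1.
Proof. by rewrite -(ext_activity_conn_poly (GRing.RMorphism.clone _ _ idfun _)). Qed.

(** Coefficientwise form of [deriv2_conn_egf] after cancelling $(q-1)^{n+1}$. The factor $q^{i+1}-1$
    leaves a geometric sum, so the right side has only positive operations. *)
Lemma ext_activity_rec n :
  R_ n.+2 = \sum_(i < n.+1)
    ((\sum_(l < i.+1) q ^+ l) * R_ i.+1 * R_ (n - i).+1) *+ 'C(n, i).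
Proof.
have := congr1 (fun f : hurwitz {poly int} => f n) deriv2_conn_egf.
rewrite hzM !hz_derivE /conn_egf conn_poly_ext_activity => h.
have q1 : (q - 1) ^+ n.+1 != 0 by rewrite expf_neq0// -[1]/(1%:P) polyXsubC_eq0.
apply: (mulfI q1); rewrite h mulr_sumr; apply: eq_bigr => i _.
rewrite mulrnAr; congr (_ *+ _).
rewrite hzD hzN hz_constM /hz_dilate !hz_derivE !conn_poly_ext_activity.
rewrite mulrA -exprS -[X in _ - X]mul1r -mulrBl subrX1.
have -> : (q - 1) ^+ n.+1 = (q - 1) * (q - 1) ^+ i * (q - 1) ^+ (n - i).
  by rewrite -exprS -exprD; congr (_ ^+ _); have := ltn_ord i; lia.
move: (_ - 1) (\sum_(_ < _) _) (R_ i.+1) (R_ (n - i).+1) => a b c d; ring.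
Qed.

Lemma ext_activity1 : R_ 1 = 1.
Proof.
by have := conn_poly_ext_activity 0; rewrite conn_poly1 expr0 mul1r.
Qed.

Lemma coefM_ge0 (p r : {poly int}) :
  (forall i, 0 <= p`_i) -> (forall i, 0 <= r`_i) -> forall i, 0 <= (p * r)`_i.
Proof.
by move=> p0 r0 i; rewrite coefM sumr_ge0// => j _; rewrite mulr_ge0.
Qed.

(** Needed because [discrete_measure] takes absolute values of the coefficients: the moments can be
    read off the polynomial only when these are non-negative. *)
Lemma ext_activity_ge0 n i : 0 <= (R_ n.+1)`_i.
Proof.
elim/ltn_ind: n i => -[|n] IHn i; first by rewrite ext_activity1 coef1; case: i.
rewrite ext_activity_rec coef_sum sumr_ge0// => j _; rewrite coefMn mulrn_wge0//.
apply: coefM_ge0 => k; last by apply: IHn; rewrite ltnS leq_subr.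
apply: coefM_ge0 => {}k; last by apply: IHn; exact: ltn_ord.
by rewrite coef_sum sumr_ge0// => l _; rewrite coefXn; case: eqP.
Qed.

End Positivity.

(** * The heat equation *)

Section Heat.
Variable R : realType.
Local Notation H := (hurwitz R).
Local Notation HH := (hurwitz H).

Definition exps : H := hz_exp 1.
Definition half_exps : H := hz_exp (2^-1).

(* \sum_n e^(s n^2 / 2) x^n / n! and its logarithm *)
Definition gauss_egf : HH := hz_dilate half_exps (all_egf exps).
Definition log_egf : HH := hz_dilate half_exps (conn_egf exps).

Lemma euler_deriv (K : comNzRingType) (f : hurwitz K) :
  hz_euler f = hz_X K * hz_deriv f.
Proof. by apply/funext => -[|n]; rewrite hzXM hz_eulerE. Qed.

Lemma euler_dilate (K : comNzRingType) (a : K) (f : hurwitz K) :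
  hz_euler (hz_dilate a f) = hz_dilate a (hz_euler f).
Proof. by apply/funext => n; rewrite /hz_dilate !hz_eulerE mulrnAr. Qed.

Lemma euler_gauss_egf : hz_euler gauss_egf = hz_euler log_egf * gauss_egf.
Proof.
by rewrite /gauss_egf /log_egf !euler_dilate -hz_dilateM !euler_deriv
  deriv_all_egf mulrA.
Qed.

(** The dilation by $e^{s/2}$ completes the square: $n/2+\binom n2=n^2/2$. *)
Lemma gauss_egfE n : gauss_egf n = hz_exp (n%:R ^+ 2 / 2).
Proof.
rewrite /gauss_egf /hz_dilate /half_exps /all_egf /exps -!hz_expMn -hz_expD.
congr hz_exp; rewrite -[X in X + _]mulr_natr.
have e : ('C(n, 2)).*2 = (n * n.-1)%N.
  by rewrite bin2 halfK; case: n => // n; rewrite /= oddM /= andNb subn0.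
have -> : ('C(n, 2))%:R = (n%:R ^+ 2 - n%:R) / 2 :> R.
  apply: (@mulIf _ 2) => //; rewrite mulfVK// -natrM muln2 e.
  by case: (n) => [|m]; [rewrite mul0n expr2 mul0r subrr|rewrite natrM -natr1; ring].
by field.
Qed.

Definition sderiv (f : HH) : HH := fun n => hz_deriv (f n).

Lemma hz_derivD (f g : H) : hz_deriv (f + g) = hz_deriv f + hz_deriv g.
Proof. by []. Qed.

Lemma hz_derivMn (f : H) n : hz_deriv (f *+ n) = hz_deriv f *+ n.
Proof. by apply/funext => m; rewrite hz_derivE !hzMn. Qed.

Lemma sderivM f g : sderiv (f * g) = sderiv f * g + f * sderiv g.
Proof.
apply/funext => n; rewrite /sderiv hzD !hzM -big_split/=.
apply/funext => m; rewrite hz_derivE !hz_sum; apply: eq_bigr => i _.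
by rewrite hzMn -hz_derivE hz_derivM -mulrnDl hzMn.
Qed.

Lemma sderiv_euler f : sderiv (hz_euler f) = hz_euler (sderiv f).
Proof. by apply/funext => n; rewrite /sderiv !hz_eulerE hz_derivMn. Qed.

(** The heat equation: both sides multiply the coefficient $e^{sn^2/2}$ by $n^2$. *)
Lemma sderiv_gauss_egf : sderiv gauss_egf *+ 2 = hz_euler (hz_euler gauss_egf).
Proof.
apply/funext => n; rewrite hzMn /sderiv !hz_eulerE gauss_egfE hz_deriv_exp.
apply/funext => m; rewrite !hzMn hz_constM -mulrnA -[LHS]mulr_natr -[RHS]mulr_natr natrM.
by field.
Qed.

(** The heat equation for $P=e^F$ becomes $2F_s=D^2F+(DF)^2$ with $D=x\,d/dx$. *)
Lemma sderiv_log_egf n : (0 < n)%N ->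
  sderiv log_egf n *+ 2 =
  (hz_euler (hz_euler log_egf) + hz_euler log_egf * hz_euler log_egf) n.
Proof.
pose P := gauss_egf; pose F := log_egf.
pose h := hz_euler (hz_euler F) + hz_euler F * hz_euler F.
have eP : hz_euler P = hz_euler F * P := euler_gauss_egf.
have hP : sderiv P *+ 2 = h * P.
  by rewrite sderiv_gauss_egf eP hz_eulerM eP mulrA -mulrDl.
(* Only the logarithmic derivative of [P] is available, so the identity is proved after applying
   $D$. This loses the constant coefficient, hence the hypothesis [0 < n]. *)
suff e : hz_euler (sderiv F *+ 2) = hz_euler h.
  move=> n0; have := congr1 (fun f : HH => f n) e; rewrite !hz_eulerE hzMn => E.
  apply/funext => m; have := congr1 (fun f : H => f m) E; rewrite 2!hzMn [RHS]hzMn.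
  rewrite -mulr_natr -[RHS]mulr_natr => /mulIf; rewrite hzMn; apply.
  by rewrite pnatr_eq0 -lt0n.
apply: (@hz_mulrI _ P); first by rewrite /P gauss_egfE expr0n mul0r hz_exp0.
have : hz_euler (sderiv P *+ 2) = hz_euler (h * P) by rewrite hP.
rewrite hz_eulerMn -sderiv_euler eP sderivM mulrnDl hz_eulerM eP.
have -> : hz_euler F * sderiv P *+ 2 = h * (hz_euler F * P).
  by rewrite -mulrnAr hP mulrCA.
by rewrite hz_eulerMn -sderiv_euler mulrnAl => /addIr ->.
Qed.

End Heat.

(** * Wright's recursion for the expansion by excess *)

Section Excess.
Variable R : realType.
Local Notation H := (hurwitz R).

(* Exponential generating function of the moments of the uniform law. *)
Definition unit_egf : H := fun k => k.+1%:R^-1.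

Definition eval_exps (p : {poly int}) : H := (map_poly intr p).[exps R].

Lemma exps_sub1 : exps R - 1 = hz_X R * unit_egf.
Proof.
apply/funext => n; rewrite hzXM hzD hzN hz1 /exps /hz_exp expr1n /unit_egf.
case: n => [|n]; first by rewrite subrr mulr0n.
by rewrite subr0 -[RHS]mulr_natr mulVf.
Qed.

Definition eval_exps_rmorphism : {rmorphism {poly int} -> H} :=
  (horner_eval (exps R) \o map_poly intr)%FUN.

(** The moment generating function of [tilde_omega] at [m.+1], as [has_moments_omega] shows. *)
Definition omega_egf m : H :=
  unit_egf ^+ m * eval_exps (ext_activity_poly (complete_graph m.+1)).

(** Here the uniform convolutions enter: $(e^s-1)^m=s^m\,((e^s-1)/s)^m$. *)
Lemma conn_poly_exps m : conn_poly (exps R) m.+1 = hz_X R ^+ m * omega_egf m.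
Proof.
have e : eval_exps_rmorphism 'X = exps R by rewrite /= /horner_eval map_polyX hornerX.
have := ext_activity_conn_poly eval_exps_rmorphism m.
by rewrite e exps_sub1 exprMn -mulrA => <-.
Qed.

(** The moment generating function of the measure translated by $(m+1)/2$. The translation is undone
    in [scaled_moments_expand]. *)
Definition twisted_egf m : H := half_exps R ^+ m.+1 * omega_egf m.

Lemma log_egfS m : log_egf R m.+1 = hz_X R ^+ m * twisted_egf m.
Proof.
by rewrite /log_egf /hz_dilate /conn_egf conn_poly_exps /twisted_egf mulrCA.
Qed.

(* The generating function of the coefficients of s^(n - 1 + k). *)
Definition excess k : H := fun n => if n is m.+1 then twisted_egf m k / k`!%:R else 0.

Lemma log_egf_excess n k : (0 < n)%N ->
  log_egf R n (n.-1 + k)%N = (n.-1 + k)`!%:R * excess k n.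
Proof.
case: n => // m _; rewrite log_egfS hzXnM /= -[LHS]mulr_natr [RHS]mulrCA; congr (_ * _).
have k0 : k`!%:R != 0 :> R by rewrite pnatr_eq0 -lt0n fact_gt0.
apply: (mulIf k0); rewrite mulfVK// -natrM addnC -(ffact_fact (leq_addl k m)).
by rewrite addnK addnC.
Qed.

Lemma log_egfM_excess i j k : (0 < i)%N -> (0 < j)%N ->
  (log_egf R i * log_egf R j) (i.-1 + j.-1 + k)%N =
  (i.-1 + j.-1 + k)`!%:R * \sum_(l < k.+1) excess l i * excess (k - l) j.
Proof.
case: i => // i _; case: j => // j _; rewrite !log_egfS /=.
rewrite mulrACA -exprD hzXnM hzM -[LHS]mulr_natr mulrC mulr_sumr mulr_sumr.
apply: eq_bigr => l _; have := ltn_ord l; rewrite ltnS => lk.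
have fl m : m`!%:R != 0 :> R by rewrite pnatr_eq0 -lt0n fact_gt0.
have := ffact_fact (leq_addr k (i + j)); rewrite addKn => <-.
rewrite natrM -(bin_fact lk) !natrM -[X in _ * X = _]mulr_natr.
by field; rewrite !fl.
Qed.

Lemma log_egf_euler_lt n k : (0 < n)%N -> (k < n.-1)%N -> log_egf R n k = 0.
Proof. by case: n => // n _ kn; rewrite log_egfS hzXnM_lt. Qed.

Local Notation D := (@hz_euler R).

Lemma excess_rec_coef n k : (0 < n)%N -> (0 < n + k)%N -> (1 < n + k)%N ->
  excess k n * (n.-1 + k)%:R *+ 2 =
  (if k is k'.+1 then excess k' n else 0) *+ n *+ n +
  \sum_(i < n.+1) (\sum_(l < k.+1) (excess l i *+ i) * (excess (k - l) (n - i)%N *+ (n - i))) *+ 'C(n, i).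
Proof.
move=> n0 _ nk.
(* [N] is the power of $s$ to compare in [sderiv_log_egf]; the derivative in $s$ lowers $n-1+k$ by
   one. *)
have [N NE] : exists N, (n.-1 + k)%N = N.+1 by exists (n.-1 + k).-1; lia.
have fl m : m`!%:R != 0 :> R by rewrite pnatr_eq0 -lt0n fact_gt0.
have := congr1 (fun f : H => f N) (sderiv_log_egf R n0).
rewrite hzMn /sderiv hz_derivE -NE log_egf_excess// hzD.
move=> E; apply: (mulfI (fl N)).
transitivity ((n.-1 + k)`!%:R * excess k n *+ 2).
  by rewrite NE factS natrM; ring.
rewrite E hzD [RHS]mulrDr; congr (_ + _).
  rewrite !hz_eulerE !hzMn !mulrnAr; congr (_ *+ _ *+ _).
  case: k nk NE {E} => [|k] nk NE; first by rewrite mulr0 log_egf_euler_lt//; lia.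
  have -> : N = (n.-1 + k)%N by lia.
  by rewrite log_egf_excess.
rewrite hzM hz_sum mulr_sumr; apply: eq_bigr => i _.
rewrite hzMn [RHS]mulrnAr; congr (_ *+ _).
have := ltn_ord i; rewrite ltnS => iln.
rewrite !hz_eulerE mulrnAl mulrnAr !hzMn.
(* The end terms vanish because $D$ kills constants. They are split off since [i.-1] and
   [(n - i).-1] would be truncated there. *)
have [->|i0] := posnP i.
  by rewrite mulr0n big1 ?mulr0// => l _; rewrite mul0r.
have [->|j0] := posnP (n - i).
  by rewrite mulr0n mul0rn big1 ?mulr0// => l _; rewrite mulr0.
have -> : N = (i.-1 + (n - i).-1 + k)%N by lia.
rewrite log_egfM_excess// -!mulrnAr; congr (_ * _).
rewrite -!sumrMnl; apply: eq_bigr => l _.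
by rewrite mulrnAl mulrnAr.
Qed.

Lemma excess_at0 k : excess k 0 = 0. Proof. by []. Qed.

(** Wright's recursion. The power $n-1+k$ of $s$ turns $d/ds$ into the operator $D+(k-1)$. *)
Lemma excess_rec k :
  (D (excess k) + excess k * hz_const (k%:R - 1)) *+ 2 =
  (if k is k'.+1 then D (D (excess k')) else 0) +
  \sum_(l < k.+1) D (excess l) * D (excess (k - l)).
Proof.
apply/funext => n; rewrite hzMn hzD mulrC hz_constM hz_eulerE hzD hz_sum.
have [->|n0] := posnP n.
  rewrite mulr0n excess_at0 mulr0 addr0 mul0rn big1 => [|l _]; last first.
    by rewrite hzM0 !hz_eulerE !mulr0n mul0r.
  by case: k => [|k]; rewrite addr0.
(* For $n=1$, $k=0$ there is no coefficient of $s^{-1}$ to compare, but both sides are zero. *)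
have [nk1|nk] := leqP (n + k)%N 1.
  have -> : n = 1%N by lia.
  have -> : k = 0%N by lia.
  rewrite mulr1n sub0r mulN1r subrr mul0rn big_ord1 hzM !big_ord_recl big_ord0.
  by rewrite !hz_eulerE /= subnn !mulr0n !(mul0r, mulr0, mul0rn, addr0).
have := @excess_rec_coef n k n0; rewrite addn_gt0 n0 => /(_ isT nk) e.
transitivity (excess k n * (n.-1 + k)%:R *+ 2).
  congr (_ *+ 2); rewrite -[X in X + _]mulr_natr natrD.
  have -> : n%:R = n.-1%:R + 1 :> R by rewrite natr1 prednK.
  by ring.
rewrite e; congr (_ + _).
  by case: k {nk e} => [|k]; rewrite ?mul0rn// !hz_eulerE.
under [RHS]eq_bigr => l _ do rewrite hzM.
rewrite [RHS]exchange_big/=; apply: eq_bigr => i _.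
by rewrite -sumrMnl; apply: eq_bigr => l _; rewrite !hz_eulerE.
Qed.

Lemma omega_egf0 : omega_egf 0 = 1.
Proof.
by rewrite /omega_egf expr0 mul1r ext_activity1 /eval_exps rmorph1 hornerC.
Qed.

Lemma excess01 : excess 0 1 = 1.
Proof.
rewrite /= /twisted_egf omega_egf0 mulr1 expr1 /half_exps /hz_exp expr0.
by rewrite fact0 divr1.
Qed.

End Excess.

(** * The tree function *)

Section Tree.
Variable R : realType.
Local Notation H := (hurwitz R).
Local Notation D := (@hz_euler R).

Lemma hz_mulrnI (f g : H) m : f *+ m.+1 = g *+ m.+1 -> f = g.
Proof.
move=> fg; apply/funext => n; have := congr1 (fun h : H => h n) fg.
rewrite !hzMn -[LHS]mulr_natr -[RHS]mulr_natr => /mulIf; apply.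
by rewrite pnatr_eq0.
Qed.

(* T = x e^T; the differential equation [euler_tree] takes the place of this
   functional equation. *)
Definition tree : H := D (excess R 0).

(** This is $1/(1-T)$, by [tree_invM]; the formula avoids inverting a series. *)
Definition tree_inv : H := 1 + D tree.

Local Notation T := tree.
Local Notation z := tree_inv.

(** The case $k=0$ of Wright's recursion, i.e. $W_0=T-T^2/2$, the series of unrooted trees. *)
Lemma tree_excess0 : (T - excess R 0) *+ 2 = T ^+ 2.
Proof.
have := excess_rec R 0; rewrite big_ord1 subnn !add0r -expr2 => <-.
by rewrite rmorphN rmorph1 mulrN1.
Qed.

Lemma euler_tree : D T = T + T * D T.
Proof.
have := congr1 D tree_excess0; rewrite hz_eulerMn hz_eulerX expr1.
by move=> /hz_mulrnI; rewrite hz_eulerB -/T => /eqP; rewrite subr_eq addrC mulrC => /eqP.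
Qed.

Lemma tree_invM : (1 - T) * z = 1.
Proof. by rewrite mulrDr mulr1 mulrBl mul1r {1}euler_tree; ring. Qed.

Lemma tree_mul_inv : T * z = z - 1.
Proof. by have := tree_invM; rewrite mulrBl mul1r => <-; ring. Qed.

Lemma euler_treeE : D T = T * z.
Proof. by rewrite tree_mul_inv /z addrC addKr. Qed.

Lemma euler_tree_inv : D z = z ^+ 3 - z ^+ 2.
Proof.
have e : D z = T * z * z + T * D z.
  by rewrite [LHS]hz_eulerD hz_euler1 add0r euler_treeE [LHS]hz_eulerM euler_treeE.
transitivity (z * ((1 - T) * D z)); first by rewrite mulrA [z * _]mulrC tree_invM mul1r.
rewrite mulrBl mul1r {1}e addrK tree_mul_inv; ring.
Qed.

Lemma euler_tree_invX m : D (z ^+ m) = (z ^+ m.+2 - z ^+ m.+1) *+ m.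
Proof.
case: m => [|m]; first by rewrite hz_euler1 mulr0n.
by rewrite hz_eulerX euler_tree_inv; congr (_ *+ _); rewrite /= !exprS; ring.
Qed.

Lemma tree_at0 : T 0%N = 0. Proof. by rewrite /T hz_eulerE mulr0n. Qed.
Lemma tree_at1 : T 1%N = 1. Proof. by rewrite /T hz_eulerE excess01. Qed.
Lemma tree_inv_at0 : z 0%N = 1.
Proof. by rewrite /z hzD hz1 hz_eulerE mulr0n addr0. Qed.

Lemma treeXM_factor j : exists2 f : H, f 0%N = 1 & T ^+ j = hz_X R ^+ j * f.
Proof.
pose f : H := fun n => T n.+1 / n.+1%:R.
have Tf : T = hz_X R * f.
  apply/funext => -[|n]; rewrite hzXM ?tree_at0 ?mulr0n//= /f.
  by rewrite -[RHS]mulr_natr mulfVK// pnatr_eq0.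
exists (f ^+ j); last by rewrite Tf exprMn.
elim: j => [|j IHj]; first by rewrite expr0 hz1.
by rewrite exprS hzM0 IHj /f tree_at1 divr1 mulr1.
Qed.

Lemma treeXM_lt j (g : H) n : (n < j)%N -> (T ^+ j * g) n = 0.
Proof.
by have [f _ ->] := treeXM_factor j => nj; rewrite -mulrA hzXnM_lt.
Qed.

Definition treeX_inv j n := (T ^+ j * z) n.

Lemma treeX_inv_diag n : treeX_inv n n = n`!%:R.
Proof.
rewrite /treeX_inv; have [f f0 ->] := treeXM_factor n.
rewrite -mulrA -{2}[n]addn0 hzXnM addn0 ffactnn hzM0 f0 tree_inv_at0.
by rewrite mul1r.
Qed.

Lemma treeX_coef j n : (T ^+ j) n *+ n = treeX_inv j n *+ j.
Proof.
rewrite -hz_eulerE hz_eulerX hzMn /treeX_inv; case: j => // j.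
by rewrite euler_treeE exprS /= mulrAC.
Qed.

(* Since T^(j+1) z = T^j z - T^j. *)
Lemma treeX_inv_rec j n :
  treeX_inv j.+1 n *+ n = treeX_inv j n * (n%:R - j%:R).
Proof.
have -> : treeX_inv j.+1 n = treeX_inv j n - (T ^+ j) n.
  rewrite /treeX_inv exprSr -mulrA tree_mul_inv mulrBr mulr1.
  by rewrite hzD hzN.
by rewrite mulrnBl treeX_coef mulrBr !mulr_natr.
Qed.

(** Descending from the diagonal value $n!$ along [treeX_inv_rec]; this replaces Lagrange
    inversion. *)
Lemma treeX_invE n i : (i <= n)%N ->
  treeX_inv (n - i) n * i`!%:R = n`!%:R * n%:R ^+ i.
Proof.
elim: i => [|i IHi] iltn; first by rewrite subn0 treeX_inv_diag expr0.
have := treeX_inv_rec (n - i.+1) n.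
have -> : (n - i.+1).+1 = (n - i)%N by lia.
have -> : n%:R - (n - i.+1)%:R = i.+1%:R :> R by rewrite natrB// opprB addrC subrK.
rewrite factS natrM mulrA => <-.
by rewrite [LHS]mulrnAl IHi 1?ltnW// exprS -[LHS]mulr_natr; ring.
Qed.

Lemma tree_invE n : z n = n%:R ^+ n.
Proof.
have := @treeX_invE n n (leqnn n); rewrite subnn /treeX_inv expr0 mul1r.
by rewrite [RHS]mulrC => /mulIf; apply; rewrite pnatr_eq0 -lt0n fact_gt0.
Qed.

Lemma excess0E n : (0 < n)%N -> excess R 0 n * n%:R ^+ 2 = n%:R ^+ n.
Proof.
move=> n0; have := tree_invE n.
rewrite /z hzD hz1 eqn0Ngt n0 add0r /T !hz_eulerE => <-.
by rewrite expr2 mulrA !mulr_natr.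
Qed.

(** The tree polynomials of Knuth and Pittel. *)
Definition tau m n := (z ^+ m) n.

Lemma tau_rec m n : tau m.+2 n *+ m = tau m.+1 n *+ m + tau m n *+ n.
Proof.
have := congr1 (fun f : H => f n) (euler_tree_invX m).
by rewrite hz_eulerE hzMn hzD hzN mulrnBl /tau => ->; rewrite addrC subrK.
Qed.

Lemma tau1 n : tau 1 n = n%:R ^+ n. Proof. by rewrite /tau expr1 tree_invE. Qed.

(** Expand one factor of $z^2$ as a geometric series in $T$; the terms $T^jz$ with $j>n$ have order
    above $n$. *)
Lemma tau2 n : tau 2 n = \sum_(j < n.+1) treeX_inv j n.
Proof.
have : z = \sum_(j < n.+1) T ^+ j + T ^+ n.+1 * z.
  have -> : \sum_(j < n.+1) T ^+ j = (1 - T ^+ n.+1) * z.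
    have -> : 1 - T ^+ n.+1 = (1 - T) * \sum_(j < n.+1) T ^+ j.
      by rewrite -[1 - T]opprB mulNr -subrX1 opprB.
    by rewrite mulrAC tree_invM mul1r.
  by rewrite -mulrDl subrK mul1r.
move=> zE; rewrite /tau expr2 {1}zE mulrDl hzD -mulrA treeXM_lt// addr0.
by rewrite mulr_suml hz_sum.
Qed.

End Tree.

(** * Gamma values at half-integers *)

Section GammaHalf.
Local Open Scope classical_set_scope.
Local Open Scope ring_scope.
Variable R : realType.
Let mu : {measure set _ -> \bar R} := @lebesgue_measure R.

Definition erf_half (u : R) : R := gauss_integral_proof.integral0_gauss u.

Lemma erf_half_derive (u : R) : 0 < u -> is_derive u 1 erf_half (gauss_fun u).
Proof.
move=> u0.
have [|||h1 h2] := @continuous_FTC1_closed R (@gauss_fun R) 0 u (u + 1) _ _ _ (@continuous_gauss_fun R u).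
- by rewrite ltrDl.
- apply: continuous_compact_integrable => //; first exact: segment_compact.
  by apply: continuous_subspaceT; exact: continuous_gauss_fun.
- exact: u0.
- by split; [exact: h1|rewrite -derive1E; exact: h2].
Qed.

Lemma erf_half_le (u : R) : 0 <= u -> 0 <= erf_half u <= u.
Proof.
move=> u0; rewrite /erf_half gauss_integral_proof.integral0_gauss_ge0/=.
rewrite [leRHS](_ : _ = \int[mu]_(x in `[0, u]) (cst 1) x); last first.
  have e : lebesgue_measure (`[0, u]%classic : set R) = u%:E.
    rewrite lebesgue_measure_itv/= lte_fin; case: ltP => [_|u1]; first by rewrite sube0.
    by congr (_%:E); apply/eqP; rewrite eq_le u1 u0.
  by rewrite Rintegral_cst// mul1r; apply/esym; exact: (congr1 fine e).
rewrite /gauss_integral_proof.integral0_gauss; apply: le_Rintegral => //.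
- apply: continuous_compact_integrable => //; first exact: segment_compact.
  by apply: continuous_subspaceT; exact: continuous_gauss_fun.
- apply: continuous_compact_integrable => //; first exact: segment_compact.
  by apply: continuous_subspaceT => x; exact: cvg_cst.
- by move=> x _; exact: gauss_fun_le1.
Qed.

Lemma erf_half_le0 (u : R) : u <= 0 -> erf_half u = 0.
Proof.
rewrite le_eqVlt => /predU1P[->|u0]; rewrite /erf_half /gauss_integral_proof.integral0_gauss.
  by rewrite set_itv1 Rintegral_set1.
by rewrite set_itv_ge ?Rintegral_set0// bnd_simp -ltNge.
Qed.

Lemma erf_half_cvg0 : erf_half u @[u --> 0] --> 0.
Proof.
apply/cvgr0Pnorm_le => e e0; near=> u.
have [u0|u0] := leP u 0; first by rewrite erf_half_le0// normr0 ltW.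
have /andP[h1 h2] := erf_half_le (ltW u0).
rewrite ger0_norm//; apply: le_trans h2 _; rewrite -[leLHS](ger0_norm (ltW u0)).
by near: u; exists e => //= x /=; rewrite sub0r normrN => /ltW.
Unshelve. all: by end_near. Qed.

Lemma erf_half_cvgy : erf_half u @[u --> +oo] --> Num.sqrt pi / 2.
Proof.
have : Num.sqrt (erf_half u ^+ 2) @[u --> +oo] --> Num.sqrt (pi / 4).
  apply: continuous_cvg; first exact: sqrt_continuous.
  exact: gauss_integral_proof.cvg_integral0_gauss_sqr.
rewrite sqrtrM ?pi_ge0// sqrtrV// (_ : 4 = 2 ^+ 2); last by rewrite expr2 -natrM.
rewrite sqrtr_sqr ger0_norm// (_ : (fun _ => Num.sqrt _) = erf_half)//.
apply/funext => r; rewrite sqrtr_sqr// ger0_norm//.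
exact: gauss_integral_proof.integral0_gauss_ge0.
Qed.

(* A primitive of u^m e^(-u^2). *)
Fixpoint gauss_prim (m : nat) : R -> R :=
  match m with
  | 0 => erf_half
  | 1 => fun u => (1 - gauss_fun u) / 2
  | m'.+2 => fun u => (m'.+1%:R * gauss_prim m' u - u ^+ m'.+1 * gauss_fun u) / 2
  end.

(** The value of $\int_0^\infty u^me^{-u^2}du=\Gamma((m+1)/2)/2$, given by integration by parts;
    [gauss_prim_cvgy] justifies it. *)
Fixpoint gauss_moment (m : nat) : R :=
  match m with
  | 0 => Num.sqrt pi / 2
  | 1 => 2^-1
  | m'.+2 => m'.+1%:R / 2 * gauss_moment m'
  end.

Lemma nat_ind2 (P : nat -> Prop) : P 0%N -> P 1%N ->
  (forall n, P n -> P n.+2) -> forall n, P n.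
Proof.
move=> P0 P1 Pn n; suff [] : P n /\ P n.+1 by [].
by elim: n => // n [Pn1 Pn2]; split => //; exact: Pn.
Qed.

Lemma gauss_fun_derive (u : R) : is_derive u 1 (@gauss_fun R) (- 2 * u * gauss_fun u).
Proof.
rewrite /gauss_fun; apply: is_derive_eq; rewrite /GRing.scale /=; ring.
Qed.

Lemma gauss_prim_derive m (u : R) : 0 < u ->
  is_derive u 1 (gauss_prim m) (u ^+ m * gauss_fun u).
Proof.
elim/nat_ind2: m => [u0|_|m IHm u0].
- by rewrite expr0 mul1r; exact: erf_half_derive.
- have := gauss_fun_derive u => H; rewrite /=.
  by apply: is_derive_eq; rewrite /GRing.scale /=; field.
- have := gauss_fun_derive u => H; have H2 := IHm u0.
  have HX : is_derive u 1 (fun v : R => v ^+ m.+1) (m.+1%:R * u ^+ m).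
    by split; [exact: exprn_derivable|rewrite exp_derive /GRing.scale /= mulr1].
  rewrite (_ : gauss_prim m.+2 =
      2^-1 *: (m.+1%:R *: gauss_prim m - (fun v : R => v ^+ m.+1) * gauss_fun (R := R))).
    by apply: is_derive_eq; rewrite /GRing.scale /= !exprS; field.
  by apply/funext => v; rewrite /= mulrC.
Qed.

Lemma gauss_prim_cvg0 m : gauss_prim m u @[u --> 0] --> 0.
Proof.
have cg := @continuous_gauss_fun R 0.
have g0 : gauss_fun (0 : R) = 1 by rewrite /gauss_fun expr0n oppr0 expR0.
elim/nat_ind2: m => [||m IHm]; first exact: erf_half_cvg0.
  have : (1 - gauss_fun u) / 2 @[u --> (0 : R)] --> (1 - gauss_fun (0 : R)) / 2.
    by apply: cvgMr_tmp; apply: cvgB => //; exact: cvg_cst.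
  by rewrite g0 subrr mul0r.
have : (m.+1%:R * gauss_prim m u - u ^+ m.+1 * gauss_fun u) / 2 @[u --> (0 : R)]
    --> (m.+1%:R * 0 - 0 ^+ m.+1 * gauss_fun (0 : R)) / 2.
  apply: cvgMr_tmp; apply: cvgB; first exact: cvgMl_tmp.
  by apply: cvgM cg; exact: exprn_continuous.
by rewrite mulr0 expr0n mul0r subrr mul0r.
Qed.

Lemma gauss_fun_exprn_cvgy m : u ^+ m * gauss_fun (u : R) @[u --> +oo] --> 0.
Proof.
apply: (@squeeze_cvgr _ _ _ _ (cst 0) (fun u : R => (m.+1)`!%:R * u^-1)).
- near=> u.
  have u1 : 1 <= u by near: u; exact: nbhs_pinfty_ge.
  have u0 : 0 < u by exact: lt_le_trans u1.
  have f0 : 0 < m.+1`!%:R :> R by rewrite ltr0n fact_gt0.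
  apply/andP; split; first by rewrite mulr_ge0 ?exprn_ge0 ?gauss_fun_ge0// ltW.
  rewrite ler_pdivlMr// mulrAC -exprSr /gauss_fun expRN ler_pdivrMr ?expR_gt0//.
  apply: (@le_trans _ _ (u ^+ 2 ^+ m.+1)).
    by rewrite -exprM ler_weXn2l//; lia.
  rewrite mulrC -ler_pdivrMr//; apply: le_trans (expR_ge1Dxn m (exprn_ge0 2 (ltW u0))).
  by rewrite lerDr.
- exact: cvg_cst.
- rewrite -(mulr0 (m.+1)`!%:R); apply: cvgMl_tmp; apply/gtr0_cvgV0; last exact: cvg_id.
  by near=> u; near: u; exact: nbhs_pinfty_gt.
Unshelve. all: by end_near. Qed.

Lemma gauss_prim_cvgy m : gauss_prim m u @[u --> +oo] --> gauss_moment m.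
Proof.
elim/nat_ind2: m => [||m IHm]; first exact: erf_half_cvgy.
  have : (1 - gauss_fun u) / 2 @[u --> +oo] --> ((1 : R) - 0) / 2.
    by apply: cvgMr_tmp; apply: cvgB; [exact: cvg_cst|exact: cvg_gauss_fun].
  by rewrite subr0 mul1r.
have : (m.+1%:R * gauss_prim m u - u ^+ m.+1 * gauss_fun u) / 2 @[u --> +oo]
    --> (m.+1%:R * gauss_moment m - 0) / 2.
  by apply: cvgMr_tmp; apply: cvgB; [exact: cvgMl_tmp|exact: gauss_fun_exprn_cvgy].
by rewrite subr0 mulrAC.
Qed.

Lemma gauss_moment_gt0 m : 0 < gauss_moment m.
Proof.
elim/nat_ind2: m => [||m IHm]; rewrite /= ?invr_gt0//.
  by rewrite divr_gt0// sqrtr_gt0 pi_gt0.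
by rewrite mulr_gt0// divr_gt0.
Qed.

(* The primitive of (u - a)^2 u^m e^(-u^2) is nondecreasing. *)
Lemma gauss_moment_quadratic m (a : R) :
  0 <= gauss_moment m.+2 - 2 * a * gauss_moment m.+1 + a ^+ 2 * gauss_moment m.
Proof.
pose F u := gauss_prim m.+2 u - 2 * a * gauss_prim m.+1 u + a ^+ 2 * gauss_prim m u.
have dF (u : R) : 0 < u -> is_derive u 1 F ((u - a) ^+ 2 * (u ^+ m * gauss_fun u)).
  move=> u0; have d0 := gauss_prim_derive m u0.
  have d1 := gauss_prim_derive m.+1 u0; have d2 := gauss_prim_derive m.+2 u0.
  by apply: is_derive_eq; rewrite /GRing.scale /= !exprS; ring.
have F0 : F u @[u --> 0] --> 0.
  have : F u @[u --> 0] --> 0 - 2 * a * 0 + a ^+ 2 * 0.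
    apply: cvgD; [apply: cvgB|]; [|apply: cvgMl_tmp|apply: cvgMl_tmp]; exact: gauss_prim_cvg0.
  by rewrite !mulr0 subr0 addr0.
have Fy : F u @[u --> +oo] --> gauss_moment m.+2 - 2 * a * gauss_moment m.+1 + a ^+ 2 * gauss_moment m.
  apply: cvgD; [apply: cvgB|]; [|apply: cvgMl_tmp|apply: cvgMl_tmp]; exact: gauss_prim_cvgy.
have Fnd (x y : R) : 0 < x -> x <= y -> F x <= F y.
  move=> x0 xy.
  have dFF (z : R) : z \in `](x / 2), (y + 1)[ -> is_derive z 1 F ((z - a) ^+ 2 * (z ^+ m * gauss_fun z)).
    rewrite in_itv/= => /andP[xz _]; apply: dF; rewrite (lt_trans _ xz)// divr_gt0//.
  apply: (@ger0_derive1_le_oo R F (x / 2) (y + 1)) => //.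
  - by move=> z /dFF[].
  - move=> z zxy; have [_] := dFF z zxy; rewrite derive1E => ->.
    move: zxy; rewrite in_itv/= => /andP[xz _].
    have z0 : 0 < z by rewrite (lt_trans _ xz)// divr_gt0.
    by rewrite mulr_ge0 ?sqr_ge0// mulr_ge0 ?gauss_fun_ge0// exprn_ge0 ?ltW.
  - move=> z; rewrite inE/= => /dFF[h _]; exact/differentiable_continuous/derivable1_diffP.
  - rewrite in_itv/= ltr_pdivrMr// mulr_natr mulr2n ltrDl x0/=.
    by rewrite (le_lt_trans xy)// ltrDl.
  - rewrite in_itv/= ltr_pdivrMr// mulr_natr mulr2n.
    by rewrite (le_lt_trans xy) ?ltrDl ?(lt_le_trans x0 xy)//= ltrDl.
have F_ge0 (x : R) : 0 < x -> 0 <= F x.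
  move=> x0; apply: (cvgr_to_le (cvg_at_right_filter F0)).
  near=> u; apply: Fnd; first by near: u; exact: nbhs_right_gt.
  by near: u; exact: nbhs_right_le.
apply: (cvgr_to_ge Fy); near=> u; apply: F_ge0.
by near: u; exact: nbhs_pinfty_gt.
Unshelve. all: by end_near. Qed.


Lemma gauss_prim0 m : gauss_prim m 0 = 0.
Proof.
elim/nat_ind2: m => [||m IHm] /=; first by rewrite erf_half_le0.
  by rewrite /gauss_fun expr0n oppr0 expR0 subrr mul0r.
by rewrite IHm expr0n mulr0 mul0r subrr mul0r.
Qed.

Lemma sqrt_cvgy : Num.sqrt t @[t --> +oo] --> (+oo : set_system R).
Proof.
apply/cvgryPge => A; near=> t.
apply: (le_trans (ler_norm A)); rewrite -sqrtr_sqr ler_wsqrtr//.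
Unshelve. all: by end_near. Qed.

(* Substitute t = u^2. *)
Lemma Gamma_half m : Gamma (m.+3%:R / 2 : R) = 2 * gauss_moment m.+2.
Proof.
pose F t := 2 * gauss_prim m.+2 (Num.sqrt t).
pose f (t : R) := Num.sqrt t ^+ m.+1 * expR (- t).
have cf : continuous f.
  move=> t; apply: cvgM.
    by apply: (@continuous_comp _ _ _ (@Num.sqrt R) (fun u => u ^+ m.+1)); [exact: sqrt_continuous|exact: exprn_continuous].
  by apply: (@continuous_comp _ _ _ (@GRing.opp R) (@expR R)); [exact: opp_continuous|exact: continuous_expR].
have dF (t : R) : 0 < t -> is_derive t 1 F (f t).
  move=> t0; have s0 : 0 < Num.sqrt t by rewrite sqrtr_gt0.
  have d1 := gauss_prim_derive m.+2 s0; have d2 := is_derive1_sqrt t0.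
  rewrite (_ : F = 2 *: (gauss_prim m.+2 \o Num.sqrt))//.
  apply: is_derive_eq; rewrite /GRing.scale /= /f /gauss_fun sqr_sqrtr ?ltW//.
  by rewrite exprS; field; rewrite gt_eqF.
transitivity (\int[mu]_(t in `]0, +oo[) f t).
  apply: eq_Rintegral => t; rewrite inE/= in_itv/= andbT => t0.
  congr (_ * _); rewrite -powR_mulrn ?sqrtr_ge0// -powR12_sqrt ?(ltW t0)// -powRrM.
  by congr (_ `^ _); rewrite -!natr1; field.
transitivity (\int[mu]_(t in `[0, +oo[) f t).
  rewrite /Rintegral integral_itv_obnd_cbnd//.
  apply/measurable_EFinP/measurable_funTS; exact: continuous_measurable_fun.
rewrite (@Rintegral_ge0_continuous_FTC2y _ f F 0 (2 * gauss_moment m.+2)).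
- by rewrite /F sqrtr0 gauss_prim0 mulr0 subr0.
- by move=> x x0; rewrite mulr_ge0 ?exprn_ge0 ?sqrtr_ge0 ?expR_ge0.
- exact: continuous_subspaceT.
- apply: cvgMl_tmp; apply: (cvg_comp _ _ sqrt_cvgy); exact: gauss_prim_cvgy.
- by move=> t /dF[].
- rewrite /F; apply: cvgMl_tmp; rewrite sqrtr0 gauss_prim0; apply: cvg_at_right_filter.
  apply: (@cvg_comp _ _ _ (@Num.sqrt R) (gauss_prim m.+2) _ (nbhs (0 : R))); last exact: gauss_prim_cvg0.
  by have := @sqrt_continuous R 0; rewrite /continuous_at sqrtr0.
- by move=> t; rewrite in_itv/= andbT => /dF[_ <-]; rewrite derive1E.
Qed.

End GammaHalf.

(** * Asymptotics of the powers of 1 / (1 - T) *)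

Section Wallis.
Variable R : realType.
Local Open Scope classical_set_scope.
Local Open Scope ring_scope.

(** Wallis' argument. The product rule makes $x_{2i}/g_{2i}$ independent of $i$, while monotonicity
    gives $x_{2i}^2\le2i+1$ and $g_{2i}^2\ge2i$. So $(x_0/g_0)^2\le1+1/(2i)$ for every $i\ge1$. *)
Lemma wallis_le (x g : nat -> R) :
  (forall p, 0 < x p) -> (forall p, 0 < g p) ->
  (forall p, x p.+1 * x p = p.+1%:R) -> (forall p, g p.+1 * g p = p.+1%:R) ->
  (forall p, x p <= x p.+1) -> (forall p, g p <= g p.+1) -> x 0%N <= g 0%N.
Proof.
move=> x0 g0 xx gg xle gle.
have ratio i : x i.*2 * g 0%N = g i.*2 * x 0%N.
  elim: i => [|i IHi]; first by rewrite mulrC.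
  have step (y : nat -> R) p : (forall p, 0 < y p) -> (forall p, y p.+1 * y p = p.+1%:R) ->
      y p.+2 * p.+1%:R = y p * p.+2%:R.
    by move=> y0 yy; rewrite -(yy p) -(yy p.+1); ring.
  have p0 : i.*2.+1%:R != 0 :> R by rewrite pnatr_eq0.
  rewrite doubleS; apply: (mulIf p0).
  by rewrite mulrAC step// mulrAC IHi [RHS]mulrAC step//; ring.
have sq i : (x 0%N / g 0%N) ^+ 2 <= 1 + (i.+1)%:R^-1.
  have gi := g0 i.+1.*2.
  have -> : x 0%N / g 0%N = x i.+1.*2 / g i.+1.*2.
    by apply/eqP; rewrite eqr_div ?lt0r_neq0// ratio mulrC.
  rewrite expr_div_n ler_pdivrMr ?exprn_gt0//.
  apply: (@le_trans _ _ (i.+1.*2.+1)%:R).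
    by rewrite -xx expr2 ler_wpM2r ?xle// ltW.
  apply: (@le_trans _ _ ((1 + i.+1%:R^-1) * i.+1.*2%:R)).
    rewrite mulrDl mul1r -muln2 natrM mulKf ?pnatr_eq0// -[leLHS]natr1.
    by rewrite natrM lerD2l ler1n.
  rewrite ler_wpM2l ?addr_ge0 ?invr_ge0// doubleS -gg expr2 ler_wpM2l ?gle//.
  exact: ltW.
rewrite -[leRHS]mul1r -ler_pdivrMr//.
rewrite leNgt; apply/negP => h1.
have h : 1 < (x 0%N / g 0%N) ^+ 2 by rewrite exprn_egt1.
have [k hk] := ltr_add_invr h.
by have := lt_le_trans hk (sq k); rewrite ltxx.
Qed.

Lemma wallis_unique (x g : nat -> R) :
  (forall p, 0 < x p) -> (forall p, 0 < g p) ->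
  (forall p, x p.+1 * x p = p.+1%:R) -> (forall p, g p.+1 * g p = p.+1%:R) ->
  (forall p, x p <= x p.+1) -> (forall p, g p <= g p.+1) -> x 0%N = g 0%N.
Proof. by move=> *; apply/eqP; rewrite eq_le !wallis_le. Qed.

Lemma cvg_of_subseq (u : nat -> R) (l M : R) : (forall n, `|u n| <= M) ->
  (forall (f : nat -> nat) x, increasing_seq f -> u (f n) @[n --> \oo] --> x -> x = l) ->
  u n @[n --> \oo] --> l.
Proof.
move=> uM ul; apply/cvgrPdist_lt => e e0; apply: contrapT => nh.
have bad N : exists n, (N <= n)%N && (e <= `|l - u n|).
  apply: contrapT => h; apply: nh; exists N => // n /= Nn.
  rewrite ltNge; apply/negP => en; apply: h; exists n; by rewrite Nn en.
pose nxt N := sval (cid (bad N)).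
have nxtP N : (N <= nxt N)%N /\ e <= `|l - u (nxt N)|.
  by rewrite /nxt; case: cid => n /= /andP[].
pose f n := iter n (fun N => nxt N.+1) (nxt 0%N).
have fe n : e <= `|l - u (f n)|.
  by case: n => [|n]; [exact: (nxtP 0%N).2|exact: (nxtP (f n).+1).2].
have finc : increasing_seq f.
  apply/increasing_seqP => n; rewrite /f iterS ltEnat /=.
  by have [] := nxtP (iter n (fun N => nxt N.+1) (nxt 0%N)).+1.
have [|g ginc /cvg_ex[x gx]] := @bolzano_weierstrass R (u \o f).
  exists M; split; first by rewrite num_real.
  by move=> y My x _; exact: le_trans (uM _) (ltW My).
have xl : x = l by apply: (ul (f \o g)) => //; move=> a b; exact: etrans (finc _ _) (ginc _ _).
have /cvgrPdist_lt/(_ e e0)[N _ /(_ N (leqnn N))] := gx.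
by rewrite xl ltNge /= fe.
Qed.

End Wallis.

(** * Birthday weights, their rising moments, and the limits of the tree polynomials *)

Section TauAsymptotics.
Variable R : realType.
Local Open Scope classical_set_scope.
Local Open Scope ring_scope.

(** Rising products replace the powers $j^p$ because they make the summation by parts exact, see
    [rising_moment_rec]. *)
Definition rising (p j : nat) : R := \prod_(i < p) (j + i.+1)%:R.

Lemma risingS p j : rising p.+1 j = rising p j * (j + p.+1)%:R.
Proof. by rewrite /rising big_ord_recr. Qed.

Lemma rising_shift p j : rising p.+1 j = (j.+1)%:R * rising p j.+1.
Proof.
rewrite /rising big_ord_recl addn1; congr (_ * _); apply: eq_bigr => i _.
by rewrite lift0 addnS.
Qed.

Lemma rising_gt0 p j : 0 < rising p j.
Proof. by apply: prodr_gt0 => i _; rewrite ltr0n addnS. Qed.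

(** This is $\prod_{i<j}(1-i/n)$, by [weight_rec]: a discrete counterpart of $e^{-j^2/(2n)}$. *)
Definition weight n j : R := treeX_inv R j n / n%:R ^+ n.

Section FixedN.
Variables (n : nat) (n0 : (0 < n)%N).
Local Notation s := (weight n).

Let nn0 : n%:R != 0 :> R. Proof. by rewrite pnatr_eq0 -lt0n. Qed.

Lemma weight0 : s 0 = 1.
Proof.
by rewrite /weight /treeX_inv expr0 mul1r tree_invE divff// expf_neq0.
Qed.

Lemma weight_rec j : n%:R * s j.+1 = (n%:R - j%:R) * s j.
Proof.
rewrite /weight mulrA mulr_natl treeX_inv_rec.
by rewrite [_ * (_ - _)]mulrC mulrA.
Qed.

Lemma weight_ge0 j : 0 <= s j.
Proof.
have [nj|jn] := ltnP n j.
  by rewrite /weight /treeX_inv treeXM_lt ?mul0r.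
elim: j jn => [|j IHj] jn; first by rewrite weight0.
have n1 : 0 < n%:R :> R by rewrite ltr0n.
rewrite -(pmulr_rge0 _ n1) weight_rec mulr_ge0 ?IHj 1?ltnW//.
by rewrite subr_ge0 ler_nat ltnW.
Qed.

Definition rising_moment p := \sum_(j < n.+1) rising p j * s j.
Local Notation N := rising_moment.

Lemma rising_moment0 : N 0 = tau R 2 n / n%:R ^+ n.
Proof.
rewrite /N tau2 mulr_suml; apply: eq_bigr => j _.
by rewrite /rising big_ord0 mul1r.
Qed.

Lemma rising_moment_gt0 p : 0 < N p.
Proof.
rewrite /N big_ord_recl ltr_wpDr// ?sumr_ge0//.
  by move=> i _; rewrite mulr_ge0 ?weight_ge0// ltW// rising_gt0.
by rewrite weight0 mulr1 rising_gt0.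
Qed.

(** Summation by parts; the boundary terms vanish because [a 0 = 0] and the weight at $n+1$ is
    zero. *)
Lemma weight_telescope (a : nat -> R) : a 0%N = 0 ->
  \sum_(j < n.+1) (a j.+1 * (n%:R - j%:R) - n%:R * a j) * s j = 0.
Proof.
move=> a0; pose b j := n%:R * a j * s j.
rewrite (eq_bigr (fun j : 'I_n.+1 => b j.+1 - b j)); last first.
  move=> j _; rewrite /b mulrBl; congr (_ - _).
  by rewrite -[LHS]mulrA -weight_rec; ring.
rewrite -(big_mkord xpredT (fun j => b j.+1 - b j)) telescope_sumr//.
by rewrite /b a0 mulr0 mul0r subr0 /weight /treeX_inv treeXM_lt// mul0r mulr0.
Qed.

Lemma rising_moment1 : N 1 = N 0 + n%:R.
Proof.
(* The indicator of $j>0$ isolates the weight at 0, which produces the term $n$. *)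
have h := @weight_telescope (fun j => (0 < j)%N%:R) erefl.
have e0 : \sum_(j < n.+1) n%:R * (j == 0%N :> nat)%:R * s j = n%:R.
  rewrite big_ord_recl /= mulr1 weight0 mulr1 big1 ?addr0// => j _.
  by rewrite mulr0 mul0r.
have e1 : N 1 - N 0 = \sum_(j < n.+1) j%:R * s j.
  rewrite /N -sumrB; apply: eq_bigr => j _.
  by rewrite risingS /rising big_ord0 addn1 -natr1; ring.
apply/eqP; rewrite -subr_eq0 opprD addrA e1 -[X in _ - X]e0 -oppr_eq0 -sumrB -sumrN.
apply/eqP; rewrite -[RHS]h; apply: eq_bigr => j _ /=.
by case: (nat_of_ord j) => [|m] /=; ring.
Qed.

Lemma rising_moment_rec p :
  N p.+2 = p.+2%:R * N p.+1 + n%:R * p.+1%:R * N p.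
Proof.
have h := @weight_telescope (fun j => j%:R * rising p j) (mul0r _).
apply/eqP; rewrite -subr_eq0 /N !mulr_sumr -big_split/= -sumrB -oppr_eq0 -sumrN.
apply/eqP; rewrite -[RHS]h; apply: eq_bigr => j _ /=.
by rewrite -rising_shift !risingS !natrD -!natr1; ring.
Qed.

Lemma rising_moment_quadratic p a :
  0 <= N p.+2 - 2 * a * N p.+1 + a ^+ 2 * N p.
Proof.
have -> : N p.+2 - 2 * a * N p.+1 + a ^+ 2 * N p =
    \sum_(j < n.+1) rising p j * (((j + p.+1)%:R - a) ^+ 2 + (j + p.+1)%:R) * s j.
  rewrite /N !mulr_sumr -sumrB -big_split /=; apply: eq_bigr => j _.
  rewrite !risingS (_ : (j + p.+2)%:R = (j + p.+1)%:R + 1); last by rewrite addnS natr1.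
  by ring.
apply: sumr_ge0 => j _; rewrite mulr_ge0 ?weight_ge0// mulr_ge0//; first exact/ltW/rising_gt0.
by rewrite addr_ge0// sqr_ge0.
Qed.

End FixedN.

(** The discriminant criterion, evaluated at the minimum $a=y/x$. It gives log-convexity, hence
    monotone ratios, for both [gauss_moment] and [rising_moment]. *)
Lemma quadratic_log_convex (x y w : R) : 0 < x ->
  (forall a, 0 <= w - 2 * a * y + a ^+ 2 * x) -> y ^+ 2 <= w * x.
Proof.
move=> x0 h; have := h (y / x); rewrite -(pmulr_rge0 _ x0).
have -> : x * (w - 2 * (y / x) * y + (y / x) ^+ 2 * x) = w * x - y ^+ 2.
  by field; rewrite gt_eqF.
by rewrite subr_ge0.
Qed.

(* Ratios of consecutive moments, scaled; [gauss_ratio] is their limit. *)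
Definition moment_ratio p n : R :=
  rising_moment n p.+1 / rising_moment n p / Num.sqrt n%:R.

Definition gauss_ratio p : R := Num.sqrt 2 * gauss_moment R p.+1 / gauss_moment R p.

Lemma gauss_ratio_gt0 p : 0 < gauss_ratio p.
Proof. by rewrite divr_gt0 ?mulr_gt0 ?gauss_moment_gt0// sqrtr_gt0. Qed.

Lemma gauss_ratioM p : gauss_ratio p.+1 * gauss_ratio p = p.+1%:R.
Proof.
have s2 : Num.sqrt 2 ^+ 2 = 2 :> R by rewrite sqr_sqrtr.
have := gauss_moment_gt0 R p; have := gauss_moment_gt0 R p.+1.
rewrite /gauss_ratio [gauss_moment _ p.+2]/=.
move: (gauss_moment R p.+1) (gauss_moment R p) => x y x0 y0.
transitivity (Num.sqrt 2 ^+ 2 * (p.+1%:R / 2) :> R); last by rewrite s2; field.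
by field; rewrite !gt_eqF.
Qed.

Lemma gauss_ratio_le p : gauss_ratio p <= gauss_ratio p.+1.
Proof.
have h := quadratic_log_convex (gauss_moment_gt0 R p) (gauss_moment_quadratic p).
move: (gauss_moment_gt0 R p) (gauss_moment_gt0 R p.+1) h; rewrite /gauss_ratio.
move: (gauss_moment R p.+2) (gauss_moment R p.+1) (gauss_moment R p) => c b a a0 b0 h.
rewrite ler_pdivrMr// mulrAC ler_pdivlMr// -!mulrA.
by rewrite ler_pM2l ?sqrtr_gt0// -expr2.
Qed.

Section FixedN2.
Variables (n : nat) (n0 : (0 < n)%N).
Local Notation y := (moment_ratio ^~ n).
Let q0 : 0 < Num.sqrt n%:R :> R. Proof. by rewrite sqrtr_gt0 ltr0n. Qed.

Lemma moment_ratio_gt0 p : 0 < y p.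
Proof. by rewrite !divr_gt0 ?rising_moment_gt0. Qed.

(** Up to a term of order $n^{-1/2}$, this is the relation satisfied by [gauss_ratio]. *)
Lemma moment_ratioM p :
  y p.+1 * y p = p.+2%:R / Num.sqrt n%:R * y p + p.+1%:R.
Proof.
have qq : Num.sqrt n%:R ^+ 2 = n%:R :> R by rewrite sqr_sqrtr.
have := rising_moment_gt0 n0 p; have := rising_moment_gt0 n0 p.+1.
have := rising_moment_rec n p; rewrite -[X in X * p.+1%:R]qq /moment_ratio.
move: (rising_moment n p.+2) (rising_moment n p.+1) (rising_moment n p) q0.
move: (Num.sqrt n%:R) => r c b a r0 -> b0 a0.
by field; rewrite !gt_eqF.
Qed.

Lemma moment_ratio_le p : y p <= y p.+1.
Proof.
have g0 := rising_moment_gt0 n0.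
rewrite /moment_ratio ler_pM2r ?invr_gt0// ler_pdivrMr// mulrAC ler_pdivlMr//.
by rewrite -expr2; exact: quadratic_log_convex (g0 p) (rising_moment_quadratic n0 p).
Qed.

Lemma sqrt_natr_ge1 : 1 <= Num.sqrt n%:R :> R.
Proof. by rewrite -[leLHS]sqrtr1 ler_wsqrtr// ler1n. Qed.

Lemma moment_ratio0_le : y 0 <= 3.
Proof.
have h1 := moment_ratioM 0; have h2 := moment_ratio_le 0; have h3 := moment_ratio_gt0 0.
have h4 : 2%:R / Num.sqrt n%:R <= 2 :> R.
  by rewrite ler_pdivrMr// ler_peMr// sqrt_natr_ge1.
by nra.
Qed.

Lemma moment_ratio0_ge : 1 / 4 <= y 0.
Proof.
have h1 := moment_ratioM 1; have h2 := moment_ratio_le 1; have h3 := moment_ratio_gt0 1.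
have h4 : 3%:R / Num.sqrt n%:R <= 3 :> R.
  by rewrite ler_pdivrMr// ler_peMr// sqrt_natr_ge1.
have h5 : y 1 <= 4 by nra.
have h6 := moment_ratioM 0; have h7 := moment_ratio_gt0 0.
have h8 : 1 <= y 1 * y 0.
  by rewrite h6 lerDr; exact: mulr_ge0 (divr_ge0 (ler0n _ _) (sqrtr_ge0 _)) (ltW h7).
have h9 : y 1 * y 0 <= 4 * y 0 by rewrite ler_wpM2r// ltW.
rewrite ler_pdivrMr//; apply: le_trans h8 _; by rewrite [leRHS]mulrC.
Qed.

End FixedN2.

Definition inv_sqrt n : R := (Num.sqrt n.+1%:R)^-1.

Lemma inv_sqrt_cvg0 : inv_sqrt n @[n --> \oo] --> 0.
Proof.
have h : Num.sqrt (n.+1%:R^-1 : R) @[n --> \oo] --> Num.sqrt (0 : R).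
  by apply: continuous_cvg; [exact: sqrt_continuous|exact: cvg_harmonic].
rewrite sqrtr0 in h; apply: cvg_trans h; apply: near_eq_cvg; near=> n.
by rewrite /inv_sqrt sqrtrV.
Unshelve. all: by end_near. Qed.

Lemma subseq_cvg0 (u : nat -> R) (f : nat -> nat) : increasing_seq f ->
  u n @[n --> \oo] --> 0 -> u (f n) @[n --> \oo] --> 0.
Proof.
move=> finc; apply: cvg_comp => A [N _ NA]; exists N => // n /= Nn; apply: NA => /=.
have fge m : (m <= f m)%N.
  elim: m => // m IHm; apply: (leq_ltn_trans IHm).
  by have /increasing_seqP/(_ m) := finc.
exact: leq_trans Nn (fge n).
Qed.

(** By compactness it suffices to treat a convergent subsequence. Along it all ratios converge, and
    their limits are positive, nondecreasing and satisfy the product rule of [gauss_ratio];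
    [wallis_unique] identifies them. *)
Lemma moment_ratio0_cvg : moment_ratio 0 n.+1 @[n --> \oo] --> gauss_ratio 0.
Proof.
apply: (@cvg_of_subseq _ _ _ 3) => [n|f x finc fx].
  by rewrite ger0_norm ?moment_ratio0_le// ltW// moment_ratio_gt0.
pose xs := fix xs p : R := if p is p'.+1 then p'.+1%:R / xs p' else x.
have x0 : 0 < x.
  apply: (@lt_le_trans _ _ (1 / 4)) => //; apply: (cvgr_to_ge fx).
  by apply: nearW => n; exact: moment_ratio0_ge.
have xs0 p : 0 < xs p by elim: p => //= p IHp; rewrite divr_gt0.
have ycvg p : moment_ratio p (f n).+1 @[n --> \oo] --> xs p.
  elim: p => // p IHp.
  have : p.+2%:R * inv_sqrt (f n) + p.+1%:R / moment_ratio p (f n).+1 @[n --> \oo]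
      --> p.+2%:R * 0 + p.+1%:R / xs p.
    apply: cvgD; apply: cvgMl_tmp; first exact: subseq_cvg0 inv_sqrt_cvg0.
    by apply: cvgV => //; rewrite gt_eqF.
  rewrite mulr0 add0r; apply: cvg_trans; apply: near_eq_cvg; apply: nearW => n /=.
  have y0 := @moment_ratio_gt0 (f n).+1 isT p.
  apply: (mulIf (lt0r_neq0 y0)); rewrite moment_ratioM//.
  by rewrite mulrDl mulfVK ?gt_eqF.
apply: (@wallis_unique _ xs) => //; rewrite ?gauss_ratio_gt0//.
- by move=> p; exact: gauss_ratio_gt0.
- by move=> p /=; rewrite mulfVK// gt_eqF.
- exact: gauss_ratioM.
- move=> p; apply: (ler_cvg_to (ycvg p) (ycvg p.+1)).
  by apply: nearW => n; exact: moment_ratio_le.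
- exact: gauss_ratio_le.
Qed.

Definition tau_scaled m n : R := tau R m.+1 n / (n%:R ^+ n * Num.sqrt n%:R ^+ m).

(** In closed form $\sqrt\pi/(2^{m/2}\,\Gamma((m+1)/2))$. *)
Definition tau_limit m : R := Num.sqrt pi / (Num.sqrt 2 ^+ m * (2 * gauss_moment R m)).

Lemma tau_scaled_rec m n : (0 < n)%N -> tau_scaled m.+2 n =
  tau_scaled m.+1 n / Num.sqrt n%:R + tau_scaled m n / m.+1%:R.
Proof.
move=> n0; have q0 : 0 < Num.sqrt n%:R :> R by rewrite sqrtr_gt0 ltr0n.
have qq : Num.sqrt n%:R ^+ 2 = n%:R :> R by rewrite sqr_sqrtr.
have nn : 0 < n%:R ^+ n :> R by rewrite exprn_gt0// ltr0n.
have m0 : m.+1%:R != 0 :> R by [].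
have h : tau R m.+3 n * m.+1%:R = tau R m.+2 n * m.+1%:R + tau R m.+1 n * Num.sqrt n%:R ^+ 2.
  by rewrite qq !mulr_natr tau_rec.
rewrite /tau_scaled.
have -> : tau R m.+3 n = tau R m.+2 n + tau R m.+1 n * Num.sqrt n%:R ^+ 2 / m.+1%:R.
  by apply: (mulIf m0); rewrite h mulrDl mulfVK.
rewrite !exprS; move: (Num.sqrt n%:R) (n%:R ^+ n) q0 nn => r c r0 c0.
by field; rewrite !gt_eqF ?exprn_gt0//=.
Qed.

(** The recursion [tau_scaled_rec] has step two up to a vanishing term, so two starting values
    suffice: $m=0$ is exact and $m=1$ comes from the Wallis argument. *)
Lemma tau_scaled_cvg m : tau_scaled m n.+1 @[n --> \oo] --> tau_limit m.
Proof.
have nn n : 0 < n.+1%:R ^+ n.+1 :> R by rewrite exprn_gt0.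
have sp : 0 < Num.sqrt pi :> R by rewrite sqrtr_gt0 pi_gt0.
have s2 : 0 < Num.sqrt 2 :> R by rewrite sqrtr_gt0.
suff [] : tau_scaled m n.+1 @[n --> \oo] --> tau_limit m /\
    tau_scaled m.+1 n.+1 @[n --> \oo] --> tau_limit m.+1 by [].
elim: m => [|m [IHm IHm1]]; [split|split=> //].
- have -> : tau_limit 0 = 1 by rewrite /tau_limit expr0 /=; field; rewrite gt_eqF.
  rewrite (_ : (fun n => tau_scaled 0 n.+1) = cst 1); first exact: cvg_cst.
  by apply/funext => n; rewrite /tau_scaled tau1 expr0 mulr1 divff// gt_eqF.
(* By [rising_moment1] the first ratio is $1/\sqrt n$ plus the inverse of [tau_scaled 1]. *)
- have -> : tau_limit 1 = (gauss_ratio 0 - 0)^-1.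
    by rewrite /tau_limit /gauss_ratio /= subr0; field; rewrite !gt_eqF.
  have : (moment_ratio 0 n.+1 - inv_sqrt n)^-1 @[n --> \oo] --> (gauss_ratio 0 - 0)^-1.
    apply: cvgV; first by rewrite subr0 gt_eqF// gauss_ratio_gt0.
    by apply: cvgB; [exact: moment_ratio0_cvg|exact: inv_sqrt_cvg0].
  apply: cvg_trans; apply: near_eq_cvg; apply: nearW => n /=.
  have q0 : 0 < Num.sqrt n.+1%:R :> R by rewrite sqrtr_gt0 ltr0n.
  have qq : Num.sqrt n.+1%:R ^+ 2 = n.+1%:R :> R by rewrite sqr_sqrtr.
  have N0 := @rising_moment_gt0 n.+1 isT 0; rewrite rising_moment0 in N0.
  rewrite /moment_ratio rising_moment1// rising_moment0 /inv_sqrt /tau_scaled expr1.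
  rewrite [in RHS]invfM [in RHS]mulrA; move: qq N0 q0.
  move: (tau R 2 n.+1 / n.+1%:R ^+ n.+1) (Num.sqrt _) => a r <- a0 r0.
  have -> : (a + r ^+ 2) / a / r - r^-1 = r / a by field; rewrite !gt_eqF.
  by rewrite invf_div.
have -> : tau_limit m.+2 = tau_limit m.+1 * 0 + tau_limit m / m.+1%:R.
  have g0 := gauss_moment_gt0 R m; have qq : Num.sqrt 2 ^+ 2 = 2 :> R by rewrite sqr_sqrtr.
  rewrite mulr0 add0r /tau_limit [gauss_moment R m.+2]/= !exprS.
  transitivity (Num.sqrt pi / (Num.sqrt 2 ^+ 2 * Num.sqrt 2 ^+ m * (m.+1%:R * gauss_moment R m))).
    by rewrite expr2; congr (_ / _); field.
  by rewrite qq; field; rewrite !gt_eqF ?exprn_gt0//=.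
have : tau_scaled m.+1 n.+1 * inv_sqrt n + tau_scaled m n.+1 / m.+1%:R @[n --> \oo]
    --> tau_limit m.+1 * 0 + tau_limit m / m.+1%:R.
  by apply: cvgD; [apply: cvgM => //; exact: inv_sqrt_cvg0|exact: cvgMr_tmp].
apply: cvg_trans; apply: near_eq_cvg; apply: nearW => n /=.
by rewrite tau_scaled_rec.
Qed.

End TauAsymptotics.

(** * The coefficients of the logarithm of the Airy series *)

Section FpsLog.
Variable R : realType.
Implicit Types (p u : {poly R}).

Lemma coef_expr_eq p u k j : (forall i, (i <= k)%N -> p`_i = u`_i) ->
  forall i, (i <= k)%N -> (p ^+ j)`_i = (u ^+ j)`_i.
Proof.
move=> pu; elim: j => [|j IHj] i ik; first by rewrite !expr0.
rewrite !exprS !coefM; apply: eq_bigr => l _; have := ltn_ord l => li.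
by rewrite pu ?IHj//; lia.
Qed.

Lemma coef_expr_low u j : u`_0 = 0 -> forall i, (i < j)%N -> (u ^+ j)`_i = 0.
Proof.
move=> u0; elim: j => // j IHj i ij.
rewrite exprS coefM big1// => l _; have := ltn_ord l => li.
by case: (posnP l) => [->|l0]; rewrite ?u0 ?mul0r// IHj ?mulr0//; lia.
Qed.

Variable a : nat -> R.
Hypothesis a0 : a 0%N = 1.

Let u N : {poly R} := \poly_(n < N.+1) a n - 1.
Let L N : {poly R} := \sum_(1 <= j < N.+1) ((-1) ^+ j.-1 / j%:R) *: (u N) ^+ j.

Let u0 N : (u N)`_0 = 0.
Proof. by rewrite coefB coef_poly coef1 a0 subrr. Qed.

Let uE N i : (i <= N)%N -> (u N)`_i = a i - (i == 0%N)%:R.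
Proof. by move=> iN; rewrite coefB coef_poly coef1 ltnS iN. Qed.

Let coefL N k : (k <= N)%N -> (L N)`_k = fps_log a k.
Proof.
move=> kN; rewrite /L coef_sum /fps_log (@big_cat_nat _ _ _ k.+1)//=.
rewrite [X in _ + X]big_nat_cond [X in _ + X]big1 ?addr0; last first.
  by move=> j; rewrite andbT => /andP[kj _]; rewrite coefZ coef_expr_low ?mulr0.
apply: eq_big_nat => j _; rewrite coefZ; congr (_ * _).
apply: (@coef_expr_eq _ _ k) => // i ik.
by rewrite -/(u k) !uE// (leq_trans ik).
Qed.

(** A finite geometric sum; the error $(-u)^N$ has order at least $N$, so it does not affect the
    lower coefficients. *)
Let derivL N : (L N)^`() * (1 + u N) = (u N)^`() * (1 - (- u N) ^+ N).
Proof.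
have -> : (L N)^`() = (u N)^`() * \sum_(i < N) (- u N) ^+ i.
  rewrite /L raddf_sum/= big_add1 /= big_mkord mulr_sumr.
  apply: eq_bigr => i _; rewrite derivZ deriv_exp /= [in RHS]exprNn -mul_polyC.
  have e : ((-1) ^+ i / i.+1%:R)%:P * i.+1%:R = (-1) ^+ i :> {poly R}.
    by rewrite -(rmorph_nat (@polyC R)) -polyCM mulfVK// rmorphXn rmorphN rmorph1.
  by rewrite -e -(mulr_natr (_^`() * _) i.+1); ring.
rewrite -mulrA; congr (_ * _).
by rewrite -[RHS]opprB subrX1; ring.
Qed.

(** The identity $A'=(\log A)'A$, through which the explicit [fps_log] is used from here on. *)
Lemma fps_log_deriv n :
  n.+1%:R * a n.+1 = \sum_(l < n.+1) l.+1%:R * fps_log a l.+1 * a (n - l)%N.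
Proof.
have := congr1 (fun p : {poly R} => p`_n) (derivL n.+1).
rewrite mulrBr mulr1 coefB coefM [X in _ - X]coefM.
rewrite [X in _ - X]big1 ?subr0; last first.
  move=> l _; rewrite exprNn coefM big1 ?mulr0// => m _.
  by rewrite (coef_expr_low (u0 _)) ?mulr0//; lia.
rewrite coef_deriv uE// subr0 mulr_natl => <-; apply: eq_bigr => l _.
have ln := ltn_ord l; rewrite coef_deriv coefL//.
rewrite coefD coef1 uE; last by lia.
by rewrite addrC subrK mulr_natl.
Qed.

End FpsLog.

(** * The Riccati recursion for the coefficients $c_k$ *)

Section AiryCoef.
Variable R : realType.
Local Notation H := (hurwitz R).
Local Notation D := (@hz_euler R).
Local Notation c := (airy_c R).

Let eulerE (f : H) n : D f n = n%:R * f n.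
Proof. by rewrite hz_eulerE mulr_natl. Qed.

Definition airy_series n : R :=
  pochhammer (1 / 6) n * pochhammer (5 / 6) n / n`!%:R * (3 / 2) ^+ n.

Lemma airy_series0 : airy_series 0 = 1.
Proof. by rewrite /airy_series /pochhammer !big_ord0 fact0 expr0 divr1 !mulr1. Qed.

Let nf n : n`!%:R != 0 :> R. Proof. by rewrite pnatr_eq0 -lt0n fact_gt0. Qed.

(** The factor $n!$ represents an ordinary power series in the Hurwitz ring. *)
Definition airy_egf : H := fun n => n`!%:R * airy_series n.
Definition airy_log_egf : H := fun n => n`!%:R * c n.

Lemma airy_egf0 : airy_egf 0%N = 1.
Proof. by rewrite /airy_egf airy_series0 mulr1. Qed.

Lemma airy_egfS n : airy_egf n.+1 = 3 / 2 * (n%:R ^+ 2 + n%:R + 5 / 36) * airy_egf n.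
Proof.
rewrite /airy_egf /airy_series /pochhammer !big_ord_recr /= exprS.
by field; rewrite !nf.
Qed.

Lemma deriv_airy_egf : hz_deriv airy_egf = hz_deriv airy_log_egf * airy_egf.
Proof.
apply/funext => n; rewrite hzM hz_derivE /airy_egf factS natrM -mulrA mulrCA.
rewrite (fps_log_deriv airy_series0) mulr_sumr; apply: eq_bigr => l _.
rewrite hz_derivE /airy_log_egf /c -/airy_series factS natrM -[RHS]mulr_natr.
have ln : (l <= n)%N by rewrite -ltnS ltn_ord.
by rewrite -(bin_fact ln) !natrM; ring.
Qed.

Lemma euler_airy_egf : D airy_egf = D airy_log_egf * airy_egf.
Proof. by rewrite !euler_deriv deriv_airy_egf mulrA. Qed.

(** The hypergeometric series solves a linear second-order equation, since
    $(n+1/6)(n+5/6)=n^2+n+5/36$; its logarithmic derivative solves a Riccati equation. *)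
Lemma airy_riccati :
  hz_deriv airy_log_egf = hz_const (3 / 2) *
    (D (D airy_log_egf) + D airy_log_egf ^+ 2 + D airy_log_egf + hz_const (5 / 36)).
Proof.
apply: (hz_mulrI airy_egf0); rewrite -deriv_airy_egf.
have -> : hz_deriv airy_egf =
    hz_const (3 / 2) * (D (D airy_egf) + D airy_egf + hz_const (5 / 36) * airy_egf).
  apply/funext => n; rewrite hz_derivE hz_constM !hzD hz_constM !eulerE airy_egfS; ring.
by rewrite euler_airy_egf hz_eulerM euler_airy_egf; ring.
Qed.

Lemma airy_c_rec k : k.+1%:R * c k.+1 = 3 / 2 *
  (k%:R ^+ 2 * c k + k%:R * c k
   + \sum_(i < k.+1) (i%:R * c i) * ((k - i)%N%:R * c (k - i)%N)
   + (k == 0%N)%:R * (5 / 36)).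
Proof.
have := congr1 (fun f : H => f k) airy_riccati.
rewrite hz_derivE hz_constM !hzD expr2 hzM !eulerE /airy_log_egf => e.
apply: (mulfI (nf k)).
transitivity (k.+1`!%:R * c k.+1); first by rewrite factS natrM; ring.
rewrite e.
rewrite [RHS]mulrCA; congr (_ * _); rewrite !mulrDr -!addrA; congr (_ + _).
  by ring.
rewrite addrCA; congr (_ + _); first by ring.
congr (_ + _); last by case: (k) => [|m] /=; rewrite ?mul0r ?mulr0// fact0; ring.
rewrite mulr_sumr; apply: eq_bigr => i _.
have ik : (i <= k)%N by rewrite -ltnS ltn_ord.
by rewrite !eulerE -[LHS]mulr_natr -(bin_fact ik) !natrM; ring.
Qed.

(* Leading coefficients of the expansion of [hz_euler (excess R k.+1)]. *)
Definition airy_b k : R := 3 * k%:R * c k + (k == 0%N)%:R / 2.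

(** This is the recursion that the leading coefficients inherit from Wright's. The extra $1/2$ at
    $k=0$ in [airy_b] comes from $DW_1=z(z-1)/2$ and accounts for the inhomogeneous terms of
    [airy_c_rec]. *)
Lemma airy_b_rec k : airy_b k.+1 =
  ((3 * k%:R + 2) * airy_b k + \sum_(i < k.+1) airy_b i * airy_b (k - i)) / 2.
Proof.
have -> : \sum_(i < k.+1) airy_b i * airy_b (k - i) =
    9 * \sum_(i < k.+1) (i%:R * c i) * ((k - i)%N%:R * c (k - i)%N)
    + 3 * k%:R * c k + (k == 0%N)%:R / 4.
  have e1 : \sum_(i < k.+1) (i == 0%N :> nat)%:R * ((k - i)%N%:R * c (k - i)%N) = k%:R * c k.
    by rewrite big_ord_recl mul1r subn0 big1 ?addr0// => i _; rewrite mul0r.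
  have e2 : \sum_(i < k.+1) ((k - i)%N == 0%N)%:R * (i%:R * c i) = k%:R * c k.
    rewrite big_ord_recr /= subnn mul1r big1 ?add0r// => i _.
    by rewrite subn_eq0 leqNgt ltn_ord mul0r.
  have e3 : \sum_(i < k.+1) (i == 0%N :> nat)%:R * ((k - i)%N == 0%N)%:R = (k == 0%N)%:R :> R.
    by rewrite big_ord_recl mul1r subn0 big1 ?addr0// => i _; rewrite mul0r.
  transitivity (9 * \sum_(i < k.+1) (i%:R * c i) * ((k - i)%N%:R * c (k - i)%N)
    + 3 / 2 * (k%:R * c k) + 3 / 2 * (k%:R * c k) + (k == 0%N)%:R / 4); last by field.
  rewrite -{1}e1 -{1}e2 -e3 mulr_suml !mulr_sumr -!big_split /=.
  by apply: eq_bigr => i _; rewrite /airy_b; field.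
rewrite {1 2}/airy_b mulr0n mul0r addr0 -mulrA airy_c_rec.
move: (\sum_(i < _) _) => S.
by case: (k) => [|m] /=; field.
Qed.

Lemma airy_series_ge0 n : 0 <= airy_series n.
Proof.
rewrite /airy_series !mulr_ge0 ?invr_ge0 ?exprn_ge0//; apply: prodr_ge0 => i _;
  by rewrite addr_ge0.
Qed.

Lemma airy_series_le n : airy_series n <= n`!%:R * (3 / 2) ^+ n.
Proof.
have f0 m : 0 < m`!%:R :> R by rewrite ltr0n fact_gt0.
rewrite -(ler_pM2l (f0 n)) -/(airy_egf n); elim: n => [|n IHn].
  by rewrite airy_egf0 fact0 expr0 !mulr1.
rewrite airy_egfS.
have -> : n.+1`!%:R * (n.+1`!%:R * (3 / 2) ^+ n.+1) =
    3 / 2 * (n%:R + 1) ^+ 2 * (n`!%:R * (n`!%:R * (3 / 2) ^+ n)) :> R.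
  by rewrite factS natrM -natr1 exprS; ring.
have n0 : 0 <= n%:R :> R by [].
apply: ler_pM; last exact: IHn.
- by move: (n%:R : R) n0 => x x0; nra.
- by rewrite mulr_ge0// airy_series_ge0.
- by move: (n%:R : R) n0 => x x0; nra.
Qed.

(** If all $c_k\ge0$, dropping the other terms of [fps_log_deriv] leaves $c_n\le a_n$. The sign
    hypothesis is supplied by [airy_c_ge0]. *)
Lemma airy_c_le n : (forall k, (0 < k)%N -> 0 <= c k) -> (0 < n)%N ->
  c n <= n`!%:R * (3 / 2) ^+ n.
Proof.
case: n => // n c0 _; apply: le_trans (airy_series_le n.+1).
have n0 : 0 < n.+1%:R :> R by [].
rewrite -(ler_pM2l n0) (fps_log_deriv airy_series0) big_ord_recr /= subnn.
rewrite airy_series0 mulr1 lerDr sumr_ge0// => i _.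
by rewrite mulr_ge0 ?airy_series_ge0// mulr_ge0// c0.
Qed.

End AiryCoef.

(** * Asymptotics at fixed excess *)

Section ExcessAsymptotics.
Variable R : realType.
Local Open Scope classical_set_scope.
Local Open Scope ring_scope.
Local Notation H := (hurwitz R).
Local Notation D := (@hz_euler R).
Local Notation z := (tree_inv R).
Local Notation T := (tree R).
Local Notation W := (excess R).
Local Notation c := (airy_c R).
Local Notation b := (airy_b R).

Definition ev (q : {poly R}) : H := (map_poly (@hz_const R) q).[z].

Lemma evD p q : ev (p + q) = ev p + ev q.
Proof. by rewrite /ev rmorphD hornerD. Qed.
Lemma evM p q : ev (p * q) = ev p * ev q.
Proof. by rewrite /ev rmorphM hornerM. Qed.
Lemma evC a : ev a%:P = hz_const a.
Proof. by rewrite /ev map_polyC hornerC. Qed.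
Lemma ev1 : ev 1 = 1.
Proof. by rewrite /ev rmorph1 hornerC. Qed.
Lemma evX : ev 'X = z.
Proof. by rewrite /ev map_polyX hornerX. Qed.
Lemma evXn n : ev 'X^n = z ^+ n.
Proof. by elim: n => [|n IHn]; rewrite ?expr0 ?evC// !exprS evM evX IHn. Qed.
Lemma evN p : ev (- p) = - ev p.
Proof. by rewrite /ev rmorphN hornerN. Qed.

Lemma ev_sum d (q : {poly R}) : (size q <= d.+1)%N ->
  ev q = \sum_(i < d.+1) hz_const q`_i * z ^+ i.
Proof.
move=> sq; rewrite /ev (@horner_coef_wide _ d.+1); last by rewrite (leq_trans (size_poly _ _)).
by apply: eq_bigr => i _; rewrite coef_map.
Qed.

Lemma euler_ev q : D (ev q) = ev (('X^3 - 'X^2) * q^`()).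
Proof.
elim/poly_ind: q => [|q a IHq].
  by rewrite deriv0 mulr0 /ev rmorph0 horner0 raddf0.
rewrite evD evM evX evC hz_eulerD hz_euler_const addr0 hz_eulerM IHq.
rewrite derivD derivC addr0 derivM derivX mulr1 !(evM, evD, evN, evX, evXn).
by rewrite euler_tree_inv; ring.
Qed.

(* W is a combination of the powers z^lo, ..., z^(lo + d), with coefficient l at
   the top power. *)
Definition tree_span (lo d : nat) (l : R) (F : H) :=
  exists q : {poly R}, [/\ (size q <= d.+1)%N, q`_d = l & F = z ^+ lo * ev q].

Lemma tree_span_add lo d l1 l2 F G :
  tree_span lo d l1 F -> tree_span lo d l2 G -> tree_span lo d (l1 + l2) (F + G).
Proof.
move=> [p [sp lp ->]] [q [sq lq ->]]; exists (p + q); split.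
- by rewrite (leq_trans (size_polyD _ _))// geq_max sp sq.
- by rewrite coefD lp lq.
- by rewrite evD mulrDr.
Qed.

Lemma tree_span_scale lo d l a F :
  tree_span lo d l F -> tree_span lo d (a * l) (hz_const a * F).
Proof.
move=> [p [sp lp ->]]; exists (a%:P * p); split.
- by rewrite mul_polyC (leq_trans (size_scale_leq _ _)).
- by rewrite coefCM lp.
- by rewrite evM evC mulrCA.
Qed.

Lemma tree_span_mul lo1 d1 l1 F lo2 d2 l2 G :
  tree_span lo1 d1 l1 F -> tree_span lo2 d2 l2 G ->
  tree_span (lo1 + lo2) (d1 + d2) (l1 * l2) (F * G).
Proof.
move=> [p [sp lp ->]] [q [sq lq ->]]; exists (p * q); split.
- apply: leq_trans (size_polyMleq _ _) _.
  by move: (size p) (size q) sp sq => x y; lia.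
- have d1lt : (d1 < (d1 + d2).+1)%N by rewrite ltnS leq_addr.
  rewrite coefM (bigD1 (Ordinal d1lt))//= addKn lp lq big1 ?addr0// => i id.
  have [di|di] := ltnP d1 i; first by rewrite nth_default ?mul0r// (leq_trans sp).
  rewrite (@nth_default _ _ q) ?mulr0// (leq_trans sq)//.
  have : (i : nat) != d1 by apply: contraNneq id => idE; apply/eqP/val_inj.
  by move: di; lia.
- by rewrite evM exprD mulrACA.
Qed.

(** As $Dz^m=m(z^{m+2}-z^{m+1})$, the lowest power rises by one and the top power by two. *)
Lemma tree_span_euler lo d l F :
  tree_span lo d l F -> tree_span lo.+1 d.+1 ((lo + d)%:R * l) (D F).
Proof.
move=> [q [sq lq ->]].
exists (('X - 1) * (lo%:R%:P * q + 'X * q^`())); split.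
- apply: leq_trans (size_polyMleq _ _) _; rewrite size_XsubC add2n /= ltnS.
  rewrite (leq_trans (size_polyD _ _))// geq_max; apply/andP; split.
    by rewrite mul_polyC (leq_trans (size_scale_leq _ _)).
  apply: leq_trans (size_polyMleq _ _) _; rewrite size_polyX add2n /= ltnS.
  by apply: leq_trans (size_poly _ _) _; case: (size q) sq.
- have cd i : (lo%:R%:P * q + 'X * q^`())`_i = lo%:R * q`_i + q`_i *+ i.
    rewrite coefD coefCM coefXM coef_deriv; by case: i => [|i].
  rewrite mulrBl mul1r coefB coefXM /= !cd lq (@nth_default _ _ q d.+1)//.
  by rewrite mulr0 mul0rn addr0 subr0 natrD mulrDl mulr_natl mulr_natl.
- rewrite hz_eulerM euler_tree_invX euler_ev !(evM, evD, evN, evX, ev1, evXn) evC.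
  by rewrite -mulr_natl -(rmorph_nat (@hz_const R)) !exprS; ring.
Qed.

Lemma tree_span_sum n lo d (l : nat -> R) (F : nat -> H) :
  (forall i, (i < n.+1)%N -> tree_span lo d (l i) (F i)) ->
  tree_span lo d (\sum_(i < n.+1) l i) (\sum_(i < n.+1) F i).
Proof.
elim: n => [|n IHn] h; first by rewrite !big_ord1; exact: h.
rewrite big_ord_recr [X in tree_span _ _ _ X]big_ord_recr /=.
by apply: tree_span_add; [apply: IHn => i /ltnW; exact: h|exact: h].
Qed.

(** Half of what remains on the left of Wright's recursion once the two terms $T\,DW_k$ have been
    moved there. *)
Definition wright_op k (F : H) : H := (1 - T) * D F + hz_const k%:R * F.

Lemma wright_opD k F G : wright_op k (F + G) = wright_op k F + wright_op k G.
Proof. by rewrite /wright_op hz_eulerD; ring. Qed.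

Lemma wright_op_scale k a F : wright_op k (hz_const a * F) = hz_const a * wright_op k F.
Proof. by rewrite /wright_op hz_eulerM hz_euler_const mul0r add0r; ring. Qed.

Lemma wright_op_pow k d :
  wright_op k (z ^+ (k + d)) = hz_const (k + d)%:R * z ^+ (k + d).+1
    - hz_const d%:R * z ^+ (k + d).
Proof.
have e : (1 - T) * D (z ^+ (k + d)) = hz_const (k + d)%:R * (z ^+ (k + d).+1 - z ^+ (k + d)).
  rewrite euler_tree_invX -mulr_natl -(rmorph_nat (@hz_const R)) mulrCA; congr (_ * _).
  by rewrite [z ^+ _.+2]exprS [z ^+ _.+1]exprS -!mulrBr mulrA tree_invM mul1r.
by rewrite /wright_op e natrD rmorphD; ring.
Qed.

(** The operator is triangular on coefficients, with diagonal entries $n+k+1\ne0$. *)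
Lemma wright_op_inj k F : wright_op k.+1 F = 0 -> F = 0.
Proof.
move=> F0; apply/funext => n; elim/ltn_ind: n => n IHn.
have := congr1 (fun f : H => f n) F0.
rewrite /wright_op mulrBl mul1r hzD hz_constM hzD hzN hzM big_ord_recl /=.
rewrite tree_at0 mul0r mul0rn add0r big1 ?subr0; last first.
  move=> i _; rewrite hz_eulerE IHn ?mul0rn ?mulr0 ?mul0rn//.
  by have := ltn_ord i; rewrite /bump; lia.
rewrite hz_eulerE -[F n *+ n]mulr_natl -mulrDl => /eqP.
rewrite mulf_eq0 => /orP[|/eqP->//].
by rewrite -natrD pnatr_eq0 addnS.
Qed.

(** By [wright_op_pow] the powers of $z$ can be eliminated from the top down. The elimination stops
    exactly at $z^{k+1}$, whose image is a single power. *)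
Lemma wright_op_solve k d r F : tree_span k.+2 d r F ->
  exists2 G, tree_span k.+1 d (r / (k.+1 + d)%:R) G & wright_op k.+1 G = F.
Proof.
elim: d r F => [|d IHd] r F [q [sq lq FE]].
  exists (hz_const (r / (k.+1 + 0)%:R) * z ^+ k.+1).
    exists ((r / (k.+1 + 0)%:R)%:P); split; rewrite ?coefC ?evC 1?mulrC//.
    by rewrite (leq_trans (size_polyC_leq1 _)).
  have := wright_op_pow k.+1 0; rewrite wright_op_scale addn0 => ->.
  rewrite rmorph0 mul0r subr0 mulrA -rmorphM /= mulfVK// FE (size1_polyC sq) evC -lq.
  by rewrite mulrC.
pose a := r / (k.+1 + d.+1)%:R.
(* What is left of [q] after subtracting the image of $a\,z^{k+d+2}$. *)
pose p := q - r%:P * 'X^(d.+1) + (a * d.+1%:R)%:P * 'X^d.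
have sp : (size p <= d.+1)%N.
  apply/leq_sizeP => j dj; rewrite /p coefD coefB !coefCM !coefXn.
  have -> : (j == d) = false by apply/eqP => jd; move: dj; rewrite jd ltnn.
  rewrite mulr0 addr0; have [->|jd] := eqVneq j d.+1; first by rewrite lq mulr1 subrr.
  by rewrite mulr0 subr0 nth_default// (leq_trans sq)// ltn_neqAle eq_sym jd.
have [G [g [sg lg GE]] GF] := IHd p`_d (z ^+ k.+2 * ev p) (ex_intro _ p (And3 sp erefl erefl)).
exists (G + hz_const a * z ^+ (k.+1 + d.+1)).
  exists (g + a%:P * 'X^(d.+1)); split.
  - rewrite (leq_trans (size_polyD _ _))// geq_max (leq_trans sg)//=.
    by rewrite mul_polyC (leq_trans (size_scale_leq _ _))// size_polyXn.
  - by rewrite coefD nth_default// coefCM coefXn eqxx mulr1 add0r.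
  - by rewrite evD evM evC evXn mulrDr GE exprD; congr (_ + _); rewrite mulrCA.
rewrite wright_opD GF wright_op_scale wright_op_pow FE /p.
have ar : hz_const a * hz_const (k.+1 + d.+1)%:R = hz_const r.
  by rewrite -rmorphM /= /a mulfVK.
rewrite evD evD evN !evM !evC !evXn rmorphM mulrBr mulrA ar.
rewrite [z ^+ (k.+1 + d.+1)]exprD [z ^+ (k.+1 + d.+1).+1](exprD z k.+2 d.+1).
by rewrite !exprS; ring.
Qed.

Lemma excess_rec1 : D (W 1) = z * ev (2^-1%:P * ('X - 1)).
Proof.
have := excess_rec R 1; rewrite !big_ord_recl big_ord0 subrr rmorph0 mulr0 !addr0 /=.
rewrite -/T euler_treeE tree_mul_inv => h.
transitivity (z * ((1 - T) * D (W 1))); first by rewrite mulrA [z * _]mulrC tree_invM mul1r.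
have -> : (1 - T) * D (W 1) = hz_const 2^-1 * (z - 1).
  apply: (@hz_mulrnI _ _ _ 1); rewrite mulrBl mul1r mulrnBl h mulr2n.
  have -> : hz_const (2^-1) * (z - 1) *+ 2 = hz_const (2^-1 *+ 2) * (z - 1) :> H.
    by rewrite raddfMn /= mulrnAl.
  have e2 : 2^-1 *+ 2 = 1 :> R by rewrite -[_ *+ 2]mulr_natr mulVf.
  by rewrite e2 rmorph1 mul1r; ring.
by rewrite evM evC evD evN evX ev1.
Qed.

Lemma excess_recSS k : wright_op k.+1 (W k.+2) *+ 2 =
  D (D (W k.+1)) + \sum_(i < k.+1) D (W i.+1) * D (W (k - i).+1).
Proof.
have := excess_rec R k.+2; rewrite big_ord_recl big_ord_recr /= subn0 subnn.
under eq_bigr => i _ do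
  rewrite /bump leq0n add1n subSS (subSn (ltn_ord i : (i <= k)%N)).
rewrite /bump leq0n add1n.
have -> : k.+2%:R - 1 = k.+1%:R :> R by rewrite -natr1 addrK.
move=> h; have -> : wright_op k.+1 (W k.+2) *+ 2 =
    (D (W k.+2) + W k.+2 * hz_const k.+1%:R) *+ 2 - T * D (W k.+2) *+ 2.
  by rewrite -mulrnBl /wright_op; congr (_ *+ 2); ring.
by rewrite h -/T; ring.
Qed.

(** Strong induction along [excess_recSS]; top coefficients multiply and add as in [airy_b_rec]. The
    claim on [W] itself starts at $W_2$, because $W_1=\frac12\log z$ is no polynomial in $z$. *)
Lemma tree_span_excess k :
  tree_span k.+1 (k.*2).+1 (b k) (D (W k.+1)) /\
  (0 < k -> tree_span k k.*2 (c k) (W k.+1))%N.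
Proof.
elim/ltn_ind: k => -[|k] IHk.
  split=> //; exists (2^-1%:P * ('X - 1)); split.
  - by rewrite mul_polyC (leq_trans (size_scale_leq _ _))// size_XsubC.
  - by rewrite coefCM coefB coefX coefC /= subr0 mulr1 /airy_b mulr0 mul0r add0r mul1r.
  - exact: excess_rec1.
have h2 : tree_span k.+2 k.+1.*2 (b k.+1 *+ 2) (wright_op k.+1 (W k.+2) *+ 2).
  rewrite excess_recSS.
  have -> : b k.+1 *+ 2 = (k.+1 + k.*2.+1)%:R * b k + \sum_(i < k.+1) b i * b (k - i).
    have half2 (x : R) : x / 2 *+ 2 = x by rewrite -[_ *+ 2]mulr_natr mulfVK.
    rewrite airy_b_rec half2; congr (_ * _ + _).
    by rewrite -muln2 natrD -!natr1 natrM; ring.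
  apply: tree_span_add.
    by rewrite doubleS; apply: tree_span_euler; have [] := IHk k (ltnSn k).
  apply: (@tree_span_sum _ _ _ (fun i => b i * b (k - i))
    (fun i => D (W i.+1) * D (W (k - i).+1))) => i ik.
  have -> : k.+2 = (i.+1 + (k - i).+1)%N by lia.
  have -> : k.+1.*2 = (i.*2.+1 + (k - i).*2.+1)%N by lia.
  apply: tree_span_mul; first by have [] := IHk i ik.
  by have [] := IHk (k - i)%N (leq_subr _ _).
have h1 : tree_span k.+2 k.+1.*2 (b k.+1) (wright_op k.+1 (W k.+2)).
  have := tree_span_scale 2^-1 h2; rewrite -(mulr_natl (b _) 2) mulKf//.
  rewrite -(mulr_natl (wright_op _ _) 2) -(rmorph_nat (@hz_const R)) mulrA -rmorphM /=.
  by rewrite mulVf// rmorph1 mul1r.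
have [G Gspan GW] := wright_op_solve h1.
have WG : W k.+2 = G.
  apply/eqP; rewrite -subr_eq0; apply/eqP/(@wright_op_inj k).
  have -> : W k.+2 - G = W k.+2 + hz_const (-1) * G by rewrite rmorphN rmorph1 mulN1r.
  by rewrite wright_opD wright_op_scale GW rmorphN rmorph1 mulN1r subrr.
have bc : b k.+1 / (k.+1 + k.+1.*2)%:R = c k.+1.
  rewrite /airy_b /= mulr0n mul0r addr0 (_ : (k.+1 + k.+1.*2)%N = (3 * k.+1)%N); last by lia.
  by rewrite natrM mulrAC divff ?mul1r// mulf_neq0.
rewrite -WG bc in Gspan; split=> //.
have := tree_span_euler Gspan.
suff -> : (k.+1 + k.+1.*2)%:R * c k.+1 = b k.+1 by [].
by rewrite -bc mulrC mulfVK.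
Qed.

Lemma tree_spanE lo d l F n : tree_span lo d l F ->
  exists q : {poly R}, q`_d = l /\ F n = \sum_(i < d.+1) q`_i * tau R (lo + i) n.
Proof.
move=> [q [sq lq ->]]; exists q; split=> //.
rewrite (ev_sum sq) mulr_sumr hz_sum; apply: eq_bigr => i _.
by rewrite mulrCA -exprD hz_constM.
Qed.

Lemma cvg_sum_ord (n : nat) (u : nat -> nat -> R) (l : nat -> R) :
  (forall i, (i < n)%N -> u i m @[m --> \oo] --> l i) ->
  \sum_(i < n) u i m @[m --> \oo] --> \sum_(i < n) l i.
Proof.
elim: n => [|n IHn] ul.
  by rewrite big_ord0; under eq_fun do rewrite big_ord0; exact: cvg_cst.
rewrite big_ord_recr /=; under eq_fun do rewrite big_ord_recr /=.
by apply: cvgD; [apply: IHn => i /ltnW; exact: ul|exact: ul].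
Qed.

(** Each power of $z$ gains a factor $\sqrt n$ over the one below, so only the top power
    survives. *)
Lemma tree_span_cvg lo d l F : tree_span lo.+1 d l F ->
  F n.+1 / (n.+1%:R ^+ n.+1 * Num.sqrt n.+1%:R ^+ (lo + d)) @[n --> \oo]
    --> l * tau_limit R (lo + d).
Proof.
move=> [q [sq lq ->]].
have E n : (z ^+ lo.+1 * ev q) n.+1 / (n.+1%:R ^+ n.+1 * Num.sqrt n.+1%:R ^+ (lo + d)) =
    \sum_(i < d) q`_i * (tau_scaled R (lo + i) n.+1 * inv_sqrt R n ^+ (d - i))
    + l * tau_scaled R (lo + d) n.+1.
  rewrite (ev_sum sq) mulr_sumr hz_sum mulr_suml big_ord_recr /=; congr (_ + _).
    apply: eq_bigr => i _; rewrite mulrCA -exprD hz_constM -mulrA; congr (_ * _).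
    rewrite /tau_scaled /inv_sqrt exprVn -mulrA -invfM -mulrA -exprD; congr (_ / (_ * _ ^+ _)).
    by have := ltn_ord i; lia.
  by rewrite mulrCA -exprD hz_constM -mulrA lq.
under eq_fun do rewrite E.
rewrite -[l * _]add0r; apply: cvgD; last first.
  by apply: cvgMl_tmp; exact: tau_scaled_cvg.
have e0 : \sum_(i < d) q`_i * (tau_limit R (lo + i) * 0 ^+ (d - i)) = 0 :> R.
  rewrite big1// => i _; rewrite expr0n subn_eq0 leqNgt ltn_ord /=.
  by rewrite !mulr0.
suff : \sum_(i < d) q`_i * (tau_scaled R (lo + i) n.+1 * inv_sqrt R n ^+ (d - i)) @[n --> \oo]
    --> \sum_(i < d) q`_i * (tau_limit R (lo + i) * 0 ^+ (d - i)) by rewrite e0.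
apply: (@cvg_sum_ord d (fun i n => q`_i * (tau_scaled R (lo + i) n.+1 * inv_sqrt R n ^+ (d - i)))
  (fun i => q`_i * (tau_limit R (lo + i) * 0 ^+ (d - i)))) => i id.
apply: cvgMl_tmp; apply: cvgM; first exact: tau_scaled_cvg.
exact: (cvg_comp _ _ (@inv_sqrt_cvg0 R) (@exprn_continuous R (d - i) 0)).
Qed.

Definition excess_scaled k n : R :=
  W k n * n%:R ^+ 2 / (n%:R ^+ n * Num.sqrt n%:R ^+ (3 * k)).

(** Three regimes: $k=0$ is exact, $k=1$ uses $DW_1$, and for $k\ge2$ the top power is $z^{3(k-1)}$,
    whose [tau_limit] contains $\Gamma(3(k-1)/2)$. *)
Lemma excess_scaled_cvg k :
  excess_scaled k n.+1 @[n --> \oo] --> airy_rho R (k%:Z - 1).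
Proof.
have nn n : n.+1%:R ^+ n.+1 != 0 :> R by rewrite expf_neq0.
have s0 n : Num.sqrt n.+1%:R != 0 :> R by rewrite gt_eqF// sqrtr_gt0.
have qq n : Num.sqrt n.+1%:R ^+ 2 = n.+1%:R :> R by rewrite sqr_sqrtr.
case: k => [|[|k]].
- rewrite /= (_ : (fun n => _) = cst 1); first exact: cvg_cst.
  by apply/funext => n; rewrite /excess_scaled excess0E// muln0 expr0 mulr1 divff.
- have -> : airy_rho R (1%:Z - 1) = 2^-1 * tau_limit R 1.
    rewrite subrr /= /tau_limit /= expr1 (_ : 2 * 2^-1 = 1) ?mulfV// mulr1.
    rewrite sqrtrM//; have qq2 : Num.sqrt 2 ^+ 2 = 2 :> R by rewrite sqr_sqrtr.
    have s2 : Num.sqrt 2 != 0 :> R by rewrite gt_eqF// sqrtr_gt0.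
    apply: (mulfI s2); rewrite mulrA mulrA -expr2 qq2; field.
    by rewrite s2.
  have := @tree_span_cvg 0 1 (b 0) _ (tree_span_excess 0).1.
  have -> : b 0 = 2^-1 by rewrite /airy_b mulr0 mul0r add0r mul1r.
  apply: cvg_trans; apply: near_eq_cvg; apply: nearW => n /=.
  rewrite /excess_scaled hz_eulerE -[_ *+ n.+1]mulr_natr muln1 add0n expr1.
  have -> : n.+1%:R ^+ 2 = n.+1%:R * Num.sqrt n.+1%:R ^+ 2 :> R by rewrite qq expr2.
  move: (Num.sqrt n.+1%:R) (n.+1%:R ^+ n.+1) (s0 n) (nn n) => r m r0 m0.
  by field; rewrite r0 m0.
have -> : airy_rho R (k.+2%:Z - 1) = c k.+1 * tau_limit R (k + k.+1.*2).
  have -> : (k.+2%:Z - 1) = Posz k.+1 by rewrite -addn1 PoszD addrK.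
  have kE : (k + k.+1.*2)%N = (3 * k).+2 by lia.
  rewrite /= mulrC /tau_limit kE -Gamma_half; congr (_ * (_ / (_ * _))).
    rewrite -powR_mulrn ?sqrtr_ge0// -powR12_sqrt// -powRrM; congr (_ `^ _).
    by rewrite -!natr1 natrM; field.
  by congr Gamma; rewrite -!natr1 natrM; field.
have := tree_span_cvg ((tree_span_excess k.+1).2 isT).
apply: cvg_trans; apply: near_eq_cvg; apply: nearW => n.
rewrite /excess_scaled.
have -> : n.+1%:R ^+ 2 = Num.sqrt n.+1%:R ^+ 4 :> R by rewrite -{1}qq -exprM.
have -> : (3 * k.+2)%N = (4 + (k + k.+1.*2))%N by lia.
rewrite (exprD _ 4); move: (Num.sqrt n.+1%:R) (n.+1%:R ^+ n.+1) (s0 n) (nn n) => r m r0 m0.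
have := expf_neq0 (k + k.+1.*2) r0; move: (r ^+ (k + k.+1.*2)) => p p0.
by move: (W _ _) => w; field; rewrite r0 m0 p0.
Qed.

End ExcessAsymptotics.

(** * Moments of the convolutions *)

Section Moments.
Variable R : realType.
Local Open Scope classical_set_scope.
Local Open Scope ring_scope.
Local Notation mR := (measurableTypeR R).
Local Notation H := (hurwitz R).
Local Notation neg := (`]-oo, 0%R[%classic : set mR).

(** Absolute values keep the integrands non-negative, so that Tonelli applies; the first clause
    makes them harmless. *)
Definition has_moments (mu : {measure set mR -> \bar R}) (f : H) : Prop :=
  mu neg = 0%E /\
  forall k, (\int[mu]_x (`|x| ^+ k)%:E = (f k)%:E)%E.

Lemma measurable_normX k : measurable_fun [set: mR] (fun x : mR => (`|x| ^+ k)%:E).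
Proof.
apply/measurable_EFinP; apply: measurable_funX; apply: measurableT_comp; [exact: normr_measurable|exact: measurable_id].
Qed.

Lemma integral_normXZ (mu : {measure set mR -> \bar R}) (a : R) k : 0 <= a ->
  (\int[mu]_x (a%:E * (`|x| ^+ k)%:E) = a%:E * \int[mu]_x (`|x| ^+ k)%:E)%E.
Proof.
move=> a0; apply: ge0_integralZl_EFin => //; exact: measurable_normX.
Qed.

(* Only the values on [0, +oo[ matter to such a measure. *)
Lemma eq_integral_ge0 (mu : {measure set mR -> \bar R}) (f g : mR -> \bar R) :
  mu neg = 0%E ->
  measurable_fun [set: mR] f -> measurable_fun [set: mR] g ->
  (forall x, 0 <= f x)%E -> (forall x, 0 <= g x)%E ->
  (forall x : R, 0 <= x -> f x = g x) ->
  (\int[mu]_x f x = \int[mu]_x g x)%E.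
Proof.
move=> mu0 mf mg f0 g0 fg.
have mN : measurable neg by exact: measurable_itv.
rewrite (ge0_negligible_integral mN)//.
rewrite [RHS](ge0_negligible_integral mN)//.
apply: eq_integral => x; rewrite inE /= => -[_ /=].
by rewrite in_itv/= => /negP; rewrite -leNgt; exact: fg.
Qed.

Variables (mu nu : {finite_measure set mR -> \bar R}).

Let measurable_comp_add (f : mR -> \bar R) : measurable_fun [set: mR] f ->
  measurable_fun [set: mR * mR] (f \o @addR_pair R).
Proof.
by move=> mf; exact: measurableT_comp.
Qed.

Lemma measurable_integral_shift (f : mR -> \bar R) :
  measurable_fun [set: mR] f -> (forall x, 0 <= f x)%E ->
  measurable_fun [set: mR] (fun x : mR => \int[nu]_y f (x + y)%R)%E.
Proof.
move=> mf f0.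
have := @measurable_fun_fubini_tonelli_F _ _ mR mR R nu (f \o @addR_pair R).
by apply; [exact: measurable_comp_add|move=> z; exact: f0].
Qed.

Lemma integral_convolution (f : mR -> \bar R) :
  measurable_fun [set: mR] f -> (forall x, 0 <= f x)%E ->
  (\int[convolution mu nu]_x f x = \int[mu]_x \int[nu]_y f (x + y)%R)%E.
Proof.
move=> mf f0.
transitivity (\int[(mu \x nu)%E]_z (f \o @addR_pair R) z)%E.
  by rewrite ge0_integral_pushforward.
apply: (@fubini_tonelli1 _ _ _ _ _ mu nu (f \o @addR_pair R)).
  exact: measurable_comp_add.
by move=> z; exact: f0.
Qed.

Lemma measurable_shift (f : mR -> \bar R) (x : mR) : measurable_fun [set: mR] f ->
  measurable_fun [set: mR] (fun y : mR => f (x + y)%R).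
Proof.
move=> mf; apply: (measurableT_comp mf).
by apply: measurable_funD; [exact: measurable_cst|exact: measurable_id].
Qed.

(** The Hurwitz product is the binomial formula for moments of a sum; $|x+y|=x+y$ almost everywhere
    by the support condition. *)
Lemma has_moments_convolution (f g : H) :
  (forall k, 0 <= f k) -> (forall k, 0 <= g k) ->
  has_moments mu f -> has_moments nu g -> has_moments (convolution mu nu) (f * g).
Proof.
move=> f0 g0 [mu0 muf] [nu0 nug]; split.
  have mN : measurable neg by exact: measurable_itv.
  have m1N : measurable_fun [set: mR] (fun x : mR => (\1_neg x)%:E : \bar R).
    by apply/measurable_EFinP; exact: measurable_indic.
  transitivity (\int[convolution mu nu]_x (\1_neg x)%:E)%E.
    by rewrite integral_indic// setIT.
  rewrite integral_convolution//.
  rewrite (@eq_integral_ge0 _ _ (cst 0%E))//.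
  - by rewrite integral0.
  - exact: measurable_integral_shift m1N _.
  - by move=> x; apply: integral_ge0.
  - move=> x x0; rewrite (@eq_integral_ge0 _ _ (cst 0%E))//.
    + by rewrite integral0.
    + exact: measurable_shift m1N.
    + move=> y y0; rewrite indicE memNset//= in_itv/=.
      by apply/negP; rewrite -leNgt addr_ge0.
move=> k; rewrite integral_convolution//; last exact: measurable_normX.
rewrite (@eq_integral_ge0 _ _ (fun x => (\sum_(i < k.+1) (g (k - i)%N *+ 'C(k, i))%:E * (`|x| ^+ i)%:E))%E)//.
- rewrite ge0_integral_sum//; last 2 first.
  + by move=> i; exact: (measurable_funeM _ (measurable_normX _)).
  + by move=> i x _; rewrite mule_ge0// lee_fin ?mulrn_wge0.
  rewrite hzM -sumEFin; apply: eq_bigr => i _.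
  rewrite integral_normXZ ?mulrn_wge0//.
  by rewrite muf -EFinM mulrnAl mulrC.
- exact: (measurable_integral_shift (measurable_normX k)).
- by apply: emeasurable_sum => i _; exact: (measurable_funeM _ (measurable_normX _)).
- by move=> x; apply: integral_ge0 => y _; rewrite lee_fin exprn_ge0.
- by move=> x; apply: sume_ge0 => i _; rewrite mule_ge0// lee_fin ?mulrn_wge0// exprn_ge0.
move=> x x0.
rewrite (@eq_integral_ge0 _ _ (fun y => (\sum_(i < k.+1) (`|x| ^+ i *+ 'C(k, i))%:E * (`|y| ^+ (k - i))%:E))%E)//.
- rewrite ge0_integral_sum//; last first.
    by move=> i; exact: (measurable_funeM _ (measurable_normX _)).
  apply: eq_bigr => i _; rewrite integral_normXZ ?mulrn_wge0 ?exprn_ge0//.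
  by rewrite nug -!EFinM mulrnAl mulrnAl mulrC.
- exact: (measurable_shift x (measurable_normX k)).
- by apply: emeasurable_sum => i _; exact: (measurable_funeM _ (measurable_normX _)).
- by move=> y; apply: sume_ge0 => i _; rewrite mule_ge0// lee_fin ?mulrn_wge0 ?exprn_ge0.
move=> y y0; rewrite ger0_norm ?addr_ge0// addrC exprDn -sumEFin; apply: eq_bigr => i _.
by rewrite -EFinM !ger0_norm// mulrnAl mulrC.
Qed.

End Moments.

(** * The moments and the mass of $\tilde\omega_n$ *)

Section OmegaMoments.
Variable R : realType.
Local Open Scope classical_set_scope.
Local Open Scope ring_scope.
Local Notation mR := (measurableTypeR R).
Local Notation H := (hurwitz R).
Local Notation neg := (`]-oo, 0%R[%classic : set mR).

Lemma hz_mul_ge0 (f g : H) : (forall k, 0 <= f k) -> (forall k, 0 <= g k) ->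
  forall k, 0 <= (f * g) k.
Proof.
by move=> f0 g0 k; rewrite hzM sumr_ge0// => i _; rewrite mulrn_wge0// mulr_ge0.
Qed.

Lemma unit_egfX_ge0 m k : 0 <= (unit_egf R ^+ m) k.
Proof.
elim: m k => [|m IHm] k; first by rewrite expr0 hz1.
by rewrite exprS; apply: hz_mul_ge0 => // i; rewrite /unit_egf invr_ge0.
Qed.

Lemma has_moments_dirac0 : has_moments (dirac (0 : mR) : {measure set mR -> \bar R}) 1.
Proof.
split; first by rewrite /= diracE memNset//= in_itv/= ltxx.
move=> k; rewrite integral_dirac//; last exact: measurable_normX.
by rewrite diracT mul1e normr0 expr0n hz1.
Qed.

Lemma integral_normX01 k :
  (\int[lebesgue_measure]_(x in `[0%R, 1%R]) ((`|x| ^+ k)%:E : \bar R) = (k.+1%:R^-1)%:E)%E.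
Proof.
pose F (x : R) := k.+1%:R^-1 * x ^+ k.+1.
transitivity (\int[lebesgue_measure]_(x in `[0%R, 1%R]) ((x ^+ k)%:E : \bar R))%E.
  by apply: eq_integral => x; rewrite inE/= in_itv/= => /andP[x0 _]; rewrite ger0_norm.
have dF (x : R) : is_derive x 1 F (x ^+ k).
  have HX : is_derive x 1 (fun v : R => v ^+ k.+1) (k.+1%:R * x ^+ k).
    by split; [exact: exprn_derivable|rewrite exp_derive /GRing.scale /= mulr1].
  rewrite (_ : F = k.+1%:R^-1 *: (fun v : R => v ^+ k.+1))//.
  by apply: is_derive_eq; rewrite /GRing.scale /= mulKf.
have cF : continuous F.
  by move=> x; apply: cvgMl_tmp; exact: exprn_continuous.
rewrite (@continuous_FTC2 _ _ F)//.
- by rewrite /F expr1n mulr1 expr0n mulr0 sube0.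
- by apply: continuous_subspaceT; exact: exprn_continuous.
- split; first by move=> x _; have [] := dF x.
    by apply: cvg_at_right_filter; exact: cF.
  by apply: cvg_at_left_filter; exact: cF.
- by move=> x _; have [_ <-] := dF x; rewrite derive1E.
Qed.

Lemma has_moments_unit : has_moments (unit_interval_measure R) (unit_egf R).
Proof.
pose I01 := (`[0%R, 1%R]%classic : set mR).
have m01 : measurable I01 by exact: measurable_itv.
split.
  rewrite /= /mfrestr /mrestr.
  suff -> : neg `&` `[0%R, 1%R] = set0 by rewrite measure0.
  rewrite -subset0 => x [/=]; rewrite !in_itv/= => x0 /andP[x1 _].
  by rewrite ltNge x1 in x0.
move=> k; rewrite (@ge0_negligible_integral _ mR R _ _ (~` I01))//.
- rewrite setTD setCK (@eq_measure_integral _ _ _ _ (@lebesgue_measure R)).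
    exact: integral_normX01.
  by move=> A mA A01; rewrite /= /mfrestr /mrestr setIidl.
- exact: measurableC.
- exact: measurable_normX.
- by rewrite /= /mfrestr /mrestr setICl measure0.
Qed.

Lemma has_moments_power m :
  has_moments (convolution_power (unit_interval_measure R) m) (unit_egf R ^+ m).
Proof.
elim: m => [|m IHm]; first by rewrite expr0; exact: has_moments_dirac0.
rewrite exprS; apply: has_moments_convolution => //.
- by move=> k; rewrite /unit_egf invr_ge0.
- exact: unit_egfX_ge0.
- exact: has_moments_unit.
Qed.

Lemma eval_expsE (p : {poly int}) k :
  eval_exps R p k = \sum_(i < size p) (p`_i)%:~R * i%:R ^+ k.
Proof.
rewrite /eval_exps (@horner_coef_wide _ (size p)); last by rewrite size_poly.
rewrite hz_sum; apply: eq_bigr => i _.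
rewrite coef_map /= -(rmorph_int (@hz_const R)) hz_constM /exps -hz_expMn.
by rewrite /hz_exp.
Qed.

Lemma has_moments_discrete (p : {poly int}) : (forall i, 0 <= p`_i) ->
  has_moments (discrete_measure (map_poly intr p : {poly R})) (eval_exps R p).
Proof.
move=> p0; split.
  rewrite /= /discrete_measure /msum big1// => i _.
  have d0 : dirac (i%:R : mR) neg = 0%E :> \bar R.
    by rewrite diracE memNset//= in_itv/=; apply/negP; rewrite -leNgt.
  exact: etrans (congr1 (fun x => _ * x)%E d0) (mule0 _).
move=> k; rewrite (@integral_discrete_measure _ _ (fun x => `|x| ^+ k)).
- rewrite size_map_inj_poly ?rmorph0//; last exact: intr_inj.
  rewrite eval_expsE; congr (_%:E); apply: eq_bigr => i _.
  by rewrite coef_map /= ger0_norm// mulrC.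
- by move=> i; rewrite coef_map /= ler0z.
- by apply/measurable_EFinP; exact: measurable_normX.
Qed.

Lemma eval_exps_ge0 (p : {poly int}) : (forall i, 0 <= p`_i) ->
  forall k, 0 <= eval_exps R p k.
Proof.
move=> p0 k; rewrite eval_expsE sumr_ge0// => i _.
by rewrite mulr_ge0 ?ler0z ?exprn_ge0.
Qed.

Lemma has_moments_omega m : has_moments (tilde_omega R m.+1) (omega_egf R m).
Proof.
apply: has_moments_convolution.
- exact: unit_egfX_ge0.
- exact/eval_exps_ge0/ext_activity_ge0.
- exact: has_moments_power.
- exact/has_moments_discrete/ext_activity_ge0.
Qed.

Lemma has_moments_mass (mu : {measure set mR -> \bar R}) f :
  has_moments mu f -> mu setT = (f 0%N)%:E.
Proof.
move=> [_ /(_ 0%N) <-].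
by rewrite (eq_integral (cst 1%E))// integral_cst// mul1e.
Qed.

Lemma omega_egf_mass m :
  omega_egf R m 0%N = ((ext_activity_poly (complete_graph m.+1)).[1])%:~R.
Proof.
rewrite /omega_egf hzM0 eval_expsE horner_coef rmorph_sum /=.
have -> : (unit_egf R ^+ m) 0%N = 1.
  elim: m => [|m IHm]; first by rewrite expr0 hz1.
  by rewrite exprS hzM0 IHm mulr1 /unit_egf invr1.
rewrite mul1r; apply: eq_bigr => i _.
by rewrite expr0 expr1n !mulr1.
Qed.

Lemma natr_expz_sub2 n : n.+1%:R ^ (n.+1%:Z - 2) = n.+1%:R ^+ n.+1 / n.+1%:R ^+ 2 :> R.
Proof. by rewrite expfzDr// -exprnP -exprnN. Qed.

(** Cayley's formula, read off the coefficients of $W_0$ ([excess0E]). *)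
Lemma omega_egf_cayley m : omega_egf R m 0%N = m.+1%:R ^ (m.+1%:Z - 2).
Proof.
have := excess0E R (ltn0Sn m); rewrite /excess /twisted_egf hzM0 fact0 divr1.
have -> : (half_exps R ^+ m.+1) 0%N = 1.
  by rewrite /half_exps -hz_expMn /hz_exp expr0.
rewrite mul1r natr_expz_sub2 => <-.
by rewrite mulfK// expf_neq0.
Qed.

End OmegaMoments.

(** * The rescaled measures *)

Section Rescaled.
Variable R : realType.
Local Open Scope classical_set_scope.
Local Open Scope ring_scope.
Local Notation mR := (measurableTypeR R).
Local Notation H := (hurwitz R).
Local Notation neg := (`]-oo, 0%R[%classic : set mR).

Definition rescale n (x : mR) : mR := x / n%:R `^ (3 / 2).

Let measurable_rescale n : measurable_fun [set: mR] (rescale n).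
Proof. by apply: measurable_funM => //; exact: measurable_cst. Qed.

Let weight_ge0 n : 0 <= (n.+1%:R : R) ^ (- (n.+1%:Z - 2)).
Proof. by rewrite exprz_ge0. Qed.

Definition pushed_omega n : {measure set mR -> \bar R} :=
  measure_function_pushforward__canonical__measure_function_Measure
    (tilde_omega R n.+1) (measurable_rescale n.+1).

Definition scaled_omega n : {measure set mR -> \bar R} :=
  mscale (NngNum (weight_ge0 n)) (pushed_omega n).

Lemma scaled_omegaE n A : scaled_omega n A = rescaled_omega R n.+1 A.
Proof. by []. Qed.

Lemma powR_3half n : (n%:R : R) `^ (3 / 2) = Num.sqrt n%:R ^+ 3.
Proof.
by rewrite -powR_mulrn ?sqrtr_ge0// -powR12_sqrt// -powRrM; congr (_ `^ _); field.
Qed.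

Definition scaled_moments n : H := fun k =>
  n.+1%:R ^+ 2 / n.+1%:R ^+ n.+1 / Num.sqrt n.+1%:R ^+ (3 * k) * omega_egf R n k.

Lemma has_moments_scaled n : has_moments (scaled_omega n) (scaled_moments n).
Proof.
have [om0 omk] := has_moments_omega R n.
have s0 : 0 < Num.sqrt n.+1%:R ^+ 3 :> R by rewrite exprn_gt0// sqrtr_gt0.
split.
  rewrite scaled_omegaE /rescaled_omega /pushforward.
  suff -> : (fun x : mR => x / n.+1%:R `^ (3 / 2) : mR) @^-1` neg = neg.
    exact: etrans (congr1 (fun x => _ * x)%E om0) (mule0 _).
  apply/seteqP; split => x /=; rewrite !in_itv/= powR_3half.
    by rewrite pmulr_llt0 ?invr_gt0.
  by rewrite pmulr_llt0 ?invr_gt0.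
move=> k; rewrite ge0_integral_mscale//; last exact: measurable_normX.
rewrite ge0_integral_pushforward//; last exact: measurable_normX.
rewrite preimage_setT.
transitivity ((n.+1%:R ^ (- (n.+1%:Z - 2)))%:E *
   \int[tilde_omega R n.+1]_x ((Num.sqrt n.+1%:R ^+ (3 * k))^-1%:E * (`|x| ^+ k)%:E))%E.
  congr (_ * _)%E; apply: eq_integral => x _ /=.
  rewrite /rescale powR_3half -EFinM normrM normfV exprMn exprVn mulrC.
  by rewrite (ger0_norm (ltW s0)) exprM.
rewrite integral_normXZ ?invr_ge0 ?exprn_ge0 ?sqrtr_ge0// omk -!EFinM mulrA.
by rewrite /scaled_moments -invr_expz natr_expz_sub2 invf_div.
Qed.

(** Multiplying by $e^{-ns/2}$ undoes the translation of [twisted_egf]. On the scale $n^{3/2}$ a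
    translation of order $n$ costs $n^{-1/2}$ per degree, so only [i = 0] matters in the limit. *)
Lemma scaled_moments_expand n k : scaled_moments n k =
  \sum_(i < k.+1) 'C(k, i)%:R * (k - i)`!%:R * (- 2^-1) ^+ i
    * (excess_scaled R (k - i) n.+1 * inv_sqrt R n ^+ i).
Proof.
have s0 : 0 < Num.sqrt n.+1%:R :> R by rewrite sqrtr_gt0.
have qq : Num.sqrt n.+1%:R ^+ 2 = n.+1%:R :> R by rewrite sqr_sqrtr.
rewrite /scaled_moments.
have -> : omega_egf R n = hz_exp (- (n.+1%:R / 2)) * twisted_egf R n.
  rewrite /twisted_egf mulrA /half_exps -hz_expMn -hz_expD.
  by rewrite -[2^-1 *+ _]mulr_natl addNr hz_exp0 mul1r.
rewrite hzM mulr_sumr; apply: eq_bigr => i _.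
have ik : (i <= k)%N by rewrite -ltnS.
rewrite /excess_scaled /excess /inv_sqrt /hz_exp.
have -> : (3 * k = 3 * (k - i) + i + i.*2)%N by lia.
rewrite !exprD -muln2 mulnC exprM qq.
have nn : n.+1%:R ^+ n.+1 != 0 :> R by rewrite expf_neq0.
have f0 : (k - i)`!%:R != 0 :> R by rewrite pnatr_eq0 -lt0n fact_gt0.
rewrite -mulNr exprMn exprNn [(- 2^-1) ^+ i]exprNn exprVn -[X in _ * X = _]mulr_natr.
move: (twisted_egf R n (k - i)%N) => t.
have := lt0r_neq0 s0; move: (Num.sqrt n.+1%:R) => r r0.
have n0 : n.+1%:R != 0 :> R by [].
move: (n.+1%:R ^+ n.+1) nn n0 => m m0; move: (n.+1%:R : R) => x x0.
have xi := expf_neq0 i x0; have ri := expf_neq0 i r0.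
have rk := expf_neq0 (k - i) r0; have t2 : 2 ^+ i != 0 :> R by rewrite expf_neq0.
rewrite exprVn.
by field; rewrite m0 rk ri f0 xi t2.
Qed.

Lemma scaled_moments_cvg k :
  scaled_moments n k @[n --> \oo] --> k`!%:R * airy_rho R (k%:Z - 1).
Proof.
pose l i : R := 'C(k, i)%:R * (k - i)`!%:R * (- 2^-1) ^+ i
    * (airy_rho R ((k - i)%N%:Z - 1) * 0 ^+ i).
have -> : k`!%:R * airy_rho R (k%:Z - 1) = \sum_(i < k.+1) l i.
  rewrite big_ord_recl big1 ?addr0 => [|i _].
    by rewrite /l bin0 subn0 expr0 mul1r !mulr1.
  by rewrite /l lift0 expr0n mulr0 mulr0.
under eq_fun do rewrite scaled_moments_expand.
apply: (@cvg_sum_ord R k.+1 (fun i n => 'C(k, i)%:R * (k - i)`!%:R * (- 2^-1) ^+ i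
    * (excess_scaled R (k - i) n.+1 * inv_sqrt R n ^+ i)) l) => i _.
apply: cvgMl_tmp; apply: cvgM; first exact: excess_scaled_cvg.
exact: (cvg_comp _ _ (@inv_sqrt_cvg0 R) (@exprn_continuous R i 0)).
Qed.

End Rescaled.

(** * One-sided approximation by polynomials *)

Section PolySandwich.
Variable R : realType.
Local Open Scope classical_set_scope.
Local Open Scope ring_scope.
Local Notation H := (hurwitz R).

Lemma nneg_of_deriv (f df : R -> R) : (forall y : R, is_derive y 1 f (df y)) ->
  f 0 = 0 -> (forall y, 0 <= y -> 0 <= df y) -> forall y, 0 <= y -> 0 <= f y.
Proof.
move=> fd f0 df0 y y0.
have cf : {within `[0, y], continuous f}.
  apply: continuous_subspaceT => x; have [h _] := fd x.
  exact/differentiable_continuous/derivable1_diffP.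
have [c cy] := MVT_segment y0 (fun x _ => fd x) cf.
rewrite f0 !subr0 => ->; rewrite mulr_ge0// df0//.
by move: cy; rewrite in_itv/= => /andP[].
Qed.

(* The beginning of the Taylor series of e^(-y). *)
Definition exp_poly L : {poly R} := \poly_(l < L) ((-1) ^+ l / l`!%:R).

Lemma exp_polyE L (y : R) : (exp_poly L).[y] = \sum_(l < L) (- y) ^+ l / l`!%:R.
Proof.
rewrite horner_poly; apply: eq_bigr => l _.
by rewrite (exprNn y) mulrAC.
Qed.

Lemma deriv_exp_poly L : (exp_poly L.+1)^`() = - exp_poly L.
Proof.
apply/polyP => i; rewrite coef_deriv coefN !coef_poly ltnS.
case: ltnP => iL; last by rewrite mul0rn oppr0.
rewrite factS natrM -mulr_natr exprS.
have f0 : i`!%:R != 0 :> R by rewrite pnatr_eq0 -lt0n fact_gt0.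
by field; rewrite f0 nat1r pnatr_eq0.
Qed.

(** Induction by monotonicity: the signed remainder at $L+1$ vanishes at 0 and its derivative is the
    signed remainder at $L$. *)
Lemma exp_poly_remainder L (y : R) : 0 <= y ->
  0 <= (-1) ^+ L * (expR (- y) - (exp_poly L).[y]) <= y ^+ L / L`!%:R.
Proof.
have der k (t : R) : is_derive t 1 (fun u : R => (-1) ^+ k.+1 * (expR (- u) - (exp_poly k.+1).[u]))
    ((-1) ^+ k * (expR (- t) - (exp_poly k).[t])).
  have d1 : is_derive t 1 (fun u : R => expR (- u)) (- expR (- t)).
    have := @is_derive1_comp R expR -%R t _ _ (is_derive_expR (- t)) (is_deriveNid t 1).
    by rewrite mulrN1.
  have d2 := is_derive_poly (exp_poly k.+1) t.
  have d3 : is_derive t 1 ((-1) ^+ k.+1 \*: ((fun u : R => expR (- u)) - horner (exp_poly k.+1)))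
     ((-1) ^+ k * (expR (- t) - (exp_poly k).[t])).
    apply: is_derive_eq; rewrite deriv_exp_poly hornerN /GRing.scale/= exprS; ring.
  exact: d3.
elim: L y => [|L IHL] y y0.
  by rewrite !expr0 mul1r fact0 divr1 /exp_poly poly_def big_ord0 horner0 subr0 expR_ge0 expR_le1 oppr_le0.
apply/andP; split.
  apply: (nneg_of_deriv (der L)) => //.
    rewrite oppr0 expR0 exp_polyE oppr0 big_ord_recl big1 ?addr0 ?expr0 ?fact0 ?divr1 ?subrr ?mulr0//.
    by move=> i _; rewrite lift0 expr0n mul0r.
  by move=> t t0; case/andP: (IHL t t0).
rewrite -subr_ge0.
have derX (t : R) : is_derive t 1 (fun u : R => u ^+ L.+1 / L.+1`!%:R - (-1) ^+ L.+1 * (expR (- u) - (exp_poly L.+1).[u]))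
    (t ^+ L / L`!%:R - (-1) ^+ L * (expR (- t) - (exp_poly L).[t])).
  have d1 := der L t.
  have d2 : is_derive t 1 (((L.+1)`!%:R^-1 : R) \*: (fun u : R => u ^+ L.+1)
     - (fun u : R => (-1) ^+ L.+1 * (expR (- u) - (exp_poly L.+1).[u])))
    (t ^+ L / L`!%:R - (-1) ^+ L * (expR (- t) - (exp_poly L).[t])).
    have d3 : is_derive t 1 (fun u : R => u ^+ L.+1) (L.+1%:R * t ^+ L).
      have := is_derive_poly ('X^(L.+1) : {poly R}) t.
      rewrite derivXn/= hornerMn hornerXn mulr_natl; congr (is_derive _ _ _ _).
      by apply/funext => u; rewrite hornerXn.
    apply: is_derive_eq; rewrite /GRing.scale/= factS natrM invfM; congr (_ - _).
    have f0 : L`!%:R != 0 :> R by rewrite pnatr_eq0 -lt0n fact_gt0.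
    by field; rewrite f0 nat1r pnatr_eq0.
  have -> : (fun u : R => u ^+ L.+1 / L.+1`!%:R - (-1) ^+ L.+1 * (expR (- u) - (exp_poly L.+1).[u]))
    = ((L.+1)`!%:R^-1 : R) \*: (fun u : R => u ^+ L.+1)
     - (fun u : R => (-1) ^+ L.+1 * (expR (- u) - (exp_poly L.+1).[u])).
    by apply/funext => u; rewrite [RHS]/GRing.add/= /GRing.scale/= mulrC.
  exact: d2.
apply: (nneg_of_deriv derX) => //.
  rewrite expr0n mul0r sub0r oppr0 expR0 exp_polyE oppr0 big_ord_recl big1 ?addr0 ?expr0 ?fact0 ?divr1 ?subrr ?mulr0 ?oppr0//.
  by move=> i _; rewrite lift0 expr0n mul0r.
by move=> t t0; rewrite subr_ge0; case/andP: (IHL t t0).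
Qed.

Lemma exp_poly_norm L (y : R) : 0 <= y ->
  `|expR (- y) - (exp_poly L).[y]| <= y ^+ L / L`!%:R.
Proof.
move=> y0; have /andP[h1 h2] := exp_poly_remainder L y0.
suff -> : `|expR (- y) - (exp_poly L).[y]| = `|(-1) ^+ L * (expR (- y) - (exp_poly L).[y])|.
  by rewrite ger0_norm.
by rewrite normrM normrX normrN1 expr1n mul1r.
Qed.

(** The mean of [p] under any law on $[0,\infty[$ with moments [m], see [integral_norm_poly]. *)
Definition moment_poly (m : H) (p : {poly R}) : R := \sum_(l < size p) p`_l * m l.

Lemma moment_poly_widen m (p : {poly R}) D : (size p <= D)%N ->
  moment_poly m p = \sum_(l < D) p`_l * m l.
Proof.
move=> pD; rewrite /moment_poly (big_ord_widen D (fun l => p`_l * m l))// big_mkcond/=.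
apply: eq_bigr => l _; case: ltnP => // pl.
by rewrite nth_default// mul0r.
Qed.

Lemma moment_polyD m p q : moment_poly m (p + q) = moment_poly m p + moment_poly m q.
Proof.
have h := size_polyD p q.
rewrite (moment_poly_widen m h) (moment_poly_widen m (leq_maxl (size p) (size q))).
rewrite (moment_poly_widen m (leq_maxr (size p) (size q))) -big_split/=.
by apply: eq_bigr => l _; rewrite coefD mulrDl.
Qed.

Lemma moment_polyZ m a p : moment_poly m (a *: p) = a * moment_poly m p.
Proof.
rewrite (moment_poly_widen m (size_scale_leq a p)) mulr_sumr.
by apply: eq_bigr => l _; rewrite coefZ mulrA.
Qed.

Lemma moment_polyXn m n : moment_poly m 'X^n = m n.
Proof.
rewrite /moment_poly size_polyXn (bigD1 ord_max)//= coefXn eqxx mul1r big1 ?addr0//.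
move=> l /negbTE ln; rewrite coefXn; case: eqP => [e|_]; last by rewrite mul0r.
by move: ln; rewrite -val_eqE/= e eqxx.
Qed.

Lemma moment_polyC m a : moment_poly m a%:P = a * m 0%N.
Proof.
rewrite -[a%:P]mulr1 mul_polyC moment_polyZ; congr (_ * _); exact: (moment_polyXn m 0).
Qed.

Lemma moment_poly_cvg (M : nat -> H) (m : H) p :
  (forall k, M n k @[n --> \oo] --> m k) ->
  moment_poly (M n) p @[n --> \oo] --> moment_poly m p.
Proof.
move=> Mm; apply: (@cvg_sum_ord R (size p) (fun i n => p`_i * M n i) (fun i => p`_i * m i)).
by move=> i _; apply: cvgMl_tmp; exact: Mm.
Qed.

Lemma bernoulli_ge (u : R) n : 0 <= u <= 1 -> 1 - n%:R * u <= (1 - u) ^+ n.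
Proof.
move=> /andP[u0 u1]; elim: n => [|n IHn]; first by rewrite mul0r subr0.
have h : (1 - u) * (1 - n%:R * u) <= (1 - u) * (1 - u) ^+ n by rewrite ler_wpM2l// subr_ge0.
rewrite exprS; apply: le_trans h; rewrite -natr1.
have : 0 <= n%:R * u * u by rewrite !mulr_ge0.
lra.
Qed.

Lemma bernoulli_le (u : R) n : 0 <= u <= 1 -> (1 - u) ^+ n <= (1 + n%:R * u)^-1.
Proof.
move=> /andP[u0 u1].
have h0 : 0 < 1 + n%:R * u by rewrite ltr_pwDl// mulr_ge0.
apply: (@le_trans _ _ (expR (- u) ^+ n)).
  by apply: lerXn2r; rewrite ?nnegrE ?subr_ge0 ?expR_ge0// expR_ge1Dx.
rewrite -expRM_natl mulrN expRN lef_pV2 ?posrE ?expR_gt0//.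
exact: expR_ge1Dx.
Qed.

(* (1 - e^(-jx))^N with N about e^(jz) approximates the indicator function of
   ]z, +oo[ when j is large. *)
Lemma exp_step (x y e : R) : 0 <= x -> x < y -> 0 < e ->
  exists j N : nat,
    (forall t, 0 <= t <= x -> (1 - expR (- (j%:R * t))) ^+ N <= e) /\
    (forall t, y < t -> 1 - e <= (1 - expR (- (j%:R * t))) ^+ N).
Proof.
move=> x0 xy e0; pose d := (y - x) / 2; pose z := (x + y) / 2.
have d0 : 0 < d by rewrite divr_gt0// subr_gt0.
have [j jd] : exists j : nat, expR (- (j%:R * d)) <= e.
  exists (Num.truncn ((e^-1) / d)).+1; rewrite expRN -[leRHS]invrK lef_pV2 ?posrE ?invr_gt0 ?expR_gt0//.
  apply: le_trans (expR_ge1Dx _); apply: ler_wpDl => //.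
  rewrite -ler_pdivrMr//; apply: ltW; exact: truncnS_gt.
exists j, (Num.truncn (expR (j%:R * z))).
have /andP[N1 N2] := truncn_itv (expR_ge0 (j%:R * z)).
move: (Num.truncn _) N1 N2 => N N1 N2; rewrite -natr1 in N2.
have u01 (t : R) : 0 <= t -> 0 <= expR (- (j%:R * t)) <= 1.
  by move=> t0; rewrite expR_ge0 expR_le1 oppr_le0 mulr_ge0.
split=> t.
  move=> /andP[t0 tx]; apply: (le_trans (bernoulli_le N (u01 t t0))).
  have h0 : 0 < 1 + N%:R * expR (- (j%:R * t)) by rewrite ltr_pwDl// mulr_ge0// expR_ge0.
  apply: le_trans jd; rewrite [leRHS]expRN lef_pV2 ?posrE ?expR_gt0//.
  have h1 : expR (- (j%:R * x)) <= expR (- (j%:R * t)).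
    by rewrite ler_expR lerN2 ler_wpM2l.
  have h2 : N%:R * expR (- (j%:R * x)) <= N%:R * expR (- (j%:R * t)) by rewrite ler_wpM2l.
  have h3 : expR (j%:R * d) = expR (j%:R * z) * expR (- (j%:R * x)).
    by rewrite -expRD; congr expR; rewrite /d /z; field.
  have h4 : expR (j%:R * z) * expR (- (j%:R * x)) <= (N%:R + 1) * expR (- (j%:R * x)).
    by rewrite ler_wpM2r ?expR_ge0// ltW.
  have /andP[_ h5] := u01 _ x0.
  rewrite h3; apply: (le_trans h4); lra.
move=> yt; have t0 : 0 <= t by rewrite ltW// (le_lt_trans x0)// (lt_trans xy).
apply: (le_trans _ (bernoulli_ge N (u01 t t0))); rewrite lerD2l lerN2.
apply: le_trans jd.
have -> : expR (- (j%:R * d)) = expR (j%:R * z) * expR (- (j%:R * y)).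
  by rewrite -expRD; congr expR; rewrite /d /z; field.
apply: ler_pM => //; rewrite ?expR_ge0// ler_expR lerN2 ler_wpM2l//; exact: ltW.
Qed.

(** Expand binomially and replace each $e^{-ijt}$ by its Taylor polynomial; $2^N$ is the sum of the
    binomial coefficients. *)
Lemma poly_approx_exp_power j N L : exists p : {poly R}, forall t, 0 <= t ->
  `|(1 - expR (- (j%:R * t))) ^+ N - p.[t]| <= 2 ^+ N * ((N * j)%:R ^+ L / L`!%:R) * t ^+ L.
Proof.
exists (\sum_(i < N.+1) ((-1) ^+ i * 'C(N, i)%:R) *: (exp_poly L \Po ((i * j)%:R *: 'X))) => t t0.
rewrite exprBn horner_sum -sumrB.
apply: (le_trans (ler_norm_sum _ _ _)).
have -> : 2 ^+ N * ((N * j)%:R ^+ L / L`!%:R) * t ^+ L =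
    \sum_(i < N.+1) 'C(N, i)%:R * (((N * j)%:R * t) ^+ L / L`!%:R).
  rewrite -mulr_suml exprMn -natr_sum -(_ : 2%:R ^+ N = (\sum_(i < N.+1) 'C(N, i))%:R); last first.
    by rewrite -natrX -[2%N]/(1 + 1)%N expnDn; congr (_%:R); apply: eq_bigr => i _; rewrite !exp1n !muln1.
  by field; rewrite pnatr_eq0 -lt0n fact_gt0.
apply: ler_sum => i _; rewrite expr1n mulr1 -expRM_natl mulrN [i%:R * _]mulrA -natrM.
rewrite hornerZ horner_comp hornerZ hornerX -mulr_natr.
rewrite [_ * 'C(N, i)%:R]mulrAC -mulrBr normrM normrM normrX normrN1 expr1n mul1r normr_nat.
apply: ler_wpM2l => //; apply: (le_trans (exp_poly_norm L _)); first by rewrite mulr_ge0.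
rewrite ler_wpM2r ?invr_ge0//; apply: lerXn2r; rewrite ?nnegrE ?mulr_ge0//.
by rewrite ler_wpM2r// ler_nat leq_mul2r -ltnS ltn_ord orbT.
Qed.

(** The Taylor error is at most $C_Lt^L$, itself a polynomial, and its mean $C_Lm_L$ tends to 0 with
    $L$ by the growth hypothesis. *)
Lemma poly_sandwich (m : H) (x y e : R) :
  (forall h : nat, h%:R ^+ n * (m n / n`!%:R) @[n --> \oo] --> 0) -> m 0%N = 1 ->
  0 <= x -> x < y -> 0 < e ->
  exists U Lw : {poly R},
    [/\ forall t : R, 0 <= t -> (y < t)%R%:R <= U.[t],
        forall t : R, 0 <= t -> Lw.[t] <= (x < t)%R%:R &
        moment_poly m U <= moment_poly m Lw + e].
Proof.
move=> gm m0 x0 xy e0; have e40 : 0 < e / 4 by rewrite divr_gt0.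
have [j [N [hx hy]]] := exp_step x0 xy e40.
have [L hL] : exists L, 2 ^+ N * ((N * j)%:R ^+ L * (m L / L`!%:R)) <= e / 4.
  have : 2 ^+ N * ((N * j)%:R ^+ n * (m n / n`!%:R)) @[n --> \oo] --> (2 ^+ N * 0 : R).
    by apply: cvgMl_tmp; exact: gm.
  rewrite mulr0 => /cvgr0Pnorm_le/(_ _ e40)[L _ /(_ L (leqnn L)) /= h].
  by exists L; exact: le_trans (ler_norm _) h.
have [p hp] := poly_approx_exp_power j N L.
pose C : R := 2 ^+ N * ((N * j)%:R ^+ L / L`!%:R).
have C0 : 0 <= C by rewrite !mulr_ge0// invr_ge0.
have q01 (t : R) : 0 <= t -> 0 <= (1 - expR (- (j%:R * t))) ^+ N <= 1.
  move=> t0; have u1 : 0 <= 1 - expR (- (j%:R * t)).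
    by rewrite subr_ge0 expR_le1 oppr_le0 mulr_ge0.
  by rewrite exprn_ge0// exprn_ile1// gerBl expR_ge0.
(* [C *: 'X^L] absorbs the Taylor error and [e / 4] the error of [exp_step]. *)
exists (p + C *: 'X^L + (e / 4)%:P), (p + (- C) *: 'X^L + (- (e / 4))%:P); split.
- move=> t t0; have := hp t t0; rewrite ler_norml -/C !hornerE.
  case/andP=> _ h; have /andP[q0 _] := q01 t t0.
  case: ltP => [yt|_] /=; last by lra.
  by have := hy t yt; lra.
- move=> t t0; have := hp t t0; rewrite ler_norml -/C !hornerE.
  case/andP=> h _; have /andP[_ q1] := q01 t t0.
  case: ltP => [yt|tx] /=; first by lra.
  have := hx t; rewrite t0 tx => /(_ isT); lra.
rewrite !moment_polyD !moment_polyZ !moment_polyXn !moment_polyC m0 mulNr.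
have -> : C * m L = 2 ^+ N * ((N * j)%:R ^+ L * (m L / L`!%:R)).
  by rewrite /C; field; rewrite pnatr_eq0 -lt0n fact_gt0.
move: hL; move: (2 ^+ N * _) (moment_poly m p) => K M hL.
lra.
Qed.

End PolySandwich.

(** * Growth of the Airy moments *)

Section AiryGrowth.
Variable R : realType.
Local Open Scope classical_set_scope.
Local Open Scope ring_scope.
Local Notation H := (hurwitz R).

Definition airy_moments : H := fun k => k`!%:R * airy_rho R (k%:Z - 1).

Lemma airy_moments0 : airy_moments 0%N = 1.
Proof. by rewrite /airy_moments fact0 mul1r. Qed.

Lemma airy_momentsE k : airy_moments k / k`!%:R = airy_rho R (k%:Z - 1).
Proof.
by rewrite /airy_moments mulrC mulKf// pnatr_eq0 -lt0n fact_gt0.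
Qed.

Lemma airy_moments_ge0 k : 0 <= airy_moments k.
Proof.
apply: (cvgr_to_ge (@scaled_moments_cvg R k)); near=> n.
have [_ /(_ k) h] := has_moments_scaled R n.
rewrite -lee_fin -h; apply: integral_ge0 => x _.
by rewrite lee_fin exprn_ge0.
Unshelve. all: by end_near. Qed.

Lemma airy_rhoS k : airy_rho R k.+1%:Z = Num.sqrt pi /
  (2 `^ ((3 * k.+1%:R - 1) / 2) * (2 * gauss_moment R (3 * k).+2)) * airy_c R k.+1.
Proof.
rewrite /airy_rho; congr (_ / (_ * _) * _).
rewrite -Gamma_half; congr (Gamma (_ / 2)).
by rewrite -natrM; congr (_%:R); lia.
Qed.

(** The sign comes from $\rho_{k+1}$, which up to a factorial is a limit of moments of positive
    measures. *)
Lemma airy_c_ge0 k : 0 <= airy_c R k.+1.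
Proof.
have := airy_moments_ge0 k.+2; rewrite /airy_moments pmulr_rge0; last first.
  by rewrite ltr0n fact_gt0.
have -> : k.+2%:Z - 1 = k.+1%:Z by lia.
rewrite airy_rhoS pmulr_rge0// divr_gt0 ?sqrtr_gt0 ?pi_gt0//.
by rewrite !mulr_gt0 ?powR_gt0 ?gauss_moment_gt0.
Qed.

(** The denominator is $\Gamma(3(k+1)/2)/2$, which outgrows $a^k(k+1)!$ for every [a]. *)
Definition growth_ratio (a : R) k := a ^+ k * (k.+1)`!%:R / gauss_moment R (3 * k).+2.

Lemma airy_rho_le k : airy_rho R k.+1%:Z <= Num.sqrt pi * (3 / 2) * growth_ratio (3 / 2) k.
Proof.
have J0 := gauss_moment_gt0 R (3 * k).+2.
have c1 : airy_c R k.+1 <= (k.+1)`!%:R * (3 / 2) ^+ k.+1.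
  by apply: airy_c_le => // -[//|j] _; exact: airy_c_ge0.
have c0 := airy_c_ge0 k.
have : 2 `^ 0 <= 2 `^ ((3 * k.+1%:R - 1) / 2) :> R.
  by rewrite ler_powR ?ler1n// divr_ge0// subr_ge0 -natrM ler1n.
rewrite powRr0 airy_rhoS /growth_ratio.
move: (gauss_moment _ _) (_ `^ _) J0 => J p J0 p1.
have p0 : 0 < p by exact: lt_le_trans p1.
have -> : Num.sqrt pi * (3 / 2) * ((3 / 2) ^+ k * (k.+1)`!%:R / J) =
    Num.sqrt pi / J * ((k.+1)`!%:R * (3 / 2) ^+ k.+1).
  by rewrite exprS; field; rewrite lt0r_neq0.
have p2 : 0 < p * (2 * J) by rewrite !mulr_gt0.
apply: ler_pM => //; first by rewrite divr_ge0 ?sqrtr_ge0// ltW.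
rewrite ler_wpM2l ?sqrtr_ge0// lef_pV2 ?posrE// mulrA ler_peMl ?(ltW J0)//.
by rewrite mulr_ege1// ler1n.
Qed.

Lemma growth_ratio_ge0 a k : 0 <= a -> 0 <= growth_ratio a k.
Proof.
move=> a0; rewrite /growth_ratio divr_ge0 ?mulr_ge0 ?exprn_ge0//.
exact: ltW (gauss_moment_gt0 _ _).
Qed.

Lemma gauss_momentSS m : gauss_moment R m.+2 = m.+1%:R / 2 * gauss_moment R m.
Proof. by []. Qed.

Lemma growth_ratioSS (a : R) k : 0 <= a -> 2 * a ^+ 2 <= 3 * k.+1%:R ->
  growth_ratio a k.+2 <= growth_ratio a k.
Proof.
move=> a0 ak; have J0 := gauss_moment_gt0 R (3 * k).+2.
set n := (3 * k)%N in J0 *.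
have -> : growth_ratio a k.+2 = growth_ratio a k *
    (8 * a ^+ 2 * (k.+3%:R * k.+2%:R) / (n.+2.+2.+2.+1%:R * n.+2.+2.+1%:R * n.+2.+1%:R)).
  rewrite /growth_ratio -/n (_ : (3 * k.+2) = n.+2.+2.+2)%N; last by rewrite /n; lia.
  rewrite (gauss_momentSS n.+2.+2.+2) (gauss_momentSS n.+2.+2) (gauss_momentSS n.+2).
  rewrite (factS k.+2) (factS k.+1) !natrM (exprS _ k.+1) (exprS _ k).
  have u0 : n.+2.+2.+2.+1%:R != 0 :> R by rewrite pnatr_eq0.
  have v0 : n.+2.+2.+1%:R != 0 :> R by rewrite pnatr_eq0.
  have w0 : n.+2.+1%:R != 0 :> R by rewrite pnatr_eq0.
  move: (gauss_moment R n.+2) J0 u0 v0 w0 => J J0.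
  move: (n.+2.+2.+2.+1%:R : R) (n.+2.+2.+1%:R : R) (n.+2.+1%:R : R) => u v w u0 v0 w0.
  move: (k.+3%:R : R) (k.+2%:R : R) ((k.+1)`!%:R : R) (a ^+ k) => x y z t.
  by field; rewrite u0 v0 w0 lt0r_neq0.
apply: ler_piMr; first exact: growth_ratio_ge0.
rewrite ler_pdivrMr; last by rewrite !mulr_gt0.
rewrite mul1r; apply: (@le_trans _ _ (4 * (3 * k.+1%:R) * (k.+3%:R * k.+2%:R))).
  apply: ler_wpM2r; first by rewrite mulr_ge0.
  lra.
rewrite -!natrM ler_nat /n; nia.
Qed.

Lemma growth_ratio_bounded (a : R) : 0 <= a -> exists B, forall k, growth_ratio a k <= B.
Proof.
move=> a0; pose K := (Num.truncn (2 * a ^+ 2)).+1.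
have hK k : (K <= k)%N -> growth_ratio a k.+2 <= growth_ratio a k.
  move=> Kk; apply: growth_ratioSS => //.
  apply: (le_trans (ltW (truncnS_gt _))); rewrite -/K -natrM ler_nat; lia.
have B0 k := growth_ratio_ge0 k a0.
exists (\sum_(i < K.+2) growth_ratio a i) => k.
have small i : (i < K.+2)%N -> growth_ratio a i <= \sum_(i < K.+2) growth_ratio a i.
  by move=> iK; rewrite (bigD1 (Ordinal iK))//= lerDl sumr_ge0.
have [kK|Kk] := ltnP k K; first by apply: small; lia.
rewrite -(subnK Kk); move: (k - K)%N => i.
elim/nat_ind2: i => [||i IH]; [by apply: small|by apply: small|].
by apply: le_trans IH; apply: hK; rewrite leq_addl.
Qed.

Lemma airy_moments_growth (h : nat) :
  h%:R ^+ n * (airy_moments n / n`!%:R) @[n --> \oo] --> 0.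
Proof.
pose a : R := 3 / 2 * h%:R; have a0 : 0 <= a by rewrite mulr_ge0.
(* Boundedness at [2 * a] gives geometric decay at [a]. *)
have [|B hB] := @growth_ratio_bounded (2 * a); first by rewrite mulr_ge0.
pose C := h%:R ^+ 2 * (Num.sqrt pi * (3 / 2)) * B.
have le k : h%:R ^+ k.+2 * (airy_moments k.+2 / (k.+2)`!%:R) <= C * 2^-1 ^+ k.
  rewrite airy_momentsE (_ : k.+2%:Z - 1 = k.+1%:Z); last by lia.
  have h1 : h%:R ^+ k.+2 * airy_rho R k.+1%:Z <= h%:R ^+ k.+2 * (Num.sqrt pi * (3 / 2) * growth_ratio (3 / 2) k).
    by rewrite ler_wpM2l ?exprn_ge0// airy_rho_le.
  apply: (le_trans h1).
  have -> : h%:R ^+ k.+2 * (Num.sqrt pi * (3 / 2) * growth_ratio (3 / 2) k) =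
      h%:R ^+ 2 * (Num.sqrt pi * (3 / 2)) * growth_ratio (2 * a) k * 2^-1 ^+ k.
    rewrite /growth_ratio /a !exprMn !exprVn !exprS.
    have t0 : 2 ^+ k != 0 :> R by rewrite expf_neq0.
    have := lt0r_neq0 (gauss_moment_gt0 R (3 * k).+2).
    move: (gauss_moment _ _) (2 ^+ k) t0 => J t t0 J0.
    by field; rewrite t0 J0.
  apply: ler_wpM2r; first by rewrite exprn_ge0// invr_ge0.
  apply: ler_wpM2l; last exact: hB.
  by rewrite mulr_ge0 ?exprn_ge0// mulr_ge0 ?sqrtr_ge0// divr_ge0.
rewrite -(cvg_shiftn 2)/=.
apply: (@squeeze_cvgr _ _ _ _ (cst 0) (fun n => C * 2^-1 ^+ n)).
- near=> n; rewrite addn2 le andbT mulr_ge0// divr_ge0//; exact: airy_moments_ge0.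
- exact: cvg_cst.
- rewrite -[X in _ --> X](mulr0 C); apply: cvgMl_tmp; apply: cvg_expr.
  by rewrite ger0_norm// invf_lt1 ?ltr1n.
Unshelve. all: by end_near. Qed.

End AiryGrowth.

(** * Distribution functions and moments *)

Section Tails.
Variable R : realType.
Local Open Scope classical_set_scope.
Local Open Scope ring_scope.
Local Notation mR := (measurableTypeR R).
Local Notation H := (hurwitz R).
Local Notation neg := (`]-oo, 0%R[%classic : set mR).

Lemma integrable_norm_poly (mu : {measure set mR -> \bar R}) (M : H) (p : {poly R}) :
  has_moments mu M -> mu.-integrable [set: mR] (fun x : mR => (p.[`|x|])%:E).
Proof.
move=> [_ muM].
have -> : (fun x : mR => (p.[`|x|])%:E) =
    (fun x : mR => \sum_(i < size p) (p`_i)%:E * (`|x| ^+ i)%:E)%E.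
  by apply/funext => x; rewrite horner_coef -sumEFin; apply: eq_bigr => i _; rewrite EFinM.
apply: integrable_sum => // i _; apply: integrableZl => //.
apply/integrableP; split; first exact: measurable_normX.
under eq_integral do rewrite gee0_abs ?lee_fin ?exprn_ge0//.
by rewrite muM ltry.
Qed.

Lemma integral_norm_poly (mu : {measure set mR -> \bar R}) (M : H) (p : {poly R}) :
  has_moments mu M -> (\int[mu]_x (p.[`|x|])%:E = (moment_poly M p)%:E)%E.
Proof.
move=> muM; have [_ muE] := muM.
have ik i : mu.-integrable [set: mR] (fun x : mR => (`|x| ^+ i)%:E).
  have := integrable_norm_poly 'X^i muM.
  by congr (integrable _ _ _); apply/funext => x; rewrite hornerXn.
transitivity (\int[mu]_x (\sum_(i < size p) (p`_i)%:E * (`|x| ^+ i)%:E))%E.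
  apply: eq_integral => x _.
  by rewrite horner_coef -sumEFin; apply: eq_bigr => i _; rewrite EFinM.
rewrite integral_sum//; last by move=> i; apply: integrableZl.
rewrite -sumEFin; apply: eq_bigr => i _.
by rewrite integralZl// muE EFinM.
Qed.

Lemma measure_le_ge0 (mu : {measure set mR -> \bar R}) (A B : set mR) : mu neg = 0%E ->
  measurable A -> measurable B -> (forall x : R, 0 <= x -> A x -> B x) ->
  (mu A <= mu B)%E.
Proof.
move=> mu0 mA mB AB; have mneg : measurable neg by exact: measurable_itv.
apply: (@le_trans _ _ (mu (B `|` neg))).
  rewrite le_measure ?inE//; first exact: measurableU.
  move=> x Ax; have [x0|x0] := leP 0 x; first by left; exact: AB.
  by right; rewrite /= in_itv.
apply: (le_trans (measureU2 _ mB mneg)).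
have mu0' : (mu neg <= 0)%E by rewrite mu0.
by rewrite -[leRHS]adde0; exact: leeD.
Qed.

Definition cdfR (mu : set mR -> \bar R) (x : R) : R := fine (mu `]-oo, x]%classic).

Section Probability.
Variables (P : probability mR R) (M : H).
Hypothesis PM : has_moments P M.

Let T (y : R) : set mR := [set t : mR | y < `|t|].

Let mT y : measurable (T y).
Proof.
have : measurable_fun [set: mR] (fun t : mR => `|t|) by exact: normr_measurable.
move=> /(_ measurableT `]y, +oo[%classic (measurable_itv _)); rewrite setTI.
by congr measurable; apply/seteqP; split => t /=; rewrite in_itv/= andbT.
Qed.

Let mitv (y : R) : measurable (`]y, +oo[%classic : set mR).
Proof. exact: measurable_itv. Qed.

Lemma cdfRE y : P `]-oo, y]%classic = (cdfR P y)%:E.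
Proof. by rewrite fineK// fin_num_measure//; exact: measurable_itv. Qed.

Lemma cdfR_le1 y : cdfR P y <= 1.
Proof. by rewrite -lee_fin -cdfRE probability_le1//; exact: measurable_itv. Qed.

Lemma cdfR_ge0 y : 0 <= cdfR P y.
Proof. by rewrite -lee_fin -cdfRE. Qed.

Lemma cdfR_nd x y : x <= y -> cdfR P x <= cdfR P y.
Proof.
move=> xy; rewrite -lee_fin -!cdfRE le_measure ?inE//; try exact: measurable_itv.
by move=> t /=; rewrite !in_itv/= => /le_trans; exact.
Qed.

Lemma cdfR_neg y : y < 0 -> cdfR P y = 0.
Proof.
move=> y0; apply/eqP; rewrite eq_le cdfR_ge0 andbT -lee_fin -cdfRE.
apply: (@le_trans _ _ (P neg)); last by rewrite (proj1 PM).
rewrite le_measure ?inE//; try exact: measurable_itv.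
by move=> t /=; rewrite !in_itv/= => /le_lt_trans; exact.
Qed.

Lemma tailE y : P `]y, +oo[%classic = (1 - cdfR P y)%:E.
Proof.
by rewrite -setCitvl probability_setC; [rewrite cdfRE EFinB|exact: measurable_itv].
Qed.

Lemma cdfR_ge (U : {poly R}) y : (forall t : R, 0 <= t -> (y < t)%R%:R <= U.[t]) ->
  1 - moment_poly M U <= cdfR P y.
Proof.
move=> hU; rewrite lerBlDr -lerBlDl -lee_fin -tailE -(integral_norm_poly _ PM).
apply: (@le_trans _ _ (P (T y))).
  rewrite le_measure ?inE// => t /=; rewrite in_itv/= andbT => /lt_le_trans; apply.
  exact: ler_norm.
rewrite -[T y]setIT -integral_indic//; apply: le_integral => //.
- exact: integrable_indic.
- exact: integrable_norm_poly PM.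
- by move=> t _; rewrite lee_fin indicE mem_setE; exact: hU.
Qed.

Lemma cdfR_le (L : {poly R}) x : 0 <= x -> (forall t : R, 0 <= t -> L.[t] <= (x < t)%R%:R) ->
  cdfR P x <= 1 - moment_poly M L.
Proof.
move=> x0 hL; rewrite lerBrDl -lerBrDr -lee_fin -tailE -(integral_norm_poly _ PM).
apply: (@le_trans _ _ (P (T x))).
  rewrite -[T x]setIT -integral_indic//; apply: le_integral => //.
  - exact: integrable_norm_poly PM.
  - exact: integrable_indic.
  - by move=> t _; rewrite lee_fin indicE mem_setE; exact: hL.
apply: measure_le_ge0 => //; first exact: (proj1 PM).
by move=> t t0; rewrite /T/= in_itv/= andbT ger0_norm.
Qed.

End Probability.

(** The threshold [t] depends on the limit moments only and is chosen before the sequence, so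
    different sequences with the same limit moments can be compared. *)
Lemma cdfR_sandwich (m : H) (x y e : R) :
  (forall h : nat, h%:R ^+ n * (m n / n`!%:R) @[n --> \oo] --> 0) -> m 0%N = 1 ->
  x < y -> 0 < e ->
  exists t, forall (P : nat -> probability mR R) (M : nat -> H),
    (forall n, has_moments (P n) (M n)) ->
    (forall k, M n k @[n --> \oo] --> m k) ->
    \forall n \near \oo, cdfR (P n) x <= t + e /\ t - e <= cdfR (P n) y.
Proof.
move=> gm m0 xy e0; have [x0|x0] := ltP x 0.
  exists 0 => P M PM Mm; near=> n; split.
    by rewrite (cdfR_neg (PM n)) // add0r ltW.
  by rewrite sub0r (le_trans _ (cdfR_ge0 _ _))// oppr_le0 ltW.
have e20 : 0 < e / 2 by rewrite divr_gt0.
have [U [L [hU hL UL]]] := poly_sandwich gm m0 x0 xy e20.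
exists (1 - moment_poly m L) => P M PM Mm; near=> n.
have h1 := cdfR_le (PM n) x0 hL; have h2 := cdfR_ge (PM n) hU.
have : `|moment_poly m L - moment_poly (M n) L| <= e / 2.
  by near: n; move/cvgrPdist_le: (@moment_poly_cvg R M m L Mm); apply.
have : `|moment_poly m U - moment_poly (M n) U| <= e / 2.
  by near: n; move/cvgrPdist_le: (@moment_poly_cvg R M m U Mm); apply.
rewrite !ler_norml => /andP[a1 a2] /andP[b1 b2]; split; lra.
Unshelve. all: by end_near. Qed.

End Tails.

(** * Existence of a limit with given moments *)

Section LimitCdf.
Variable R : realType.
Local Open Scope classical_set_scope.
Local Open Scope ring_scope.
Local Notation mR := (measurableTypeR R).
Local Notation H := (hurwitz R).
Local Notation neg := (`]-oo, 0%R[%classic : set mR).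

Variables (m : H) (P : nat -> probability mR R) (M : nat -> H).
Hypothesis growth : forall h : nat, h%:R ^+ n * (m n / n`!%:R) @[n --> \oo] --> 0.
Hypothesis m0 : m 0%N = 1.
Hypothesis PM : forall n, has_moments (P n) (M n).
Hypothesis Mm : forall k, M n k @[n --> \oo] --> m k.

Let F n x := cdfR (P n) x.
Let bounds x : set R := [set t | exists2 y, x < y & \forall n \near \oo, F n y <= t].

(* The right-continuous version of the upper limit of the distribution functions. *)
Definition limit_cdf (x : R) : R := inf (bounds x).
Local Notation G := limit_cdf.

Let bounds1 x : bounds x 1.
Proof. by exists (x + 1); [rewrite ltrDl|near=> n; exact: cdfR_le1]. Unshelve. all: by end_near. Qed.

Let bounds_lb x : lbound (bounds x) 0.
Proof.
move=> t [y _ [N _ /(_ N (leqnn N)) /= h]]; exact: le_trans (cdfR_ge0 _ _) h.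
Qed.

Let bounds_inf x : has_inf (bounds x).
Proof. by split; [exists 1; exact: bounds1|exists 0; exact: bounds_lb]. Qed.

Let limit_cdf_lb x t : bounds x t -> G x <= t.
Proof. by apply: ge_inf; case: (bounds_inf x). Qed.

Lemma limit_cdf_ge0 x : 0 <= G x.
Proof. by apply: lb_le_inf; [exists 1; exact: bounds1|exact: bounds_lb]. Qed.

(** An upper limit alone would not give this bound. Applied between the midpoint and [y],
    [cdfR_sandwich] bounds the late distribution functions on both sides of one threshold. *)
Lemma limit_cdf_near_le x y e : x < y -> 0 < e -> \forall n \near \oo, G x <= F n y + e.
Proof.
move=> xy e0; have e20 : 0 < e / 2 by rewrite divr_gt0.
pose z := (x + y) / 2.
have xz : x < z by rewrite /z; lra.
have zy : z < y by rewrite /z; lra.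
have [t /(_ P M PM Mm) ht] := cdfR_sandwich growth m0 zy e20.
have Gt : G x <= t + e / 2.
  apply: limit_cdf_lb; exists z => //.
  by apply: filterS ht => n [].
by apply: filterS ht => n [_ h]; rewrite /F; lra.
Qed.

Lemma limit_cdf_near_ge x e : 0 < e -> \forall n \near \oo, F n x <= G x + e.
Proof.
move=> e0; have [t [y xy yt] te] := inf_adherent e0 (bounds_inf x).
apply: filterS yt => n h; apply: le_trans (ltW te); apply: le_trans h.
by apply: cdfR_nd; exact: ltW.
Qed.

Lemma limit_cdf_nd : nondecreasing G.
Proof.
move=> x y xy; apply: lb_le_inf; first by exists 1; exact: bounds1.
move=> t [z yz h]; apply: limit_cdf_lb; exists z => //; exact: le_lt_trans yz.
Qed.

Lemma limit_cdf_rc : right_continuous G.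
Proof.
move=> x; apply/cvgrPdist_le => e e0.
have [t [y xy yt] te] := inf_adherent e0 (bounds_inf x).
near=> z.
have xz : x <= z by near: z; exact: nbhs_right_ge.
have Gxz := limit_cdf_nd xz.
rewrite distrC ger0_norm ?subr_ge0// lerBlDl (le_trans _ (ltW te))//.
by apply: limit_cdf_lb; exists y => //; near: z; exact: nbhs_right_lt.
Unshelve. all: by end_near. Qed.

Lemma limit_cdf_neg x : x < 0 -> G x = 0.
Proof.
move=> x0; apply/eqP; rewrite eq_le limit_cdf_ge0 andbT.
apply: limit_cdf_lb; exists (x / 2); first by lra.
near=> n; rewrite /F (cdfR_neg (PM n))//; lra.
Unshelve. all: by end_near. Qed.

Lemma limit_cdf_le1 x : G x <= 1.
Proof. by apply: limit_cdf_lb; exact: bounds1. Qed.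

(** Markov's inequality with $m_1+1$ eventually bounding the first moments; this tightness ensures
    that no mass escapes. *)
Lemma limit_cdf_markov x : 0 < x -> 1 - (m 1%N + 1) / x <= G x.
Proof.
move=> x0; apply/ler_addgt0Pr => e e0.
have : \forall n \near \oo, M n 1%N <= m 1%N + 1.
  move/cvgrPdist_le: (@Mm 1%N) => /(_ 1 ltr01); apply: filterS => n.
  by rewrite ler_norml => /andP[h _]; lra.
move=> /(filterI (limit_cdf_near_ge x e0))[N _ /(_ N (leqnn N)) /= [h1 h2]].
apply: (le_trans _ h1).
have := @cdfR_ge R (P N) (M N) (PM N) (x^-1 *: 'X^1) x.
rewrite moment_polyZ moment_polyXn mulrC => h3; apply: le_trans (h3 _).
  by rewrite lerD2l lerN2 ler_wpM2r// invr_ge0 ltW.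
move=> t t0; rewrite hornerZ hornerXn; case: ltP => /= [xt|_].
  by rewrite mulrC expr1 ler_pdivlMr// mul1r ltW.
by rewrite mulr_ge0// invr_ge0 ltW.
Qed.

Let limit_cdfNy : G x @[x --> -oo] --> (0 : R).
Proof.
apply: cvg_near_cst; near=> x; apply: limit_cdf_neg; near: x; exact: nbhs_ninfty_lt.
Unshelve. all: by end_near. Qed.

Let limit_cdfy : G x @[x --> +oo] --> (1 : R).
Proof.
have m1 : 0 <= m 1%N.
  apply: (cvgr_to_ge (@Mm 1%N)); near=> n.
  have [_ /(_ 1%N) h] := PM n; rewrite -lee_fin -h; apply: integral_ge0 => x _.
  by rewrite lee_fin exprn_ge0.
apply/cvgrPdist_le => e e0; near=> x.
have x0 : 0 < x by near: x; exact: nbhs_pinfty_gt.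
rewrite ger0_norm ?subr_ge0 ?limit_cdf_le1// lerBlDr -lerBlDl.
apply: le_trans (limit_cdf_markov x0); rewrite lerD2l lerN2 ler_pdivrMr//.
rewrite -ler_pdivrMl// mulrC; near: x; exact: nbhs_pinfty_ge.
Unshelve. all: by end_near. Qed.

Lemma limit_probability : exists Q : probability mR R,
  forall x, Q `]-oo, x]%classic = (G x)%:E.
Proof.
pose f : cumulativeBounded 0 1 := HB.pack G
  (isCumulative.Build R _ R G limit_cdf_nd limit_cdf_rc)
  (isCumulativeBounded.Build R 0 1 G limit_cdfNy limit_cdfy).
exists (lebesgue_stieltjes_measure f) => x.
by have := cdf_lebesgue_stieltjes_id f x; rewrite /cdf /= /pushforward preimage_id.
Qed.

End LimitCdf.

(** * Fatou's lemma for the limit law *)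

Section LimitMoments.
Variable R : realType.
Local Open Scope classical_set_scope.
Local Open Scope ring_scope.
Local Notation mR := (measurableTypeR R).
Local Notation H := (hurwitz R).
Local Notation neg := (`]-oo, 0%R[%classic : set mR).

Lemma measure_ltv (mu : probability mR R) (a : R) (c : \bar R) :
  (forall s, (s < a)%R -> mu `]-oo, s]%classic <= c)%E -> (mu `]-oo, a[%classic <= c)%E.
Proof.
move=> h; pose A n : set mR := `]-oo, a - n.+1%:R^-1]%classic.
have -> : `]-oo, a[%classic = \bigcup_n A n.
  apply/seteqP; split => x; rewrite /= ?in_itv/=.
    move=> xa; have ax : 0 < a - x by rewrite subr_gt0.
    exists (Num.truncn (a - x)^-1) => //; rewrite /A/= in_itv/= lerBrDl -lerBrDr.
    by rewrite invf_ple ?posrE// ltW// truncnS_gt.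
  by move=> [n _]; rewrite /A/= in_itv/= => /le_lt_trans; apply; rewrite gtrBl invr_gt0.
have cv : mu (A n) @[n --> \oo] --> mu (\bigcup_n A n).
  apply: nondecreasing_cvg_mu => //.
  - by move=> n; exact: measurable_itv.
  - by apply: bigcup_measurable => n _; exact: measurable_itv.
  - move=> i j ij; apply/subsetPset => x; rewrite /A/= !in_itv/= => /le_trans; apply.
    by rewrite lerD2l lerN2 lef_pV2 ?posrE// ler_nat.
rewrite -(cvg_lim _ cv)//; apply: lime_le; first by apply/cvg_ex; exists (mu (\bigcup_n A n)).
by near=> n; apply: h; rewrite gtrBl invr_gt0.
Unshelve. all: by end_near. Qed.

(* Fatou's lemma for the tails, integrated by the layer cake formula. *)
Lemma fatou_tail (Q : probability mR R) (P : nat -> probability mR R)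
    (phi : mR -> R) (u : nat -> R) (c : R) :
  measurable_fun [set: mR] phi -> (forall x, 0 <= phi x) ->
  (forall r e : R, 0 <= r -> 0 < e ->
     \forall n \near \oo, (Q [set x | (r < phi x)%R] <= P n [set x | (r < phi x)%R] + e%:E)%E) ->
  (forall n, \int[P n]_x (phi x)%:E <= (u n)%:E)%E -> u n @[n --> \oo] --> c ->
  (\int[Q]_x (phi x)%:E <= c%:E)%E.
Proof.
move=> mphi phi0 tails Pu uc.
pose X : {mfun mR >-> R} := HB.pack phi (isMeasurableFun.Build _ _ _ _ phi mphi).
have tailX (P' : probability mR R) (r : R) :
    ccdf (X : {RV P' >-> R}) r = P' [set x | (r < phi x)%R].
  transitivity (P' (phi @^-1` `]r, +oo[%classic)); first by [].
  by rewrite preimage_itvoy.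
have layer (P' : probability mR R) : (\int[P']_x (phi x)%:E =
    \int[lebesgue_measure]_(r in `[0%R, +oo[) P' [set x | (r < phi x)%R])%E.
  have := @ge0_expectation_ccdf _ mR R P' X phi0.
  rewrite expectation_def => ->; apply: eq_integral => r _; exact: tailX.
have mtail (P' : probability mR R) :
    measurable_fun (`[0%R, +oo[%classic : set mR) (fun r : mR => P' [set x | (r < phi x)%R]).
  have := @ccdf_measurable _ mR R P' X; have -> : ccdf (X : {RV P' >-> R}) =
      (fun r : R => P' [set x | (r < phi x)%R]) by apply/funext => r; exact: tailX.
  exact: measurable_funTS.
rewrite layer.
have := @fatou _ _ R lebesgue_measure `[0%R, +oo[%classic (measurable_itv _)
  (fun n r => P n [set x | r < phi x]) (fun n => mtail (P n)) (fun n r _ => measure_ge0 _ _).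
have le1 : (limn_einf (fun n => \int[lebesgue_measure]_(r in `[0%R, +oo[) P n [set x | (r < phi x)%R]) <= c%:E)%E.
  rewrite limn_einf_lim.
  have uE : (u n)%:E @[n --> \oo] --> c%:E by apply/cvg_EFin; [exact: nearW|exact: uc].
  rewrite -(cvg_lim _ uE)//; apply: lee_lim; first exact: is_cvg_einfs.
    by apply/cvg_ex; exists c%:E.
  near=> n; apply: (@le_trans _ _ (\int[P n]_x (phi x)%:E)%E); last exact: Pu.
  by rewrite layer; apply: ereal_inf_lbound; exists n => /=.
move=> /le_trans/(_ le1); apply: le_trans.
apply: ge0_le_integral => //.
- apply: measurableT_comp => //; apply: measurable_fun_limn_esup => n.
  by apply: measurableT_comp => //; exact: (mtail (P n)).
move=> r; rewrite /= in_itv/= andbT => r0; apply/lee_addgt0Pr => e e0.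
rewrite -leeBlDr// limn_einf_lim; apply: lime_ge; first exact: is_cvg_einfs.
have [N _ hN] := tails r e r0 e0.
near=> n; apply: le_ereal_inf_tmp => _ [k /= nk <-].
rewrite EFinN leeBlDr//; apply: hN => /=; apply: leq_trans nk.
by near: n; exists N.
Unshelve. all: by end_near. Qed.

End LimitMoments.

(** * The moments of the limit law *)

Section MomentsOfLimit.
Variable R : realType.
Local Open Scope classical_set_scope.
Local Open Scope ring_scope.
Local Notation mR := (measurableTypeR R).
Local Notation H := (hurwitz R).
Local Notation neg := (`]-oo, 0%R[%classic : set mR).

Variables (m : H) (P : nat -> probability mR R) (M : nat -> H).
Hypothesis growth : forall h : nat, h%:R ^+ n * (m n / n`!%:R) @[n --> \oo] --> 0.
Hypothesis m0 : m 0%N = 1.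
Hypothesis PM : forall n, has_moments (P n) (M n).
Hypothesis Mm : forall k, M n k @[n --> \oo] --> m k.
Variable Q : probability mR R.
Hypothesis QE : forall x, Q `]-oo, x]%classic = (limit_cdf P x)%:E.

Let cdfQ x : cdfR Q x = limit_cdf P x.
Proof. by rewrite /cdfR QE. Qed.

Let Qneg : Q neg = 0%E.
Proof.
apply/eqP; rewrite eq_le measure_ge0 andbT.
by apply: measure_ltv => s s0; rewrite QE (limit_cdf_neg PM).
Qed.

Let mtail (phi : mR -> R) (r : R) : measurable_fun [set: mR] phi ->
  measurable ([set x | r < phi x] : set mR).
Proof.
move=> /(_ measurableT `]r, +oo[%classic (measurable_itv _)).
by rewrite setTI preimage_itvoy.
Qed.

Let mX k : measurable_fun [set: mR] (fun x : mR => `|x| ^+ k : R).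
Proof. by apply/measurable_EFinP; exact: measurable_normX. Qed.

Let root_lt k (x r : R) : (0 < k)%N -> 0 <= x -> 0 <= r ->
  (x ^+ k < r) = (x < r `^ k%:R^-1) /\ (r < x ^+ k) = (r `^ k%:R^-1 < x).
Proof.
move=> k0 x0 r0; have kr : (r `^ k%:R^-1) ^+ k = r.
  by rewrite -powR_mulrn ?powR_ge0// -powRrM mulVf ?powRr1// pnatr_eq0 -lt0n.
have p0 := powR_ge0 r k%:R^-1; move: (_ `^ _) kr p0 => p <- p0.
by rewrite !ltr_pXn2r ?nnegrE.
Qed.

Let tail_gt (a e : R) : 0 < e ->
  \forall n \near \oo, (Q `]a, +oo[%classic <= P n `]a, +oo[%classic + e%:E)%E.
Proof.
move=> e0; apply: filterS (limit_cdf_near_ge P a e0) => n h.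
rewrite !tailE cdfQ -EFinD lee_fin; lra.
Qed.

Let tail_lt (a e : R) : 0 < e ->
  \forall n \near \oo, (Q `]-oo, a[%classic <= P n `]-oo, a[%classic + e%:E)%E.
Proof.
move=> e0; have e20 : 0 < e / 2 by rewrite divr_gt0.
have mitv : measurable (`]-oo, a[%classic : set mR) by exact: measurable_itv.
have [q qE] : exists q : R, Q `]-oo, a[%classic = q%:E.
  by exists (fine (Q `]-oo, a[%classic)); rewrite fineK// fin_num_measure.
have [s sa Gs] : exists2 s, s < a & q - e / 2 <= limit_cdf P s.
  apply: contrapT => h.
  have : (Q `]-oo, a[%classic <= (q - e / 2)%:E)%E.
    apply: measure_ltv => s sa; rewrite QE lee_fin leNgt; apply/negP => hs.
    by apply: h; exists s => //; exact: ltW.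
  by rewrite qE lee_fin lerBrDl gerDr leNgt e20.
pose t := (s + a) / 2.
have st : s < t by rewrite /t; lra.
have ta : t < a by rewrite /t; lra.
apply: filterS (limit_cdf_near_le growth m0 PM Mm st e20) => n h.
have hn : (P n `]-oo, t]%classic <= P n `]-oo, a[%classic)%E.
  rewrite le_measure ?inE//.
  by move=> x /=; rewrite !in_itv/= => /le_lt_trans; exact.
have := hn; rewrite cdfRE qE => hn'.
apply: (@le_trans _ _ ((cdfR (P n) t)%:E + e%:E)%E).
  rewrite -EFinD lee_fin; lra.
exact: leeD.
Qed.

Let moment_le k : (0 < k)%N -> (\int[Q]_x (`|x| ^+ k)%:E <= (m k)%:E)%E.
Proof.
move=> k0; apply: (@fatou_tail R Q P (fun x => `|x| ^+ k) (fun n => M n k) (m k) (mX k)).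
- by move=> x; rewrite exprn_ge0.
- move=> r e r0 e0; apply: filterS (tail_gt (r `^ k%:R^-1) e0) => n h.
  have mi : measurable (`]r `^ k%:R^-1, +oo[%classic : set mR) by exact: measurable_itv.
  apply: (@le_trans _ _ (Q `]r `^ k%:R^-1, +oo[%classic)).
    apply: measure_le_ge0 => //; first exact: mtail (mX k).
    move=> x x0 /=; rewrite in_itv/= andbT ger0_norm//.
    by rewrite (root_lt k0 x0 r0).2.
  apply: (le_trans h); apply: leeD => //.
  apply: measure_le_ge0 => //; [exact: (proj1 (PM n))|exact: mtail (mX k)|].
  move=> x x0 /=; rewrite in_itv/= andbT ger0_norm//.
  by rewrite (root_lt k0 x0 r0).2.
- by move=> n; rewrite (proj2 (PM n)).
- exact: Mm.
Qed.

(** Fatou's lemma only bounds integrals from above, so a lower bound for the moment is obtained from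
    $\max(0,A-y)$ with $y=|x|^k$. This is dominated by $A-y+y^2/A$, whose limiting mean is known. *)
Let moment_ge k (A : R) : (0 < k)%N -> 0 < A ->
  (\int[Q]_x (Num.max 0 (A - `|x| ^+ k))%:E <= (A - m k + m (k + k)%N / A)%:E)%E.
Proof.
move=> k0 A0; pose U : {poly R} := A%:P + (-1) *: 'X^k + A^-1 *: 'X^(k + k).
have UE (f : H) : moment_poly f U = A * f 0%N - f k + f (k + k)%N / A.
  rewrite /U !moment_polyD !moment_polyZ !moment_polyXn moment_polyC.
  by rewrite mulN1r [A^-1 * _]mulrC.
have mphi : measurable_fun [set: mR] (fun x : mR => Num.max 0 (A - `|x| ^+ k)).
  by apply: measurable_maxr => //; apply: measurable_funB => //; exact: mX.
have phi0 (x : mR) : 0 <= Num.max 0 (A - `|x| ^+ k) by rewrite le_max lexx.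
have phiE (r : R) (x : R) : 0 <= r -> (r < Num.max 0 (A - x ^+ k)) = (x ^+ k < A - r).
  by move=> r0; rewrite lt_max ltNge r0/= ltrBrDl -ltrBrDr.
apply: (@fatou_tail R Q P _ (fun n => moment_poly (M n) U) _ mphi phi0).
- move=> r e r0 e0; have [Ar|Ar] := ltP 0 (A - r); last first.
    near=> n; rewrite (_ : [set x | _] = set0) ?measure0 ?adde_ge0//.
      by rewrite lee_fin ltW.
    apply/seteqP; split => // x /=; rewrite phiE// => /lt_le_trans/(_ Ar).
    by rewrite ltNge exprn_ge0.
  apply: filterS (tail_lt ((A - r) `^ k%:R^-1) e0) => n h.
  have mi : measurable (`]-oo, (A - r) `^ k%:R^-1[%classic : set mR) by exact: measurable_itv.
  apply: (@le_trans _ _ (Q `]-oo, (A - r) `^ k%:R^-1[%classic)).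
    apply: measure_le_ge0 => //; first exact: mtail mphi.
    move=> x x0 /=; rewrite in_itv/= phiE// ger0_norm//.
    by rewrite (root_lt k0 x0 (ltW Ar)).1.
  apply: (le_trans h); apply: leeD => //.
  apply: measure_le_ge0 => //; [exact: (proj1 (PM n))|exact: mtail mphi|].
  move=> x x0 /=; rewrite in_itv/= phiE// ger0_norm//.
  by rewrite (root_lt k0 x0 (ltW Ar)).1.
- move=> n; rewrite -(integral_norm_poly U (PM n)).
  have mU : measurable_fun [set: mR] (fun x : mR => (U.[`|x|])%:E).
    by case/integrableP: (integrable_norm_poly U (PM n)).
  have le x : Num.max 0 (A - `|x| ^+ k) <= U.[`|x|].
    rewrite /U !hornerE exprD; set y := _ ^+ k.
    have y0 : 0 <= y by rewrite exprn_ge0.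
    have h : 0 <= A^-1 * (y * y) by rewrite !mulr_ge0// invr_ge0 ltW.
    rewrite ge_max; apply/andP; split; last lra.
    have -> : A + -1 * y + A^-1 * (y * y) = A^-1 * ((y - A / 2) ^+ 2 + 3 / 4 * A ^+ 2).
      by field; rewrite lt0r_neq0.
    by rewrite mulr_ge0 ?invr_ge0 ?(ltW A0)// addr_ge0 ?sqr_ge0// mulr_ge0 ?sqr_ge0.
  apply: ge0_le_integral => //.
  + by move=> x _; rewrite lee_fin.
  + exact/measurable_EFinP.
  + by move=> x _; rewrite lee_fin.
- have := @moment_poly_cvg R M m U Mm.
  by rewrite UE m0 mulr1.
Unshelve. all: by end_near. Qed.

(** The lower bound follows by integrating $A\le\max(0,A-|x|^k)+|x|^k$, with an error $m_{2k}/A$. *)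
Lemma has_moments_limit : has_moments Q m.
Proof.
split=> // -[|k].
  rewrite m0; under eq_integral do rewrite expr0.
  by rewrite integral_cst// mul1e; exact: probability_setT.
have k0 : (0 < k.+1)%N by []; move: k.+1 k0 => {}k k0.
have Qk0 : (0 <= \int[Q]_x (`|x| ^+ k)%:E)%E.
  by apply: integral_ge0 => x _; rewrite lee_fin exprn_ge0.
have Qle := moment_le k0.
have Qf : (\int[Q]_x (`|x| ^+ k)%:E)%E \is a fin_num.
  by rewrite ge0_fin_numE// (le_lt_trans Qle)// ltry.
apply/eqP; rewrite eq_le Qle/= -(fineK Qf) lee_fin; apply/ler_addgt0Pr => e e0.
have m2 : 0 <= m (k + k)%N.
  apply: (cvgr_to_ge (@Mm (k + k)%N)); near=> n.
  have [_ /(_ (k + k)%N) h] := PM n; rewrite -lee_fin -h; apply: integral_ge0 => x _.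
  by rewrite lee_fin exprn_ge0.
pose A := (m (k + k)%N + 1) / e.
have A0 : 0 < A by rewrite divr_gt0// ltr_wpDl.
have Ale : m (k + k)%N / A <= e.
  rewrite ler_pdivrMr// /A mulrC divfK ?lt0r_neq0//; lra.
have mphi : measurable_fun [set: mR] (fun x : mR => (Num.max 0 (A - `|x| ^+ k))%:E).
  apply/measurable_EFinP; apply: measurable_maxr => //.
  by apply: measurable_funB => //; exact: mX.
have : (A%:E <= \int[Q]_x ((Num.max 0 (A - `|x| ^+ k))%:E + (`|x| ^+ k)%:E))%E.
  have -> : A%:E = (\int[Q]_x (cst A%:E) x)%E.
    by rewrite integral_cst// [X in (_ * X)%E]probability_setT mule1.
  apply: ge0_le_integral => //.
  - by move=> x _; rewrite lee_fin ltW.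
  - by apply: emeasurable_funD => //; exact: measurable_normX.
  - by move=> x _; rewrite -EFinD lee_fin -lerBlDr le_max lexx orbT.
have p0 (x : mR) : (0 <= (Num.max 0 (A - `|x| ^+ k))%:E)%E by rewrite lee_fin le_max lexx.
have q0 (x : mR) : (0 <= (`|x| ^+ k)%:E)%E by rewrite lee_fin exprn_ge0.
rewrite (ge0_integralD Q measurableT (fun x _ => p0 x) mphi (fun x _ => q0 x) (@measurable_normX R k)).
move=> /le_trans/(_ (leeD (moment_ge k0 A0) (le_refl _))).
rewrite -(fineK Qf) -EFinD lee_fin; lra.
Unshelve. all: by end_near. Qed.

End MomentsOfLimit.

(** * Determinacy *)

Section Determinacy.
Variable R : realType.
Local Open Scope classical_set_scope.
Local Open Scope ring_scope.
Local Notation mR := (measurableTypeR R).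
Local Notation H := (hurwitz R).
Local Notation neg := (`]-oo, 0%R[%classic : set mR).

Let mE k : measurable_fun [set: mR] (fun x : mR => (x ^+ k)%:E).
Proof. by apply/measurable_EFinP; apply: measurable_funX. Qed.

Lemma integral_expr_norm (Q : probability mR R) k : Q neg = 0%E ->
  (\int[Q]_x (x ^+ k)%:E = \int[Q]_x (`|x| ^+ k)%:E)%E.
Proof.
move=> Q0; apply: ae_eq_integral => //; first exact: measurable_normX.
exists neg; split; [exact: measurable_itv|exact: Q0|].
move=> x /= h; rewrite in_itv/= ltNge; apply/negP => x0.
by apply: h => _; rewrite ger0_norm.
Qed.

Variable m : H.
Hypothesis growth : forall h : nat, h%:R ^+ n * (m n / n`!%:R) @[n --> \oo] --> 0.
Hypothesis m0 : m 0%N = 1.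

(** A single law [Q] on $[0,\infty[$ with these moments bounds polynomial means under every other
    law with the same moments, whatever its support. *)
Lemma moment_poly_le (Q : probability mR R) (p q : {poly R}) : has_moments Q m ->
  (forall x : R, 0 <= x -> p.[x] <= q.[x]) -> moment_poly m p <= moment_poly m q.
Proof.
move=> Qm pq; rewrite -lee_fin -!(integral_norm_poly _ Qm).
apply: le_integral => //; [exact: integrable_norm_poly Qm|exact: integrable_norm_poly Qm|].
by move=> x _; rewrite lee_fin pq.
Qed.

Section Unsigned.
Variable P : probability mR R.
Hypothesis PE : forall k, (\int[P]_x (x ^+ k)%:E = (m k)%:E)%E.

Let iP k : P.-integrable [set: mR] (fun x : mR => (x ^+ k)%:E).
Proof.
apply/integrableP; split; first exact: mE.
by rewrite integral_fin_num_abs// ?PE//; exact/measurable_EFinP.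
Qed.

Let polyE (p : {poly R}) :
  (fun x : mR => (p.[x])%:E) = (fun x : mR => \sum_(i < size p) (p`_i)%:E * (x ^+ i)%:E)%E.
Proof.
by apply/funext => x; rewrite horner_coef -sumEFin; apply: eq_bigr => i _; rewrite EFinM.
Qed.

Lemma integrable_poly (p : {poly R}) : P.-integrable [set: mR] (fun x : mR => (p.[x])%:E).
Proof.
by rewrite polyE; apply: integrable_sum => // i _; apply: integrableZl.
Qed.

Lemma integral_poly (p : {poly R}) : (\int[P]_x (p.[x])%:E = (moment_poly m p)%:E)%E.
Proof.
rewrite polyE integral_sum//; last by move=> i; apply: integrableZl.
by rewrite -sumEFin; apply: eq_bigr => i _; rewrite integralZl// PE EFinM.
Qed.

(* The odd-length Taylor polynomials of e^(-jx) are nonnegative, and at least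
   j|x| when x < 0; the growth condition bounds their mean values. *)
Lemma moments_support (Q : probability mR R) : has_moments Q m -> P neg = 0%E.
Proof.
move=> Qm.
have bound (j : nat) (e : R) : (0 < j)%N -> 0 < e ->
    (P `]-oo, (- e)%R]%classic <= (2 / (j%:R * e))%:E)%E.
  move=> j0 e0; have je : 0 < j%:R * e by rewrite mulr_gt0// ltr0n.
  have [N _ hN] : \forall n \near \oo, j%:R ^+ n * (m n / n`!%:R) <= 1.
    move/cvgr0Pnorm_le: (growth j) => /(_ 1 ltr01); apply: filterS => n.
    exact: le_trans (ler_norm _).
  (* Odd, so that the Taylor polynomial lies above $e^{-y}$ for $y\ge0$; beyond [N]; and long enough
     to contain the linear term. *)
  pose L := (2 * N).+3.
  have hL := hN L; rewrite /= /L in hL; have {}hL := hL (ltac:(lia)).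
  rewrite -/L in hL.
  pose S : {poly R} := exp_poly R L \Po (j%:R *: 'X).
  have SE x : S.[x] = (exp_poly R L).[j%:R * x] by rewrite horner_comp hornerZ hornerX.
  have oddL : (-1) ^+ L = -1 :> R.
    by rewrite /L mulnC -signr_odd /= oddM andbF.
  have S_ge0 x : 0 <= x -> 0 <= S.[x] <= 1 + (j%:R * x) ^+ L / L`!%:R.
    move=> x0; have jx : 0 <= j%:R * x by rewrite mulr_ge0.
    have /andP[h1 h2] := exp_poly_remainder L jx; rewrite SE.
    have h3 := expR_ge0 (- (j%:R * x)).
    have h4 : expR (- (j%:R * x)) <= 1 by rewrite expR_le1 oppr_le0.
    move: h1 h2; rewrite oddL => h1 h2; apply/andP; split; lra.
  have S_neg x : x < 0 -> - (j%:R * x) <= S.[x].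
    move=> x0; have jx : 0 <= - (j%:R * x) by rewrite oppr_ge0 mulr_ge0_le0// ltW.
    rewrite SE exp_polyE /L big_ord_recl big_ord_recl lift0 /= expr0 expr1 fact0 divr1.
    rewrite [1`!]factS fact0 muln1 divr1 addrCA lerDl addr_ge0// sumr_ge0// => i _.
    by rewrite divr_ge0// exprn_ge0.
  have h1 : ((j%:R * e)%:E * P `]-oo, (- e)%R]%classic <= (moment_poly m S)%:E)%E.
    have mI : measurable (`]-oo, (- e)%R]%classic : set mR) by exact: measurable_itv.
    have iI := integrable_indic P mI.
    rewrite -integral_poly -[X in P X]setIT -integral_indic// -integralZl//.
    apply: le_integral => //.
    - exact: integrableZl.
    - exact: integrable_poly.
    move=> x _; rewrite -EFinM lee_fin indicE mem_setE in_itv/=.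
    have [x0|x0] := leP 0 x.
      have -> : (x <= - e) = false.
        by apply/negbTE; rewrite -ltNge (lt_le_trans _ x0)// oppr_lt0.
      rewrite mulr0.
      by case/andP: (S_ge0 x x0).
    apply: (le_trans _ (S_neg x x0)); case: (leP x (- e)) => [xe|_] /=.
      by rewrite mulr1 -mulrN ler_wpM2l// lerNr.
    by rewrite mulr0 oppr_ge0 mulr_ge0_le0// ltW.
  (* The mean of [S] depends on the moments only, so it may be estimated under [Q], where only
     $x\ge0$ counts. *)
  have h2 : moment_poly m S <= 2.
    pose U : {poly R} := 1%:P + (j%:R ^+ L / L`!%:R) *: 'X^L.
    apply: (@le_trans _ _ (moment_poly m U)).
      apply: (moment_poly_le Qm) => x x0.
      have -> : U.[x] = 1 + (j%:R * x) ^+ L / L`!%:R.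
        by rewrite /U hornerD hornerC hornerZ hornerXn exprMn mulrAC.
      by case/andP: (S_ge0 x x0).
    rewrite /U moment_polyD moment_polyZ moment_polyXn moment_polyC m0 mul1r -mulrA [_^-1 * _]mulrC.
    lra.
  have Pf : P `]-oo, (- e)%R]%classic = (cdfR P (- e))%:E by rewrite cdfRE.
  move: h1; rewrite Pf -EFinM !lee_fin => h1.
  by rewrite ler_pdivlMr// mulrC (le_trans h1).
apply/eqP; rewrite eq_le measure_ge0 andbT.
apply: measure_ltv => s s0; apply/lee_addgt0Pr => e e0; rewrite add0e.
have s0' : 0 < - s by rewrite oppr_gt0.
have := bound (Num.truncn (2 / (- s * e))).+1 (- s) isT s0'.
rewrite opprK => /le_trans; apply; rewrite lee_fin.
rewrite ler_pdivrMr ?mulr_gt0// mulrC -mulrA -ler_pdivrMr ?mulr_gt0//.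
exact: ltW (truncnS_gt _).
Qed.

End Unsigned.
End Determinacy.

(** * Convergence to the Airy distribution *)

Section AiryLimit.
Variable R : realType.
Local Open Scope classical_set_scope.
Local Open Scope ring_scope.
Local Notation mR := (measurableTypeR R).
Local Notation am := (@airy_moments R).

Let scaled_mass n : scaled_omega R n setT = 1%E.
Proof.
rewrite (has_moments_mass (has_moments_scaled R n)) /scaled_moments.
rewrite omega_egf_cayley natr_expz_sub2 muln0 expr0 divr1.
by rewrite mulrA divfK ?divff ?expf_neq0.
Qed.

Definition scaled_mass1 n : set mR -> \bar R := scaled_omega R n.

HB.instance Definition _ n := Measure.copy (scaled_mass1 n) (scaled_omega R n).
HB.instance Definition _ n :=
  Measure_isProbability.Build _ _ _ (scaled_mass1 n) (scaled_mass n).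

Definition scaled_probability n : probability mR R := scaled_mass1 n.

Lemma scaled_probabilityE n A : scaled_probability n A = rescaled_omega R n.+1 A.
Proof. by []. Qed.

Let scaled_moments_of n : has_moments (scaled_probability n) (scaled_moments R n).
Proof. exact: has_moments_scaled. Qed.

Let am_cvg k : scaled_moments R n k @[n --> \oo] --> am k.
Proof. exact: scaled_moments_cvg. Qed.

Let growth := @airy_moments_growth R.
Let am0 := @airy_moments0 R.

Lemma airy_probability_exists : exists Q : probability mR R, has_moments Q am.
Proof.
have [Q QE] := limit_probability scaled_moments_of am_cvg.
exists Q; exact: (has_moments_limit growth am0 scaled_moments_of am_cvg QE).
Qed.

(** Existence of one law with the Airy moments is what makes the choice by [get] meaningful. *)
Lemma airy_distributionP : has_airy_moments (airy_distribution R).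
Proof.
have ex : exists Q, (@has_airy_moments R) Q.
  have [Q [Q0 QE]] := airy_probability_exists; exists Q => k.
  by rewrite integral_expr_norm// QE.
rewrite /airy_distribution; exact: getPex ex.
Qed.

Lemma has_moments_airy : has_moments (airy_distribution R) am.
Proof.
have [Q Qm] := airy_probability_exists.
have A0 := moments_support growth am0 airy_distributionP Qm.
by split=> // k; rewrite -integral_expr_norm// airy_distributionP.
Qed.

(** Continuity at [x] provides $y<x<z$ with nearly equal Airy distribution functions. The squeeze on
    $(y,x)$ and on $(x,z)$ is applied both to the rescaled laws and to the constant Airy sequence,
    with common thresholds. *)
Lemma cdfR_scaled_cvg (x : R) :
  {for x, continuous (fun t : R => airy_distribution R `]-oo, t]%classic)} ->
  cdfR (scaled_probability n) x @[n --> \oo] --> cdfR (airy_distribution R) x.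
Proof.
move=> cx; pose F := cdfR (airy_distribution R).
have cF : F t @[t --> x] --> F x.
  by apply: fine_cvg; rewrite -cdfRE; exact: cx.
apply/cvgrPdist_le => e e0; have e40 : 0 < e / 4 by rewrite divr_gt0.
move/cvgrPdist_le: cF => /(_ _ e40)[d /= d0 hd].
pose y := x - d / 2; pose z := x + d / 2.
have d20 : 0 < d / 2 by rewrite divr_gt0.
have Fy : `|F x - F y| <= e / 4.
  apply: hd; rewrite /y /= opprB addrC subrK gtr0_norm//; lra.
have Fz : `|F x - F z| <= e / 4.
  apply: hd; rewrite /z /= opprD addrA subrr add0r normrN gtr0_norm//; lra.
have yx : y < x by rewrite /y; lra.
have xz : x < z by rewrite /z; lra.
have [t ht] := cdfR_sandwich growth am0 yx e40.
have [s hs] := cdfR_sandwich growth am0 xz e40.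
have [a1 _] : F y <= t + e / 4 /\ t - e / 4 <= F x.
  have [|N _ /(_ N (leqnn N))//] := ht (fun=> airy_distribution R) (fun=> am) (fun=> has_moments_airy).
  by move=> k; exact: cvg_cst.
have [_ b2] : F x <= s + e / 4 /\ s - e / 4 <= F z.
  have [|N _ /(_ N (leqnn N))//] := hs (fun=> airy_distribution R) (fun=> am) (fun=> has_moments_airy).
  by move=> k; exact: cvg_cst.
near=> n.
have [_ a2] : cdfR (scaled_probability n) y <= t + e / 4 /\ t - e / 4 <= cdfR (scaled_probability n) x.
  by near: n; exact: ht scaled_moments_of am_cvg.
have [b1 _] : cdfR (scaled_probability n) x <= s + e / 4 /\ s - e / 4 <= cdfR (scaled_probability n) z.
  by near: n; exact: hs scaled_moments_of am_cvg.
move: Fy Fz; rewrite -/(F x) !ler_norml => /andP[c1 c2] /andP[c3 c4].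
apply/andP; split; lra.
Unshelve. all: by end_near. Qed.

Lemma cvg_airy : cvg_in_distribution (rescaled_omega R) (airy_distribution R).
Proof.
move=> x cx; rewrite -cvg_shiftS/=.
have -> : (fun n => rescaled_omega R n.+1 `]-oo, x]%classic) =
    (fun n => (cdfR (scaled_probability n) x)%:E).
  by apply/funext => n; rewrite -cdfRE.
rewrite cdfRE; apply/cvg_EFin; first exact: nearW.
exact: cdfR_scaled_cvg.
Qed.

Lemma tilde_omega_mass n : (0 < n)%N ->
  tilde_omega R n setT = ((ext_activity_poly (complete_graph n)).[1]%:~R)%:E /\
  (ext_activity_poly (complete_graph n)).[1]%:~R = n%:R ^ (n%:Z - 2) :> R.
Proof.
case: n => // n _; split; last by rewrite -omega_egf_mass omega_egf_cayley.
by rewrite (has_moments_mass (has_moments_omega R n)) omega_egf_mass.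
Qed.

End AiryLimit.

Theorem mainTheorem11 (R : realType) :
  (forall n : nat, (0 < n)%N ->
     tilde_omega R n setT
       = ((ext_activity_poly (complete_graph n)).[1]%:~R)%:E /\
     (ext_activity_poly (complete_graph n)).[1]%:~R = n%:R ^ (n%:Z - 2) :> R) /\
  cvg_in_distribution (rescaled_omega R) (airy_distribution R).
Proof. by split; [exact: tilde_omega_mass|exact: cvg_airy]. Qed.
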